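(* Let $n\ge 1$ be an integer. (a) Let $\Lambda$ be a finite-dimensional algebra and let $M$ be an $n$-cluster tilting object in $\operatorname{mod}\Lambda$. Then $\operatorname{End}_\Lambda(M)$ is an $n$-Auslander algebra. (b) Any $n$-Auslander algebra $\Gamma$ can be obtained in this way, i.e. $\Gamma\simeq\operatorname{End}_\Lambda(M)$ for some finite-dimensional algebra $\Lambda$ and some $n$-cluster tilting object $M$ in $\operatorname{mod}\Lambda$. This (the assignment sending the equivalence class of $\operatorname{add}M$ to the Morita-equivalence class of $\operatorname{End}_\Lambda(M)$) gives a bijection between the set of equivalence classes of $n$-cluster tilting categories with additive generators and the set of Morita-equivalence classes of $n$-Auslander algebras.
   Context: Finite-dimensional algebras are over a field $k$. Modules are right modules; $\operatorname{mod}\Lambda$ is the category of finitely generated $\Lambda$-modules. For $M\in\operatorname{mod}\Lambda$, $\operatorname{add}M$ is the full subcategory of $\operatorname{mod}\Lambda$ consisting of direct summands of finite direct sums of copies of $M$. An additive category has an additive generator $M$ if every object is a direct summand of a finite direct sum of copies of $M$. A full subcategory $\mathcal C$ of $\mathcal X:=\operatorname{mod}\Lambda$ is functorially finite if for every $X\in\mathcal X$ there are morphisms $C\to X$ and $X\to C'$ with $C,C'\in\mathcal C$ such that every morphism from an object of $\mathcal C$ to $X$ factors through $C\to X$ and every morphism from $X$ to an object of $\mathcal C$ factors through $X\to C'$. The subcategory $\mathcal C$ is called $n$-cluster tilting if it is functorially finite and $$\mathcal C=\{X\in\mathcal X\mid \operatorname{Ext}^i_\Lambda(C,X)=0\ \text{for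 all } C\in\mathcal C,\ 0<i<n\}=\{X\in\mathcal X\mid \operatorname{Ext}^i_\Lambda(X,C)=0\ \text{for all } C\in\mathcal C,\ 0<i<n\}.$$ An object $M\in\operatorname{mod}\Lambda$ is $n$-cluster tilting if $\operatorname{add}M$ is an $n$-cluster tilting subcategory. An additive category is called $n$-cluster tilting if it is equivalent to an $n$-cluster tilting subcategory of $\operatorname{mod}\Lambda$ for some finite-dimensional algebra $\Lambda$. For a finite-dimensional algebra $\Gamma$ with minimal injective resolution $0\to\Gamma\to I_0\to I_1\to\cdots$ of the $\Gamma$-module $\Gamma$, one writes $\operatorname{dom.dim}\Gamma\ge m$ if $I_i$ is a flat (equivalently, projective) $\Gamma$-module for all $0\le i<m$. A finite-dimensional algebra $\Gamma$ is called an $n$-Auslander algebra if $\operatorname{gl.dim}\Gamma\le n+1\le\operatorname{dom.dim}\Gamma$. *)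

(* Defs.v *)
From HB Require Import structures.
From mathcomp Require Import all_boot all_order all_algebra.

Set Implicit Arguments.
Unset Strict Implicit.
Unset Printing Implicit Defensive.

Import GRing.Theory.
Local Open Scope ring_scope.

Record preadditive := Preadditive {
  obj :> Type;
  mor : obj -> obj -> zmodType;
  idm : forall X, mor X X;
  mcomp : forall X Y Z, mor Y Z -> mor X Y -> mor X Z;
  mcomp1m : forall X Y (f : mor X Y), mcomp (idm Y) f = f;
  mcompm1 : forall X Y (f : mor X Y), mcomp f (idm X) = f;
  mcompA : forall X Y Z T (h : mor Z T) (g : mor Y Z) (f : mor X Y),
    mcomp h (mcomp g f) = mcomp (mcomp h g) f;
  mcompDl : forall X Y Z (g g' : mor Y Z) (f : mor X Y),
    mcomp (g + g') f = mcomp g f + mcomp g' f;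
  mcompDr : forall X Y Z (g : mor Y Z) (f f' : mor X Y),
    mcomp g (f + f') = mcomp g f + mcomp g f' }.

Arguments mor {p} X Y.
Arguments idm {p} X.
Arguments mcomp {p X Y Z} g f.

Notation "g \oc f" := (mcomp g f) (at level 40, left associativity).

Section Category.

Variable C : preadditive.

Definition is_iso (X Y : C) (f : mor X Y) : Prop :=
  exists g : mor Y X, g \oc f = idm X /\ f \oc g = idm Y.

Definition is_biproduct (I : finType) (X : I -> C) (S : C) : Prop :=
  exists (inj : forall i, mor (X i) S) (prj : forall i, mor S (X i)),
    [/\ forall i, prj i \oc inj i = idm (X i),
        forall i j, i != j -> prj j \oc inj i = 0
      & \sum_i inj i \oc prj i = idm S].

(* The case n = 0 provides the zero object. *)
Definition is_additive : Prop :=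
  forall (n : nat) (X : 'I_n -> C), exists S, is_biproduct X S.

Definition direct_summand (X S : C) : Prop :=
  exists Y : C, is_biproduct (fun b : bool => if b then X else Y) S.

Definition in_add (M X : C) : Prop :=
  exists (n : nat) (S : C),
    is_biproduct (fun _ : 'I_n => M) S /\ direct_summand X S.

Definition has_additive_generator : Prop := exists M : C, forall X, in_add M X.

Definition functorially_finite (P : C -> Prop) : Prop :=
  forall X : C,
    (exists (A : C) (f : mor A X), P A /\
       forall (B : C) (g : mor B X), P B -> exists h : mor B A, g = f \oc h)
    /\
    (exists (A : C) (f : mor X A), P A /\
       forall (B : C) (g : mor X B), P B -> exists h : mor A B, g = h \oc f).

Definition full_subcategory (P : C -> Prop) : preadditive :=
  @Preadditive {X : C | P X} (fun X Y => mor (sval X) (sval Y))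
    (fun X => idm (sval X))
    (fun _ _ _ g f => g \oc f)
    (fun _ _ f => mcomp1m f) (fun _ _ f => mcompm1 f)
    (fun _ _ _ _ h g f => mcompA h g f)
    (fun _ _ _ g g' f => mcompDl g g' f)
    (fun _ _ _ g f f' => mcompDr g f f').

End Category.

Record add_functor (C D : preadditive) := AddFunctor {
  fobj :> C -> D;
  fmap : forall X Y : C, mor X Y -> mor (fobj X) (fobj Y);
  fmap1 : forall X : C, fmap (idm X) = idm (fobj X);
  fmapM : forall (X Y Z : C) (g : mor Y Z) (f : mor X Y),
    fmap (g \oc f) = fmap g \oc fmap f;
  fmapD : forall (X Y : C) (f g : mor X Y), fmap (f + g) = fmap f + fmap g }.

Arguments fmap {C D} a {X Y} f.

(* Mutually quasi-inverse additive functors F and G, the natural isomorphisms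
   being eta : id -> G F and eps : F G -> id. *)
Definition equivalent (C D : preadditive) : Prop :=
  exists (F : add_functor C D) (G : add_functor D C)
    (eta : forall X : C, mor X (G (F X)))
    (eps : forall Y : D, mor (F (G Y)) Y),
    [/\ forall X, is_iso (eta X),
        forall Y, is_iso (eps Y),
        forall (X X' : C) (f : mor X X'),
          eta X' \oc f = fmap G (fmap F f) \oc eta X
      & forall (Y Y' : D) (g : mor Y Y'),
          eps Y' \oc fmap F (fmap G g) = g \oc eps Y].

(* Unlike [falgType], this structure allows the zero algebra, so that every
   module, zero or not, has an endomorphism algebra. The multiplication belongs
   to the mixin because the library has no structure of algebras over possibly
   zero rings; the ring structure is recovered just below. *)
HB.mixin Record isFDAlgebra (k : fieldType) A of Vector k A := {
  fdone : A;
  fdmul : A -> A -> A;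
  fdmulA : associative fdmul;
  fdmul1l : left_id fdone fdmul;
  fdmul1r : right_id fdone fdmul;
  fdmulDl : left_distributive fdmul +%R;
  fdmulDr : right_distributive fdmul +%R;
  fdmulZl : forall (c : k) (a b : A), c *: fdmul a b = fdmul (c *: a) b;
  fdmulZr : forall (c : k) (a b : A), c *: fdmul a b = fdmul a (c *: b) }.

#[short(type="fdAlgType")]
HB.structure Definition FDAlgebra (k : fieldType) :=
  {A of Vector k A & isFDAlgebra k A}.

HB.instance Definition _ (k : fieldType) (A : fdAlgType k) :=
  GRing.Zmodule_isPzRing.Build (FDAlgebra.sort A)
    fdmulA fdmul1l fdmul1r fdmulDl fdmulDr.

Definition fdalg_iso (k : fieldType) (A B : fdAlgType k) : Prop :=
  exists f : {linear A -> B},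
    [/\ bijective f, f 1 = 1 & forall a b, f (a * b) = f a * f b].

(* Over a finite-dimensional algebra the finitely generated right modules are
   the finite-dimensional vector spaces with a bilinear right action. *)
HB.mixin Record isRModule (k : fieldType) (A : fdAlgType k) V
    of Vector k V := {
  ract : V -> A -> V;
  ract_linearl : forall (c : k) (u v : V) (a : A),
    ract (c *: u + v) a = c *: ract u a + ract v a;
  ract_linearr : forall (c : k) (v : V) (a b : A),
    ract v (c *: a + b) = c *: ract v a + ract v b;
  ract1 : forall v : V, ract v 1 = v;
  ractM : forall (v : V) (a b : A), ract v (a * b) = ract (ract v a) b }.

#[short(type="rmodType")]
HB.structure Definition RModule (k : fieldType) (A : fdAlgType k) :=
  {V of Vector k V & isRModule k A V}.

Section Regular.

Variables (k : fieldType) (A : fdAlgType k).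

Definition regular_rmod : Type := A.

HB.instance Definition _ := Vector.on regular_rmod.

Fact regular_linearl (c : k) (u v : regular_rmod) (a : A) :
  (c *: u + v : A) * a = c *: (u * a : A) + (v * a : A).
Proof. by rewrite mulrDl -[(c *: u) * a]fdmulZl. Qed.

Fact regular_linearr (c : k) (v : regular_rmod) (a b : A) :
  (v : A) * (c *: a + b) = c *: (v * a : A) + (v * b : A).
Proof. by rewrite mulrDr -[v * (c *: a)]fdmulZr. Qed.

HB.instance Definition _ := isRModule.Build k A regular_rmod
  regular_linearl regular_linearr (@mulr1 A) (@mulrA A).

End Regular.

Section Homs.

Variables (k : fieldType) (A : fdAlgType k).
Implicit Types V W : rmodType A.

Definition ractl V (a : A) : 'End(V) := linfun (fun v : V => ract v a).

Fact ractlE V a (v : V) : ractl V a v = ract v a.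
Proof.
have lin : linear (fun v : V => ract v a) by move=> c u w; exact: ract_linearl.
pose f : {linear V -> V} :=
  HB.pack (fun v : V => ract v a) (GRing.isLinear.Build _ _ _ _ _ lin).
exact: (lfunE f v).
Qed.

Definition ract_defect V W (a : A) : 'Hom('Hom(V, W), 'Hom(V, W)) :=
  linfun (fun f : 'Hom(V, W) => (f \o ractl V a)%VF - (ractl W a \o f)%VF).

Fact ract_defectE V W a (f : 'Hom(V, W)) :
  ract_defect V W a f = (f \o ractl V a)%VF - (ractl W a \o f)%VF.
Proof.
pose F f : 'Hom(V, W) := (f \o ractl V a)%VF - (ractl W a \o f)%VF.
have lin : linear F.
  move=> c u w; rewrite /F comp_lfunDl comp_lfunDr -comp_lfunZl -comp_lfunZr.
  by rewrite scalerBr opprD addrACA.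
pose g : {linear 'Hom(V, W) -> 'Hom(V, W)} :=
  HB.pack F (GRing.isLinear.Build _ _ _ _ _ lin).
exact: (lfunE g f).
Qed.

(* The space of A-linear maps, see [rhomvP]. *)
Definition rhomv V W : {vspace 'Hom(V, W)} :=
  (\bigcap_i lker (ract_defect V W (tnth (vbasis {:A}) i)))%VS.

Lemma rhomvP V W (f : 'Hom(V, W)) :
  reflect (forall v a, f (ract v a) = ract (f v) a) (f \in rhomv V W).
Proof.
apply: (iffP subv_bigcapP) => [kf v a | fA i _]; last first.
  rewrite -memvE memv_ker ract_defectE subr_eq0; apply/eqP/lfunP => v.
  by rewrite !comp_lfunE !ractlE fA.
have fb i : f (ract v (tnth (vbasis {:A}) i)) =
            ract (f v) (tnth (vbasis {:A}) i).
  have := kf i isT; rewrite -memvE memv_ker ract_defectE subr_eq0.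
  by move=> /eqP/lfunP/(_ v); rewrite !comp_lfunE !ractlE.
have lin (U : rmodType A) (u : U) : linear (fun b : A => ract u b).
  by move=> c b b'; exact: ract_linearr.
pose r (U : rmodType A) (u : U) : {linear A -> U} :=
  HB.pack (fun b : A => ract u b) (GRing.isLinear.Build _ _ _ _ _ (lin U u)).
rewrite -[ract v a]/(r V v a) -[RHS]/(r W (f v) a).
rewrite (coord_vbasis (memvf a)) !linear_sum; apply: eq_bigr => i _.
by rewrite !linearZ /= -tnth_nth fb.
Qed.

Definition rHom V W := subvs_of (rhomv V W).

Coercion lfun_of_rHom V W (f : rHom V W) : 'Hom(V, W) := vsval f.

Lemma rHomE V W (f : rHom V W) v a : f (ract v a) = ract (f v) a.
Proof. exact/rhomvP/subvsP. Qed.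

Lemma rHom_inj V W (f g : rHom V W) : (forall v, f v = g v) -> f = g.
Proof. by move=> fg; apply/val_inj/lfunP. Qed.

Fact rhomv_id V : \1%VF \in rhomv V V.
Proof. by apply/rhomvP => v a; rewrite !id_lfunE. Qed.

Definition rid V : rHom V V := Subvs (rhomv_id V).

Fact rhomv_comp V W U (g : rHom W U) (f : rHom V W) :
  (vsval g \o vsval f)%VF \in rhomv V U.
Proof. by apply/rhomvP => v a; rewrite !comp_lfunE !rHomE. Qed.

Definition rcomp V W U (g : rHom W U) (f : rHom V W) : rHom V U :=
  Subvs (rhomv_comp g f).

Fact rcomp1m V W (f : rHom V W) : rcomp (rid W) f = f.
Proof. by apply/val_inj/comp_lfun1l. Qed.

Fact rcompm1 V W (f : rHom V W) : rcomp f (rid V) = f.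
Proof. by apply/val_inj/comp_lfun1r. Qed.

Fact rcompA V W U T (h : rHom U T) (g : rHom W U) (f : rHom V W) :
  rcomp h (rcomp g f) = rcomp (rcomp h g) f.
Proof. by apply/val_inj/comp_lfunA. Qed.

Fact rcompDl V W U (g g' : rHom W U) (f : rHom V W) :
  rcomp (g + g') f = rcomp g f + rcomp g' f.
Proof. by apply/val_inj/comp_lfunDl. Qed.

Fact rcompDr V W U (g : rHom W U) (f f' : rHom V W) :
  rcomp g (f + f') = rcomp g f + rcomp g f'.
Proof. by apply/val_inj/comp_lfunDr. Qed.

Definition modcat : preadditive :=
  @Preadditive (rmodType A) (fun V W => rHom V W) rid rcomp
    rcomp1m rcompm1 rcompA rcompDl rcompDr.

End Homs.

(* The product of End(M) is composition, f * g = f o g: a right module M is a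
   left module over its endomorphism algebra. *)
Definition endalg (k : fieldType) (A : fdAlgType k) (M : rmodType A) : Type :=
  rHom M M.

HB.instance Definition _ (k : fieldType) (A : fdAlgType k) (M : rmodType A) :=
  Vector.copy (endalg M) (rHom M M).

Fact endalg_scalel (k : fieldType) (A : fdAlgType k) (M : rmodType A)
    (c : k) (f g : endalg M) :
  c *: (rcomp f g : endalg M) = rcomp (c *: f : endalg M) g.
Proof. by apply/val_inj; rewrite /= comp_lfunZl. Qed.

Fact endalg_scaler (k : fieldType) (A : fdAlgType k) (M : rmodType A)
    (c : k) (f g : endalg M) :
  c *: (rcomp f g : endalg M) = rcomp f (c *: g : endalg M).
Proof. by apply/val_inj; rewrite /= comp_lfunZr. Qed.

HB.instance Definition _ (k : fieldType) (A : fdAlgType k) (M : rmodType A) :=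
  isFDAlgebra.Build k (endalg M)
    (@rcompA k A M M M M) (@rcomp1m k A M M) (@rcompm1 k A M M)
    (@rcompDl k A M M M) (@rcompDr k A M M M)
    (@endalg_scalel k A M) (@endalg_scaler k A M).

HB.instance Definition _ (k : fieldType) (A : fdAlgType k) (M : rmodType A) :=
  GRing.Zmodule_isPzRing.Build (endalg M)
    fdmulA fdmul1l fdmul1r fdmulDl fdmulDr.

Section Homological.

Variables (k : fieldType) (A : fdAlgType k).

(* Projectivity and injectivity are tested on finitely generated modules, which
   for a finitely generated module over a finite-dimensional algebra is the same
   as testing on all modules. *)
Definition projective (P : rmodType A) : Prop :=
  forall (V W : rmodType A) (g : rHom V W) (f : rHom P W),
    limg g = fullv -> exists h : rHom P V, f = rcomp g h.

Definition injective_rmod (I : rmodType A) : Prop :=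
  forall (V W : rmodType A) (g : rHom V W) (f : rHom V I),
    lker g = 0%VS -> exists h : rHom W I, f = rcomp h g.

Record proj_resolution (X : rmodType A) := ProjResolution {
  pr_obj :> nat -> rmodType A;
  pr_projective : forall i, projective (pr_obj i);
  pr_d : forall i, rHom (pr_obj i.+1) (pr_obj i);
  pr_aug : rHom (pr_obj 0) X;
  pr_aug_onto : limg pr_aug = fullv;
  pr_exact0 : limg (pr_d 0) = lker pr_aug;
  pr_exact : forall i, limg (pr_d i.+1) = lker (pr_d i) }.

Definition ext_cocycle X (P : proj_resolution X) (Y : rmodType A) (i : nat)
    (g : rHom (P i) Y) : Prop :=
  rcomp g (pr_d P i) = 0.

Definition ext_coboundary X (P : proj_resolution X) (Y : rmodType A) (i : nat) :
    rHom (P i) Y -> Prop :=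
  if i is j.+1 return rHom (P i) Y -> Prop
  then fun g => exists h : rHom (P j) Y, g = rcomp h (pr_d P j)
  else fun g => g = 0.

(* Ext^i(X, Y) = 0, that is H^i(Hom(P, Y)) = 0 for a projective resolution P
   of X. *)
Definition ext_vanishes (i : nat) (X Y : rmodType A) : Prop :=
  exists P : proj_resolution X,
    forall g : rHom (P i) Y, ext_cocycle g -> ext_coboundary g.

Definition projdim_le (X : rmodType A) (m : nat) : Prop :=
  exists P : proj_resolution X, forall i, (m < i)%N -> forall v : P i, v = 0.

Definition submodule (V : rmodType A) (U : {vspace V}) : Prop :=
  forall u a, u \in U -> ract u a \in U.

Definition essential (V : rmodType A) (U : {vspace V}) : Prop :=
  forall W : {vspace V}, submodule W -> W <> 0%VS -> (U :&: W)%VS <> 0%VS.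

(* Minimality: X -> I_0 and the image of each differential in I_(i+1) are
   essential, i.e. all the I_i are injective envelopes. *)
Record min_inj_resolution (X : rmodType A) := MinInjResolution {
  ir_obj :> nat -> rmodType A;
  ir_injective : forall i, injective_rmod (ir_obj i);
  ir_aug : rHom X (ir_obj 0);
  ir_d : forall i, rHom (ir_obj i) (ir_obj i.+1);
  ir_aug_mono : lker ir_aug = 0%VS;
  ir_exact0 : limg ir_aug = lker (ir_d 0);
  ir_exact : forall i, limg (ir_d i) = lker (ir_d i.+1);
  ir_min0 : essential (limg ir_aug);
  ir_min : forall i, essential (limg (ir_d i)) }.

End Homological.

Section Auslander.

Variable k : fieldType.

(* The supremum of the projective dimensions of the finitely generated right
   modules. *)
Definition gldim_le (A : fdAlgType k) (m : nat) : Prop :=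
  forall X : rmodType A, projdim_le X m.

Definition domdim_ge (A : fdAlgType k) (m : nat) : Prop :=
  exists I : min_inj_resolution (regular_rmod A),
    forall i, (i < m)%N -> projective (I i).

Definition auslander_algebra (n : nat) (A : fdAlgType k) : Prop :=
  gldim_le A n.+1 /\ domdim_ge A n.+1.

(* Equivalence of the categories of finitely generated right modules. *)
Definition morita_equivalent (A B : fdAlgType k) : Prop :=
  equivalent (modcat A) (modcat B).

Definition ct_subcategory (n : nat) (A : fdAlgType k) (P : modcat A -> Prop) :
    Prop :=
  [/\ functorially_finite P,
      forall X, P X <->
        forall C i, P C -> (0 < i < n)%N -> ext_vanishes i C X
    & forall X, P X <->
        forall C i, P C -> (0 < i < n)%N -> ext_vanishes i X C].

Definition ct_object (n : nat) (A : fdAlgType k) (M : rmodType A) : Prop :=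
  ct_subcategory n (in_add (M : modcat A)).

Definition addcat (A : fdAlgType k) (M : rmodType A) : preadditive :=
  full_subcategory (in_add (M : modcat A)).

Definition ct_category (n : nat) (C : preadditive) : Prop :=
  is_additive C /\
  exists (A : fdAlgType k) (P : modcat A -> Prop),
    ct_subcategory n P /\ equivalent C (full_subcategory P).

End Auslander.

(* The class of x is the predicate [R x], and [classes R P] is the set of
   classes of the elements satisfying P. *)
Definition classes T (R : T -> T -> Prop) (P : T -> Prop) (c : T -> Prop) :
    Prop :=
  exists2 x, P x & c = R x.

Definition bijection_on S T (A : S -> Prop) (B : T -> Prop) (f : S -> T) :
    Prop :=
  [/\ forall x, A x -> B (f x),
      forall x y, A x -> A y -> f x = f y -> x = y
    & forall y, B y -> exists2 x, A x & f x = y].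

(* Main.v *)
(* For a module T over an algebra A, Hom(T, -) and D Hom(-, T) are functors from
   mod A to mod End(T), where D = Hom_k(-, k).

   (a) Let M be n-cluster tilting and H = Hom(M, -). A module over End(M) is the
   cokernel of some H f with f in add M. The kernel K of f has a resolution
   0 -> M_(n-1) -> ... -> M_0 -> K -> 0 by approximations in add M which stays
   exact under H, so that gl.dim End(M) <= n + 1. Moreover H sends a minimal
   injective resolution J of M to the beginning of one of End(M), up to the term
   H J_n, and each H J_i is both projective and injective.

   (b) Let G be n-Auslander, Q the sum of the first n + 1 terms of the minimal
   injective resolution of G, L = End(Q), and F = D Hom(-, Q). As Q is injective,
   F is exact; it is fully faithful on the G-modules Y with a copresentation
   0 -> Y -> Q_0 -> Q_1 by summands of powers of Q, and it is dense on them because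
   F Q = D L. Hence End(F G) = G, the copresentation of G gives
   Ext^i(F G, F G) = 0 for 0 < i < n, and if Ext^i(F G, F Y) = 0 for 0 < i < n then
   the copresentation of Y extends to one of length n + 1; as gl.dim G <= n + 1,
   Y is projective, so F Y is in add F G. The other half of the cluster tilting
   condition follows by splicing approximations in add F G.

   Finally add M is equivalent to the category of projective End(M)-modules, and a
   module category and its category of projectives determine each other. *)
From HB Require Import structures.
From mathcomp Require Import all_boot all_order all_algebra.
From mathcomp Require Import boolp.
Require Import Defs.

Set Implicit Arguments.
Unset Strict Implicit.
Unset Printing Implicit Defensive.

Import GRing.Theory.
Local Open Scope ring_scope.

(** * Modules and their homomorphisms *)

Local Notation "g \* f" := (rcomp g f) (at level 40, left associativity) : ring_scope.

(** The bound n + 1 arises in both directions as (n - 1) + 2. Each of the n - 1 vanishing degrees of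
    Ext accounts for one term; the two others come from left exactness of Hom(M, -) in (a), and in
    (b) they are what fullness of F requires. The dual in D Hom(-, T) makes the functor covariant
    with values in right modules, so that left modules never enter. Ext groups are never formed.
    Only their vanishing matters, so [ez] is developed by dimension shifting in both arguments, and
    the long exact sequence survives as a few lifting and vanishing statements. The delicate point
    of (a) is minimality of the resolution: a left exact functor need not preserve essential maps,
    and the argument rests on A being in add M. The delicate point of the bijection is to extend an
    equivalence of projectives to all modules although presentations and lifts are chosen
    arbitrarily. The extension is therefore treated as a relation between morphisms; that each side
    determines the other gives well-definedness and faithfulness at once. *)

Section Linear.

Variables (k : fieldType).

Lemma linfun_ex (V W : vectType k) (F : V -> W) :
  linear F -> {f : 'Hom(V, W) | forall v, f v = F v}.
Proof.
move=> lF; pose f : {linear V -> W} := HB.pack F (GRing.isLinear.Build _ _ _ _ _ lF).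
by exists (linfun f) => v; rewrite lfunE.
Qed.

End Linear.

Section Modules.

Variables (k : fieldType) (A : fdAlgType k).
Implicit Types U V W X Y Z : rmodType A.

Lemma ract0l V (a : A) : ract (0 : V) a = 0.
Proof. by rewrite -(ractlE a) linear0. Qed.

Lemma ractBl V (u v : V) (a : A) : ract (u - v) a = ract u a - ract v a.
Proof. by rewrite -!(ractlE a) linearB. Qed.

Lemma ractZr V c (u : V) (a : A) : ract u (c *: a) = c *: ract u a.
Proof.
have ract0r : ract u 0 = 0.
  apply: (addrI (ract u 0)); rewrite addr0.
  by rewrite -{1}[ract u 0]scale1r -ract_linearr scale1r add0r.
by rewrite -[c *: a]addr0 ract_linearr ract0r addr0.
Qed.

Lemma rcompE U V W (g : rHom V W) (f : rHom U V) u : (g \* f) u = g (f u).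
Proof. exact: comp_lfunE. Qed.
Lemma ridE V (v : V) : rid V v = v.
Proof. exact: id_lfunE. Qed.
Lemma rHomDE V W (f g : rHom V W) v : (f + g : rHom V W) v = f v + g v.
Proof. by rewrite /= add_lfunE. Qed.
Lemma rHomNE V W (f : rHom V W) v : (- f : rHom V W) v = - f v.
Proof. by rewrite /= opp_lfunE. Qed.
Lemma rHom0E V W (v : V) : (0 : rHom V W) v = 0.
Proof. by rewrite /= zero_lfunE. Qed.
Lemma rHomZE V W c (f : rHom V W) v : (c *: f : rHom V W) v = c *: f v.
Proof. by rewrite /= scale_lfunE. Qed.
Lemma rHom_sumE V W I (r : seq I) (P : pred I) (F : I -> rHom V W) v :
  (\sum_(i <- r | P i) F i : rHom V W) v = \sum_(i <- r | P i) F i v.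
Proof.
by elim/big_rec2: _ => [|i u f _ <-]; rewrite ?rHom0E // rHomDE.
Qed.

Definition rhE := (rcompE, ridE, rHomDE, rHomNE, rHom0E, rHomZE, rHom_sumE).

Lemma rHomB V W (f : rHom V W) u v : f (u - v) = f u - f v.
Proof. exact: linearB. Qed.
Lemma rHomD V W (f : rHom V W) u v : f (u + v) = f u + f v.
Proof. exact: linearD. Qed.
Lemma rHomZ V W (f : rHom V W) c u : f (c *: u) = c *: f u.
Proof. exact: linearZ. Qed.
Lemma rHom0 V W (f : rHom V W) : f 0 = 0.
Proof. exact: linear0. Qed.
Lemma rHom_sum V W (f : rHom V W) I (r : seq I) (P : pred I) (F : I -> V) :
  f (\sum_(i <- r | P i) F i) = \sum_(i <- r | P i) f (F i).
Proof. exact: linear_sum. Qed.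

Lemma rHom_ext V W (f g : rHom V W) : f = g -> forall v, f v = g v.
Proof. by move->. Qed.

Lemma rcomp0l U V W (f : rHom U V) : (0 : rHom V W) \* f = 0.
Proof. by apply: rHom_inj => v; rewrite !rhE. Qed.
Lemma rcomp0r U V W (f : rHom V W) : f \* (0 : rHom U V) = 0.
Proof. by apply: rHom_inj => v; rewrite !rhE linear0. Qed.
Lemma rcompNl U V W (g : rHom V W) (f : rHom U V) : (- g) \* f = - (g \* f).
Proof. by apply: rHom_inj => v; rewrite !rhE. Qed.
Lemma rcompNr U V W (g : rHom V W) (f : rHom U V) : g \* (- f) = - (g \* f).
Proof. by apply: rHom_inj => v; rewrite !rhE linearN. Qed.
Lemma rcompBl U V W (g g' : rHom V W) (f : rHom U V) :
  (g - g') \* f = g \* f - g' \* f.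
Proof. by rewrite rcompDl rcompNl. Qed.
Lemma rcompBr U V W (g : rHom V W) (f f' : rHom U V) :
  g \* (f - f') = g \* f - g \* f'.
Proof. by rewrite rcompDr rcompNr. Qed.
Lemma rcomp_suml U V W I (r : seq I) (P : pred I) (g : I -> rHom V W) (f : rHom U V) :
  (\sum_(i <- r | P i) g i) \* f = \sum_(i <- r | P i) (g i \* f).
Proof. by apply: rHom_inj => v; rewrite !rhE; apply: eq_bigr => i _; rewrite rhE. Qed.
Lemma rcomp_sumr U V W I (r : seq I) (P : pred I) (g : rHom V W) (f : I -> rHom U V) :
  g \* (\sum_(i <- r | P i) f i) = \sum_(i <- r | P i) (g \* f i).
Proof.
apply: rHom_inj => v; rewrite !rhE linear_sum; apply: eq_bigr => i _.
by rewrite rhE.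
Qed.

Lemma rhomv_of V W (F : V -> W) (lF : linear F) :
    (forall v a, F (ract v a) = ract (F v) a) -> sval (linfun_ex lF) \in rhomv V W.
Proof. by move=> eF; apply/rhomvP => v a; rewrite !(svalP (linfun_ex lF)) eF. Qed.

Definition rHom_of V W (F : V -> W) (lF : linear F)
    (eF : forall v a, F (ract v a) = ract (F v) a) : rHom V W :=
  Subvs (rhomv_of lF eF).

Lemma rHom_ofE V W (F : V -> W) (lF : linear F)
    (eF : forall v a, F (ract v a) = ract (F v) a) v : rHom_of lF eF v = F v.
Proof. exact: (svalP (linfun_ex lF)). Qed.

(** * Exactness and factorization of maps *)

Definition mono V W (f : rHom V W) := forall v, f v = 0 -> v = 0.
Definition epi V W (f : rHom V W) := forall w, exists v, f v = w.
Definition exact U V W (f : rHom U V) (g : rHom V W) :=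
  forall v, g v = 0 <-> exists u, f u = v.
Definition ses U V W (f : rHom U V) (g : rHom V W) :=
  [/\ mono f, epi g & exact f g].

Lemma mono_inj V W (f : rHom V W) : mono f -> injective f.
Proof.
move=> mf u v /eqP; rewrite -subr_eq0 -rHomB => /eqP/mf/eqP.
by rewrite subr_eq0 => /eqP.
Qed.

Lemma mono_rcompI U V W (f : rHom V W) (g h : rHom U V) :
  mono f -> f \* g = f \* h -> g = h.
Proof.
move=> mf e; apply: rHom_inj => v; apply: (mono_inj mf).
by have := rHom_ext e v; rewrite !rhE.
Qed.

Lemma epi_rcompI U V W (f : rHom U V) (g h : rHom V W) :
  epi f -> g \* f = h \* f -> g = h.
Proof.
move=> ef e; apply: rHom_inj => v; have [u <-] := ef v.
by have := rHom_ext e u; rewrite !rhE.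
Qed.

Lemma monoE V W (f : rHom V W) : mono f <-> lker f = 0%VS.
Proof.
split=> [mf | kf v fv0].
  by apply/vspaceP => v; rewrite memv_ker memv0; apply/eqP/eqP => [/mf|->]; rewrite ?linear0.
by apply/eqP; rewrite -memv0 -kf memv_ker fv0.
Qed.

Lemma epiE V W (f : rHom V W) : epi f <-> limg f = fullv.
Proof.
split=> [ef | kf w].
  apply/vspaceP => w; rewrite memvf; have [v <-] := ef w.
  by rewrite memv_img ?memvf.
by have /memv_imgP[v _ ->] : w \in limg f; [rewrite kf memvf | exists v].
Qed.

Lemma mem_limgE V W (f : rHom V W) w : w \in limg f <-> exists v, f v = w.
Proof.
split=> [/memv_imgP[v _ ->] | [v <-]]; [by exists v | by rewrite memv_img ?memvf].
Qed.

Lemma exactE U V W (f : rHom U V) (g : rHom V W) : exact f g <-> limg f = lker g.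
Proof.
split=> [e | e v].
  apply/vspaceP => v; rewrite memv_ker; apply/idP/eqP.
    by move/mem_limgE/e.
  by move/e/mem_limgE.
rewrite -mem_limgE e memv_ker; split=> /eqP //.
Qed.

Lemma exact_comp U V W (f : rHom U V) (g : rHom V W) : exact f g -> g \* f = 0.
Proof. by move=> e; apply: rHom_inj => v; rewrite !rhE; apply/e; exists v. Qed.

Lemma mono_comp U V W (f : rHom U V) (g : rHom V W) : mono f -> mono g -> mono (g \* f).
Proof. by move=> mf mg v; rewrite rhE => /mg/mf. Qed.

Lemma mono_lker V W (f : rHom V W) : mono f -> lker f == 0%VS.
Proof. by move/monoE/eqP. Qed.

(** The inverse [g^-1%VF] is only a k-linear section of [g]. Its composite with [h] is nevertheless
    A-linear, because [h] takes the same value on all preimages of an element. *)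
Lemma factor_epi U V W (g : rHom U V) (h : rHom U W) :
  epi g -> (forall u, g u = 0 -> h u = 0) -> exists h', h = h' \* g.
Proof.
move=> eg gh; have gK v : g (g^-1%VF v) = v.
  by rewrite limg_lfunVK //; apply/mem_limgE.
pose F v := h (g^-1%VF v).
have hE u u' : g u = g u' -> h u = h u'.
  move=> e; apply/eqP; rewrite -subr_eq0 -rHomB gh //.
  by rewrite rHomB e subrr.
have lF : linear F by move=> c u v; rewrite /F linearP /= linearP.
have eF v a : F (ract v a) = ract (F v) a.
  by rewrite /F -rHomE; apply: hE; rewrite gK rHomE gK.
exists (rHom_of lF eF); apply: rHom_inj => u; rewrite rcompE rHom_ofE.
by apply: hE; rewrite gK.
Qed.

Lemma factor_mono U V W (f : rHom V W) (h : rHom U W) :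
  mono f -> (forall u, exists v, f v = h u) -> exists h', h = f \* h'.
Proof.
move=> mf fh; have fK u : f (f^-1%VF (h u)) = h u.
  by rewrite limg_lfunVK //; apply/mem_limgE.
pose F u := f^-1%VF (h u).
have lF : linear F by move=> c u v; rewrite /F !linearP.
have eF v a : F (ract v a) = ract (F v) a.
  by apply: (mono_inj mf); rewrite rHomE !fK rHomE.
by exists (rHom_of lF eF); apply: rHom_inj => u; rewrite rcompE rHom_ofE fK.
Qed.

Lemma factor_ker U V W X (f : rHom V W) (g : rHom W X) (h : rHom U W) :
  mono f -> exact f g -> g \* h = 0 -> exists h', h = f \* h'.
Proof.
move=> mf e gh; apply: factor_mono => // u; apply/e.
by have := rHom_ext gh u; rewrite !rhE.
Qed.

Lemma factor_coker U V W X (f : rHom U V) (g : rHom V W) (h : rHom V X) :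
  epi g -> exact f g -> h \* f = 0 -> exists h', h = h' \* g.
Proof.
move=> eg e hf; apply: factor_epi => // v /e[u <-].
by have := rHom_ext hf u; rewrite !rhE.
Qed.

(** * Submodules, quotients and products *)

Lemma sub_ex V (U : {vspace V}) : submodule U ->
  exists K (i : rHom K V), mono i /\ forall v, v \in U <-> exists u, i u = v.
Proof.
move=> sU; pose act (u : subvs_of U) a := vsproj U (ract (vsval u) a).
have actE u a : vsval (act u a) = ract (vsval u) a by rewrite vsprojK // sU ?subvsP.
have h1 c u v a : act (c *: u + v) a = c *: act u a + act v a.
  by apply: subvs_inj; rewrite actE ract_linearl [RHS]vsval_is_linear !actE.
have h2 c v a b : act v (c *: a + b) = c *: act v a + act v b.
  by apply: subvs_inj; rewrite actE ract_linearr [RHS]vsval_is_linear !actE.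
have h3 v : act v 1 = v by apply: subvs_inj; rewrite actE ract1.
have h4 v a b : act v (a * b) = act (act v a) b.
  by apply: subvs_inj; rewrite !actE ractM.
pose K : rmodType A := HB.pack (subvs_of U) (isRModule.Build k A (subvs_of U) h1 h2 h3 h4).
have l : linear (vsval : K -> V) by move=> c u v.
have e (v : K) a : vsval (ract v a) = ract (vsval v) a by rewrite -actE.
exists K, (rHom_of l e); split=> [v | v].
  by rewrite rHom_ofE => v0; apply: val_inj.
split=> [vU | [u <-]]; last by rewrite rHom_ofE subvsP.
by exists (vsproj U v : K); rewrite rHom_ofE vsprojK.
Qed.

(** The quotient is carried by a linear complement of [U], the image of the projection [q] along
    [U]. The complement need not be a submodule, so the action is followed by [q]; [qr] makes this
    associative. *)
Lemma quot_ex V (U : {vspace V}) : submodule U ->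
  exists Q (p : rHom V Q), epi p /\ forall v, v \in U <-> p v = 0.
Proof.
move=> sU; pose q : 'End(V) := (\1 - projv U)%VF.
have qE v : q v = v - projv U v by rewrite add_lfunE opp_lfunE id_lfunE.
have q0 v : v \in U <-> q v = 0.
  rewrite qE; split=> [vU | /eqP]; first by rewrite projv_id // subrr.
  by rewrite subr_eq0 => /eqP ->; apply: memv_proj.
have qq u v : u - v \in U -> q u = q v.
  by move/q0/eqP; rewrite linearB subr_eq0 => /eqP.
have qU v : v - q v \in U by rewrite qE opprB addrC subrK memv_proj.
pose B := limg q; have qB v : q v \in B by rewrite memv_img ?memvf.
pose act (u : subvs_of B) a := vsproj B (q (ract (vsval u) a)).
have actE u a : vsval (act u a) = q (ract (vsval u) a) by rewrite vsprojK.
have qr v a : q (ract (q v) a) = q (ract v a).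
  by apply/esym/qq; rewrite -ractBl sU.
have qK (u : subvs_of B) : q (vsval u) = vsval u.
  have /memv_imgP[v _ ->] := subvsP u.
  by apply/esym/qq.
have h1 c u v a : act (c *: u + v) a = c *: act u a + act v a.
  by apply: subvs_inj; rewrite actE ract_linearl linearP [RHS]vsval_is_linear !actE.
have h2 c v a b : act v (c *: a + b) = c *: act v a + act v b.
  by apply: subvs_inj; rewrite actE ract_linearr linearP [RHS]vsval_is_linear !actE.
have h3 v : act v 1 = v by apply: subvs_inj; rewrite actE ract1 qK.
have h4 v a b : act v (a * b) = act (act v a) b.
  by apply: subvs_inj; rewrite !actE ractM qr.
pose Q : rmodType A := HB.pack (subvs_of B) (isRModule.Build k A (subvs_of B) h1 h2 h3 h4).
pose F v : Q := vsproj B (q v).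
have l : linear F by move=> c u v; rewrite /F !linearP.
have e v a : F (ract v a) = ract (F v) a.
  apply: (@subvs_inj _ _ B); rewrite [RHS]actE /F !vsprojK ?qB ?qr //.
exists Q, (rHom_of l e); split=> [w | v].
  exists (vsval w); rewrite rHom_ofE /F qK; exact: vsvalK.
rewrite rHom_ofE q0 /F; split=> [-> | /(congr1 vsval)]; first by rewrite linear0.
by rewrite vsprojK.
Qed.

Lemma limg_submodule V W (f : rHom V W) : submodule (limg f).
Proof.
by move=> u a /memv_imgP[v _ ->]; rewrite -rHomE memv_img ?memvf.
Qed.

Lemma lker_submodule V W (f : rHom V W) : submodule (lker f).
Proof. by move=> u a; rewrite !memv_ker rHomE => /eqP->; rewrite ract0l. Qed.

Lemma ker_ex V W (f : rHom V W) : exists K (i : rHom K V), mono i /\ exact i f.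
Proof.
have [K [i [mi iE]]] := sub_ex (@lker_submodule _ _ f).
exists K, i; split=> // v; rewrite -iE memv_ker; split=> /eqP //.
Qed.

Lemma coker_ex V W (f : rHom V W) : exists Q (p : rHom W Q), epi p /\ exact f p.
Proof.
have [K [i [mi iE]]] := quot_ex (@limg_submodule _ _ f).
by exists K, i; split=> // v; rewrite -iE mem_limgE.
Qed.

Lemma img_ex V W (f : rHom V W) :
  exists I (e : rHom V I) (m : rHom I W), [/\ epi e, mono m & f = m \* e].
Proof.
have [I [m [mm mE]]] := sub_ex (@limg_submodule _ _ f).
have [|e fE] := @factor_mono V I W m f mm.
  by move=> u; apply/mE/mem_limgE; exists u.
exists I, e, m; split=> // w.
have /mE/mem_limgE[v] : exists u, m u = m w by exists w.
by rewrite fE rcompE => /(mono_inj mm) <-; exists v.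
Qed.

Lemma iso_ex V W (f : rHom V W) : mono f -> epi f ->
  exists g : rHom W V, g \* f = rid V /\ f \* g = rid W.
Proof.
move=> mf ef; have [|g gE] := @factor_mono W V W f (rid W) mf.
  by move=> w; have [v <-] := ef w; exists v; rewrite ridE.
exists g; split; last by rewrite gE.
by apply: (mono_rcompI mf); rewrite rcompA -gE rcomp1m rcompm1.
Qed.

Lemma zero_ex : exists Z : rmodType A, forall z : Z, z = 0.
Proof.
have [|K [i [mi iE]]] := @sub_ex (regular_rmod A) 0%VS.
  by move=> u a; rewrite !memv0 => /eqP ->; rewrite ract0l.
exists K => z; apply: mi; apply/eqP; rewrite -memv0; apply/iE.
by exists z.
Qed.

Lemma prod_ex V W : exists (S : rmodType A) (i1 : rHom V S) (i2 : rHom W S)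
    (p1 : rHom S V) (p2 : rHom S W),
  [/\ p1 \* i1 = rid V, p2 \* i2 = rid W, p1 \* i2 = 0, p2 \* i1 = 0 &
      i1 \* p1 + i2 \* p2 = rid S].
Proof.
pose act (u : V * W) a : V * W := (ract u.1 a, ract u.2 a).
have h1 c u v a : act (c *: u + v) a = c *: act u a + act v a.
  by rewrite /act /= !ract_linearl.
have h2 c v a b : act v (c *: a + b) = c *: act v a + act v b.
  by rewrite /act /= !ract_linearr.
have h3 v : act v 1 = v by rewrite /act !ract1; case: v.
have h4 v a b : act v (a * b) = act (act v a) b by rewrite /act !ractM.
pose S : rmodType A := HB.pack (V * W)%type (isRModule.Build k A (V * W)%type h1 h2 h3 h4).
have l1 : linear (fun v : V => (v, 0) : S).
  by move=> c u v; congr (_, _); rewrite /= ?scaler0 ?addr0.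
have e1 (v : V) a : ((ract v a, 0) : S) = ract ((v, 0) : S) a.
  by congr (_, _); rewrite /= ract0l.
have l2 : linear (fun w : W => (0, w) : S).
  by move=> c u v; congr (_, _); rewrite /= ?scaler0 ?addr0.
have e2 (v : W) a : ((0, ract v a) : S) = ract ((0, v) : S) a.
  by congr (_, _); rewrite /= ract0l.
have l3 : linear (fun s : S => s.1 : V) by [].
have l4 : linear (fun s : S => s.2 : W) by [].
have e3 (s : S) a : (ract s a).1 = ract (s.1 : V) a by [].
have e4 (s : S) a : (ract s a).2 = ract (s.2 : W) a by [].
exists S, (rHom_of l1 e1), (rHom_of l2 e2), (rHom_of l3 e3), (rHom_of l4 e4).
split; apply: rHom_inj => v; rewrite ?rhE !rHom_ofE ?rhE //=.
by case: v => u v; congr (_, _); rewrite /= ?addr0 ?add0r.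
Qed.

End Modules.

(** * Finite direct sums, projectives and injectives *)

Section OrdRect.

Variables (n : nat) (P : 'I_n.+1 -> Type) (P0 : P ord0)
  (PS : forall j, P (lift ord0 j)).

(** Case analysis with a result type that depends on the index: the structure maps of a direct sum
    form such a family, and [biprod_ex] builds them by induction on the number of summands. *)
Definition ordS_rect (i : 'I_n.+1) : P i :=
  match unliftP ord0 i with
  | UnliftSome j e => eq_rect_r P (PS j) e
  | UnliftNone e => eq_rect_r P P0 e
  end.

Lemma ordS_rect0 : ordS_rect ord0 = P0.
Proof.
rewrite /ordS_rect; case: unliftP => [j e|e]; last by rewrite eq_axiomK.
by case/negP: (neq_lift ord0 j); apply/eqP.
Qed.

Lemma ordS_rectS j : ordS_rect (lift ord0 j) = PS j.
Proof.
rewrite /ordS_rect; case: unliftP => [j' e|e].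
  have e' := lift_inj e; rewrite -{}e' in e *.
  by rewrite eq_axiomK.
by case/negP: (neq_lift ord0 j); apply/eqP.
Qed.

End OrdRect.

Section Add.

Variables (k : fieldType) (A : fdAlgType k).
Implicit Types M U V W X Y Z : rmodType A.

Lemma biprod_ex n (X : 'I_n -> rmodType A) :
  exists (S : rmodType A) (i : forall j, rHom (X j) S) (p : forall j, rHom S (X j)),
  [/\ forall j, p j \* i j = rid (X j), forall j l, j != l -> p l \* i j = 0 &
      \sum_j i j \* p j = rid S].
Proof.
elim: n X => [|n IH] X.
  have [Z Z0] := zero_ex A; exists Z, (fun j => 0), (fun j => 0).
  by split=> [[]|[]|] //; apply: rHom_inj => v; rewrite [LHS]Z0 [RHS]Z0.
have [S' [i' [p' [H1 H2 H3]]]] := IH (fun j => X (lift ord0 j)).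
have [S [i1 [i2 [p1 [p2 [E1 E2 E3 E4 E5]]]]]] := prod_ex (X ord0) S'.
pose i := ordS_rect (P := fun j => rHom (X j) S) i1 (fun j => i2 \* i' j).
pose p := ordS_rect (P := fun j => rHom S (X j)) p1 (fun j => p' j \* p2).
exists S, i, p; split=> [j | j l |].
- case: (unliftP ord0 j) => [j' ->|->]; rewrite /i /p ?ordS_rectS ?ordS_rect0 //.
  by rewrite -rcompA [p2 \* _]rcompA E2 rcomp1m H1.
- case: (unliftP ord0 j) => [j' ->|->]; case: (unliftP ord0 l) => [l' ->|->] //.
  + rewrite (inj_eq lift_inj) => jl; rewrite /i /p !ordS_rectS.
    by rewrite -rcompA [p2 \* _]rcompA E2 rcomp1m H2.
  + by move=> _; rewrite /i /p !ordS_rectS !ordS_rect0 rcompA E3 rcomp0l.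
  + by move=> _; rewrite /i /p !ordS_rectS !ordS_rect0 -rcompA E4 rcomp0r.
- rewrite big_ord_recl {1}/i {1}/p !ordS_rect0 -E5; congr (_ + _).
  rewrite -[in RHS](rcomp1m p2) -H3 rcomp_suml rcomp_sumr; apply: eq_bigr => j _.
  by rewrite /i /p !ordS_rectS -!rcompA.
Qed.

(** Membership in add M, see [in_addE], as a factorization of the identity through a power of M,
    written in components. Neither the power nor a complement is named, so closure properties and
    transport along additive functors are short computations. *)
Definition addp M X := exists n (p : 'I_n -> rHom M X) (q : 'I_n -> rHom X M),
  \sum_j p j \* q j = rid X.

Definition retract X Y := exists (i : rHom X Y) (p : rHom Y X), p \* i = rid X.

Lemma retract_addp M X Y : retract X Y -> addp M Y -> addp M X.
Proof.
move=> [i [p pi]] [n [f [g fg]]]; exists n, (fun j => p \* f j), (fun j => g j \* i).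
rewrite -pi -[i in RHS]rcomp1m -fg rcomp_suml rcomp_sumr; apply: eq_bigr => j _.
by rewrite !rcompA.
Qed.

Lemma addp_refl M : addp M M.
Proof.
by exists 1%N, (fun=> rid M), (fun=> rid M); rewrite big_ord1 rcomp1m.
Qed.

Lemma addp_sum M n (X : 'I_n -> rmodType A) Y (u : forall j, rHom (X j) Y)
    (v : forall j, rHom Y (X j)) :
  \sum_j u j \* v j = rid Y -> (forall j, addp M (X j)) -> addp M Y.
Proof.
move=> uv aX.
have /all_tag[m /all_tag[f /all_sig[g fg]]] (j : 'I_n) : {m & {f : 'I_m -> rHom M (X j) &
    {g : 'I_m -> rHom (X j) M | \sum_l f l \* g l = rid (X j)}}}.
  by have /cid[m /cid[f /cid[g e]]] := aX j; exists m, f, g.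
(* The composites run over pairs (j, l) of an index and a summand, so the finite type of pairs is
   enumerated. *)
pose I : finType := {j : 'I_n & 'I_(m j)}.
pose F (x : I) := u (tag x) \* f (tag x) (tagged x).
pose G (x : I) := g (tag x) (tagged x) \* v (tag x).
exists #|I|, (fun j => F (enum_val j)), (fun j => G (enum_val j)).
rewrite -(reindex _ (P := predT) (F := fun x => F x \* G x)); last first.
  by exists enum_rank => x _; rewrite ?enum_valK ?enum_rankK.
transitivity (\sum_j \sum_(l < m j) (u j \* f j l) \* (g j l \* v j)).
  by rewrite sig_big_dep.
rewrite -uv; apply: eq_bigr => j _; rewrite -[v j in RHS]rcomp1m -fg.
by rewrite rcomp_suml rcomp_sumr; apply: eq_bigr => i _; rewrite !rcompA.
Qed.

Lemma addp_trans M X Y : addp M X -> addp X Y -> addp M Y.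
Proof. by move=> aX [n [u [v uv]]]; apply: addp_sum uv _. Qed.

Lemma power_ex M n : exists (S : rmodType A) (i : 'I_n -> rHom M S) (p : 'I_n -> rHom S M),
  [/\ forall j l, p l \* i j = (rid M) *+ (j == l), \sum_j i j \* p j = rid S &
      addp M S].
Proof.
have [S [i [p [H1 H2 H3]]]] := biprod_ex (fun _ : 'I_n => M).
exists S, i, p; split=> //; last by exists n, i, p.
by move=> j l; case: eqVneq => [->|/H2//].
Qed.

Lemma addp_retract M X : addp M X ->
  exists n S (i : 'I_n -> rHom M S) (p : 'I_n -> rHom S M),
  [/\ forall j l, p l \* i j = (rid M) *+ (j == l), \sum_j i j \* p j = rid S &
      retract X S].
Proof.
move=> [n [f [g fg]]]; have [S [i [p [H1 H2 _]]]] := power_ex M n.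
exists n, S, i, p; split=> //.
exists (\sum_j i j \* g j), (\sum_j f j \* p j).
rewrite rcomp_suml -fg; apply: eq_bigr => j _; rewrite rcomp_sumr (bigD1 j) //=.
rewrite big1 ?addr0 => [|l lj].
  by rewrite -rcompA [p j \* _]rcompA H1 eqxx rcomp1m.
by rewrite -rcompA [p j \* _]rcompA H1 (negPf lj) rcomp0l rcomp0r.
Qed.

(** The complement is the kernel of [p]; its projection comes from the idempotent 1 - i p, which [p]
    annihilates. *)
Lemma retract_summand X S : retract X S -> direct_summand (X : modcat A) S.
Proof.
move=> [i [p pi]]; have [Y [y [my ey]]] := ker_ex p.
have [|e eE] := @factor_ker _ _ _ _ _ _ y p (rid S - i \* p) my ey.
  by rewrite rcompBr rcompm1 rcompA pi rcomp1m subrr.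
pose F b : modcat A := if b then X else Y : modcat A.
pose inj b : mor (F b) S := match b with true => i | false => y end.
pose prj b : mor (S : modcat A) (F b) := match b with true => p | false => e end.
have py : p \* y = 0 by apply: exact_comp.
exists Y, inj, prj; split.
- case=> //; apply: (mono_rcompI my); rewrite /= rcompA -eE rcompBl -rcompA py.
  by rewrite rcomp0r subr0 rcomp1m rcompm1.
- case=> -[] //= _; apply: (mono_rcompI my).
  by rewrite /= rcompA -eE rcompBl -rcompA pi rcompm1 rcomp1m subrr rcomp0r.
- by rewrite big_bool /= -eE addrC subrK.
Qed.

Lemma in_addE M X : in_add (M : modcat A) X <-> addp M X.
Proof.
split=> [[n [S [[i [p [_ _ ip]]]]]] | ].
  move=> [Y [i' [p' [/(_ true) pi' _ _]]]].
  exists n, (fun j => p' true \* i j), (fun j => p j \* i' true).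
  rewrite -[RHS]pi' -[i' true in RHS]mcomp1m -ip /=.
  rewrite [in RHS]rcomp_suml rcomp_sumr; apply: eq_bigr => j _.
  by rewrite !rcompA.
move=> /addp_retract[n [S [i [p [H1 H2 H3]]]]]; exists n, S; split.
  exists i, p; split=> // [j | j l]; rewrite [LHS]H1 ?eqxx //.
  by move=> /negPf ->.
exact: retract_summand.
Qed.

Lemma addp_hom0 M X Y (f : rHom X Y) : addp M X ->
  (forall g : rHom M X, f \* g = 0) -> f = 0.
Proof.
move=> [n [p [q pq]]] f0; rewrite -[f]rcompm1 -pq rcomp_sumr big1 // => j _.
by rewrite rcompA f0 rcomp0l.
Qed.

Lemma addp_zero M X : (forall x : X, x = 0) -> addp M X.
Proof.
move=> X0; exists 0%N, (fun=> 0), (fun=> 0).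
by apply: rHom_inj => x; rewrite [LHS]X0 [RHS]X0.
Qed.

Lemma projectiveE X : projective X <->
  forall V W (g : rHom V W) (f : rHom X W), epi g -> exists h, f = g \* h.
Proof. by split=> pX V W g f /epiE; apply: pX. Qed.

Lemma injectiveE X : injective_rmod X <->
  forall V W (g : rHom V W) (f : rHom V X), mono g -> exists h, f = h \* g.
Proof. by split=> pX V W g f /monoE; apply: pX. Qed.

Lemma projective_addp P X : projective P -> addp P X -> projective X.
Proof.
move=> /projectiveE pP [n [p [q pq]]]; apply/projectiveE => V W g f eg.
have /choice[h hE] : forall j, exists h, f \* p j = g \* h by move=> j; apply: pP.
exists (\sum_j h j \* q j); rewrite rcomp_sumr -[LHS]rcompm1 -pq rcomp_sumr.
by apply: eq_bigr => j _; rewrite !rcompA hE.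
Qed.

Lemma injective_addp I X : injective_rmod I -> addp I X -> injective_rmod X.
Proof.
move=> /injectiveE pP [n [p [q pq]]]; apply/injectiveE => V W g f eg.
have /choice[h hE] : forall j, exists h, q j \* f = h \* g by move=> j; apply: pP.
exists (\sum_j p j \* h j); rewrite rcomp_suml -[LHS]rcomp1m -pq rcomp_suml.
by apply: eq_bigr => j _; rewrite -!rcompA hE.
Qed.

Lemma regular_hom X (x : X) :
  {f : rHom (regular_rmod A) X | forall a : A, f (a : regular_rmod A) = ract x a}.
Proof.
have l : linear (fun a : regular_rmod A => ract x a).
  by move=> c a b; rewrite [LHS]ract_linearr.
have e (a : regular_rmod A) b : ract x (ract a b) = ract (ract x a) b.
  exact: ractM.
by exists (rHom_of l e) => a; rewrite rHom_ofE.
Qed.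

Lemma regular_homE X (f : rHom (regular_rmod A) X) (a : A) :
  f (a : regular_rmod A) = ract (f (1 : A)) a.
Proof. by rewrite -rHomE; congr (f _); rewrite /= [RHS]mul1r. Qed.

Lemma regular_projective : projective (regular_rmod A).
Proof.
apply/projectiveE => V W g f eg; have [v vE] := eg (f (1 : A)).
have [h hE] := regular_hom v; exists h; apply: rHom_inj => a.
by rewrite rcompE hE rHomE vE -regular_homE.
Qed.

Lemma generators X : exists n (f : 'I_n -> rHom (regular_rmod A) X),
  forall x, exists a : 'I_n -> A, x = \sum_j f j (a j).
Proof.
exists (\dim {:X}), (fun j => sval (regular_hom (vbasis {:X})`_j)) => x.
exists (fun j => coord (vbasis {:X}) j x *: (1 : A) : A).
rewrite {1}(coord_vbasis (memvf x)); apply: eq_bigr => j _.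
by rewrite (svalP (regular_hom _)) ractZr ract1.
Qed.

Lemma free_cover X : exists S (p : rHom S X), addp (regular_rmod A) S /\ epi p.
Proof.
have [n [f fE]] := generators X.
have [S [i [p [H1 _ aS]]]] := power_ex (regular_rmod A) n.
exists S, (\sum_j f j \* p j); split=> // x; have [a ->] := fE x.
exists (\sum_j i j (a j : regular_rmod A)).
rewrite rHom_sum; apply: eq_bigr => j _; rewrite rhE (bigD1 j) //= big1 ?addr0.
  by have /rHom_ext/(_ (a j)) := H1 j j; rewrite eqxx mulr1n !rhE => ->.
move=> l lj; have /rHom_ext/(_ (a j)) := H1 j l.
by rewrite eq_sym (negPf lj) mulr0n !rhE => ->; rewrite rHom0.
Qed.

Lemma projective_regular X : projective X <-> addp (regular_rmod A) X.
Proof.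
split=> [/projectiveE pX | /(projective_addp regular_projective)//].
have [S [p [aS ep]]] := free_cover X.
have [i iE] := pX _ _ p (rid X) ep.
by apply: retract_addp aS; exists i, p.
Qed.

Lemma proj_cover X : exists W P (i : rHom W P) (p : rHom P X), projective P /\ ses i p.
Proof.
have [P [p [/projective_regular pP ep]]] := free_cover X.
by have [W [i [mi ei]]] := ker_ex p; exists W, P, i, p.
Qed.

(* The pairs [(D, ev)] with this property are the copies of [Hom_k(A, k)] with
   [ev] the evaluation at 1. *)
Definition is_dual (D : rmodType A) (ev : 'Hom(D, k^o)) :=
  (forall V (xi : 'Hom(V, k^o)), exists f : rHom V D, forall v, ev (f v) = xi v) /\
  (forall x : D, (forall a, ev (ract x a) = 0) -> x = 0).

(** On Hom_k(A, k) the action is (f a)(b) = f (a b), and the form [xi] corresponds to the map v |->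
    (a |-> xi (v a)). *)
Lemma dual_ex : exists (D : rmodType A) (ev : 'Hom(D, k^o)), is_dual ev.
Proof.
pose D0 := 'Hom(A, k^o).
have /all_sig[mulL mulLE] (a : A) : {f : 'End(A) | forall b, f b = a * b}.
  apply: linfun_ex => c u v; rewrite mulrDr; congr (_ + _).
  by rewrite -[a * (c *: u)](fdmulZr c a u).
pose act (f : D0) (a : A) : D0 := (f \o mulL a)%VF.
have actE f a b : act f a b = f (a * b) by rewrite comp_lfunE mulLE.
have h1 c u v a : act (c *: u + v) a = c *: act u a + act v a.
  by apply/lfunP => b; rewrite !(actE, add_lfunE, scale_lfunE).
have h2 c v a b : act v (c *: a + b) = c *: act v a + act v b.
  apply/lfunP => d; rewrite !(actE, add_lfunE, scale_lfunE) mulrDl linearD.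
  by rewrite -linearZ -[(c *: a) * d](fdmulZl c a d).
have h3 v : act v 1 = v by apply/lfunP => b; rewrite actE mul1r.
have h4 v a b : act v (a * b) = act (act v a) b.
  by apply/lfunP => d; rewrite !actE mulrA.
pose D : rmodType A := HB.pack D0 (isRModule.Build k A D0 h1 h2 h3 h4).
have lev : linear (fun f : D => (f : D0) 1 : k^o).
  by move=> c u v; rewrite add_lfunE scale_lfunE.
have [ev evE] := linfun_ex lev.
exists D, ev; split=> [V xi | x x0]; last first.
  by apply/lfunP => b; rewrite zero_lfunE -(x0 b) evE actE mulr1.
have /all_sig[F FE] (v : V) : {f : D0 | forall a, f a = xi (ract v a)}.
  by apply: linfun_ex => c a b; rewrite ract_linearr linearP.
have lF : linear (F : V -> D).
  move=> c u v; apply/lfunP => a.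
  by rewrite add_lfunE scale_lfunE !FE ract_linearl linearP.
have eF v a : (F (ract v a) : D) = ract (F v : D) a.
  by apply/lfunP => b; rewrite FE actE FE ractM.
by exists (rHom_of lF eF) => v; rewrite rHom_ofE evE FE ract1.
Qed.

Section Dual.

Variables (D : rmodType A) (ev : 'Hom(D, k^o)) (dD : is_dual ev).

(** Composition with [ev] identifies module maps into D with linear forms, and forms extend along a
    one-to-one map by means of the k-linear retraction [g^-1]. *)
Lemma dual_injective : injective_rmod D.
Proof.
case: dD => ex un; apply/injectiveE => V W g f mg.
have [h hE] := ex W (ev \o f \o g^-1)%VF; exists h; apply: rHom_inj => v.
apply/eqP; rewrite -subr_eq0; apply/eqP/un => a.
have evB (x y : D) : ev (x - y) = ev x - ev y by exact: linearB.
rewrite ractBl evB -!rHomE rcompE hE !comp_lfunE lker0_lfunK ?subrr //.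
exact: mono_lker.
Qed.

Lemma cogenerators X : exists n (f : 'I_n -> rHom X D),
  forall x, (forall j, f j x = 0) -> x = 0.
Proof.
case: dD => ex un; pose n := \dim {:X}.
have /choice[f fE] : forall j : 'I_n, exists f : rHom X D,
    forall x, ev (f x) = coord (vbasis {:X}) j x.
  move=> j; have [|c cE] := @linfun_ex k X k^o (coord (vbasis {:X}) j).
    exact: linearP.
  by have [f fE] := ex X c; exists f => x; rewrite fE cE.
exists n, f => x x0; rewrite (coord_vbasis (memvf x)) big1 // => j _.
by rewrite -fE x0 linear0 scale0r.
Qed.

Lemma cofree_env X : exists S (i : rHom X S), addp D S /\ mono i.
Proof.
have [n [f fE]] := cogenerators X; have [S [i [p [H1 _ aS]]]] := power_ex D n.
exists S, (\sum_j i j \* f j); split=> // x; rewrite !rhE => x0; apply: fE => l.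
have := congr1 (p l) x0; rewrite rHom0 rHom_sum (bigD1 l) //= big1 => [|j jl].
  have /rHom_ext/(_ (f l x)) := H1 l l.
  by rewrite eqxx mulr1n !rhE addr0 => ->.
have /rHom_ext/(_ (f j x)) := H1 j l.
by rewrite (negPf jl) mulr0n !rhE.
Qed.

Lemma injective_dual X : injective_rmod X <-> addp D X.
Proof.
split=> [/injectiveE iX | /(injective_addp dual_injective)//].
have [S [i [aS mi]]] := cofree_env X.
have [p pE] := iX _ _ i (rid X) mi.
by apply: retract_addp aS; exists i, p.
Qed.

End Dual.

Lemma inj_env X : exists J Z (i : rHom X J) (p : rHom J Z), injective_rmod J /\ ses i p.
Proof.
have [D [ev dD]] := dual_ex; have [J [i [aJ mi]]] := cofree_env dD X.
have [Z [p [ep ei]]] := coker_ex i.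
by exists J, Z, i, p; split=> //; apply/(injective_dual dD).
Qed.

End Add.

(** * Vanishing of Ext *)

Section Ext.

Variables (k : fieldType) (A : fdAlgType k).
Implicit Types M U V W X Y Z P J : rmodType A.

Definition extends W P (i : rHom W P) Y := forall h : rHom W Y, exists h', h = h' \* i.
Definition lifts J Z (p : rHom J Z) X := forall f : rHom X Z, exists f', f = p \* f'.

(** Balance of Ext^1(X, Y): the left side computes its vanishing from X, the right side from Y. A
    map X -> Z is covered by some [g] : P -> J, which restricts to W -> Y; extending this
    restriction to P and subtracting makes [g] vanish on W, hence descend to X. The converse is
    dual. *)
Lemma extends_lifts W P X (i : rHom W P) (p : rHom P X)
    Y J Z (j : rHom Y J) (q : rHom J Z) :
  projective P -> ses i p -> injective_rmod J -> ses j q ->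
  extends i Y <-> lifts q X.
Proof.
move=> /projectiveE pP [mi ep eip] /injectiveE iJ [mj eq ejq].
have qj := exact_comp ejq; have pi := exact_comp eip.
split=> [ext f | lif h].
  have [g gE] := pP _ _ q (f \* p) eq.
  have [|h hE] := @factor_ker _ _ _ _ _ _ j q (g \* i) mj ejq.
    by rewrite rcompA -gE -rcompA pi rcomp0r.
  have [u uE] := ext h.
  have [|f' f'E] := @factor_coker _ _ _ _ _ _ i p (g - j \* u) ep eip.
    by rewrite rcompBl hE uE rcompA subrr.
  exists f'; apply: (epi_rcompI ep).
  by rewrite -rcompA -f'E rcompBr rcompA qj rcomp0l subr0.
have [g gE] := iJ _ _ i (j \* h) mi.
have [|f fE] := @factor_coker _ _ _ _ _ _ i p (q \* g) ep eip.
  by rewrite -rcompA -gE rcompA qj rcomp0l.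
have [f' f'E] := lif f.
have [|u uE] := @factor_ker _ _ _ _ _ _ j q (g - f' \* p) mj ejq.
  by rewrite rcompBr rcompA -f'E fE subrr.
exists u; apply: (mono_rcompI mj).
by rewrite rcompA -uE rcompBl -rcompA pi rcomp0r subr0.
Qed.

(* [ez i X Y] expresses that Ext^(i+1)(X, Y) = 0. *)
Fixpoint ez (i : nat) X Y : Prop :=
  forall W P (u : rHom W P) (p : rHom P X), projective P -> ses u p ->
  if i is i'.+1 then ez i' W Y else extends u Y.

(** Two projective presentations of X are compared through one injective copresentation of Y, which
    replaces Schanuel's lemma. *)
Lemma ez0_proj W P X Y (i : rHom W P) (p : rHom P X) :
  projective P -> ses i p -> ez 0 X Y <-> extends i Y.
Proof.
move=> pP sip; split=> [/(_ _ _ i p)|exi]; first exact.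
move=> W' P' i' p' pP' sip'; have [J [Z [j [q [iJ sjq]]]]] := inj_env Y.
by apply/(extends_lifts pP' sip' iJ sjq)/(extends_lifts pP sip iJ sjq).
Qed.

Lemma ez0_inj X Y J Z (j : rHom Y J) (q : rHom J Z) :
  injective_rmod J -> ses j q -> ez 0 X Y <-> lifts q X.
Proof.
move=> iJ sjq; have [W [P [i [p [pP sip]]]]] := proj_cover X.
by rewrite (ez0_proj Y pP sip); exact: extends_lifts pP sip iJ sjq.
Qed.

(** Both sides express Ext^2(X, Y) = 0, once through a syzygy of X and once through a cosyzygy of
    Y. *)
Lemma ez0_shift W P X Y J Z (i : rHom W P) (p : rHom P X)
    (j : rHom Y J) (q : rHom J Z) :
  projective P -> ses i p -> injective_rmod J -> ses j q ->
  ez 0 W Y <-> ez 0 X Z.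
Proof.
move=> pP sip iJ sjq; rewrite (ez0_inj W iJ sjq) (ez0_proj Z pP sip).
move/projectiveE in pP; move/injectiveE in iJ.
case: sip => mi ep eip; case: sjq => mj eq ejq.
split=> [lif f | ext f].
  have [f' ->] := lif f; have [g ->] := iJ _ _ i f' mi.
  by exists (q \* g); rewrite rcompA.
have [f' ->] := ext f; have [g ->] := pP _ _ q f' eq.
by exists (g \* i); rewrite rcompA.
Qed.

Lemma ez_shift i X Y J Z (j : rHom Y J) (q : rHom J Z) :
  injective_rmod J -> ses j q -> ez i.+1 X Y <-> ez i X Z.
Proof.
move=> iJ sjq; elim: i X => [|i IH] X.
  have [W [P [u [p [pP sup]]]]] := proj_cover X.
  split=> [e | e W' P' u' p' pP' sup'].
    exact/(ez0_shift pP sup iJ sjq)/(e _ _ u p pP sup).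
  exact/(ez0_shift pP' sup' iJ sjq).
by split=> e W P u p pP sup; apply/IH; apply: e pP sup.
Qed.

(** The recursion in [ez] quantifies over all presentations of X, so the content is that a single
    one suffices. Shifting Y along injective copresentations lowers the degree until [ez0_shift]
    compares both syzygies with X itself. *)
Lemma ezS i W P X Y (u : rHom W P) (p : rHom P X) :
  projective P -> ses u p -> ez i.+1 X Y <-> ez i W Y.
Proof.
move=> pP sup; split=> [e | e W' P' u' p' pP' sup'].
  exact: e pP sup.
elim: i Y e => [|i IH] Y; have [J [Z [j [q [iJ sjq]]]]] := inj_env Y.
  by move/(ez0_shift pP sup iJ sjq) => e; apply/(ez0_shift pP' sup' iJ sjq).
by move/(ez_shift _ _ iJ sjq)/IH => e; apply/(ez_shift _ _ iJ sjq).
Qed.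

(** Exactness of Hom(X, B) -> Hom(X, C) -> Ext^1(X, Y), for an arbitrary middle term B. *)
Lemma ez0_lift X Y B C (a : rHom Y B) (b : rHom B C) :
  ez 0 X Y -> ses a b -> lifts b X.
Proof.
move=> e [ma eb eab] f; have [W [P [i [p [pP sip]]]]] := proj_cover X.
have := e _ _ i p pP sip; case: sip => mi ep eip ext.
have [g gE] := (projectiveE P).1 pP _ _ b (f \* p) eb.
have pi := exact_comp eip; have ba := exact_comp eab.
have [|h hE] := @factor_ker _ _ _ _ _ _ a b (g \* i) ma eab.
  by rewrite rcompA -gE -rcompA pi rcomp0r.
have [u uE] := ext h.
have [|f' f'E] := @factor_coker _ _ _ _ _ _ i p (g - a \* u) ep eip.
  by rewrite rcompBl hE uE rcompA subrr.
exists f'; apply: (epi_rcompI ep).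
by rewrite -rcompA -f'E rcompBr rcompA ba rcomp0l subr0.
Qed.

Section LongExact.

Variables (X' Y' Z' : rmodType A) (a : rHom X' Y') (b : rHom Y' Z').
Hypothesis sab : ses a b.

(** The lifting hypothesis makes the connecting map Hom(X, Z') -> Ext^1(X, X') zero, so Ext^1(X, X')
    embeds in Ext^1(X, Y'). *)
Lemma ez_ses_base X : lifts b X -> ez 0 X Y' -> ez 0 X X'.
Proof.
move=> lif e W P i p pP sip h; have := e _ _ i p pP sip.
case: sip sab => mi ep eip [ma eb eab] ext.
have ba := exact_comp eab; have pi := exact_comp eip.
have [g gE] := ext (a \* h).
have [|f fE] := @factor_coker _ _ _ _ _ _ i p (b \* g) ep eip.
  by rewrite -rcompA -gE rcompA ba rcomp0l.
have [f' f'E] := lif f.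
have [|u uE] := @factor_ker _ _ _ _ _ _ a b (g - f' \* p) ma eab.
  by rewrite rcompBr rcompA -f'E fE subrr.
exists u; apply: (mono_rcompI ma).
by rewrite rcompA -uE rcompBl -rcompA pi rcomp0r subr0.
Qed.

Lemma ez_ses_left i X : ez i X Z' -> ez i.+1 X Y' -> ez i.+1 X X'.
Proof.
have [W [P [u [p [pP sup]]]]] := proj_cover X.
elim: i X W P u p pP sup => [|i IH] X W P u p pP sup; last first.
  rewrite (ezS _ _ pP sup) !(ezS i.+1 _ pP sup).
  by have [W' [P' [u' [p' [pP' sup']]]]] := proj_cover W; apply: IH pP' sup'.
rewrite (ez0_proj _ pP sup) !(ezS _ _ pP sup) => ext; apply: ez_ses_base => f.
have [f' ->] := ext f; case: sab => ma eb eab.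
have [g ->] := (projectiveE P).1 pP _ _ b f' eb.
by exists (g \* u); rewrite rcompA.
Qed.

Lemma ez_ses_right i X : ez i.+1 X X' -> ez i X Y' -> ez i X Z'.
Proof.
have [W [P [u [p [pP sup]]]]] := proj_cover X.
elim: i X W P u p pP sup => [|i IH] X W P u p pP sup; last first.
  rewrite !(ezS _ _ pP sup).
  by have [W' [P' [u' [p' [pP' sup']]]]] := proj_cover W; apply: IH pP' sup'.
rewrite !(ez0_proj _ pP sup) !(ezS _ _ pP sup) => e ext f.
have [f' ->] := ez0_lift e sab f; have [g ->] := ext f'.
by exists (b \* g); rewrite rcompA.
Qed.

End LongExact.

Lemma ez_addl i M X Y : addp M X -> ez i M Y -> ez i X Y.
Proof.
move=> aX; elim: i Y => [|i IH] Y; have [J [Z [j [q [iJ sjq]]]]] := inj_env Y.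
  rewrite !(ez0_inj _ iJ sjq) => lif f; have [n [u [v uv]]] := aX.
  have /choice[g gE] : forall j, exists g, f \* u j = q \* g by move=> l; apply: lif.
  exists (\sum_j g j \* v j); rewrite rcomp_sumr -[LHS]rcompm1 -uv rcomp_sumr.
  by apply: eq_bigr => l _; rewrite !rcompA gE.
by rewrite !(ez_shift _ _ iJ sjq); apply: IH.
Qed.

Lemma ez_addr i X M Y : addp M Y -> ez i X M -> ez i X Y.
Proof.
move=> aX; have [W [P [u [p [pP sup]]]]] := proj_cover X.
elim: i X W P u p pP sup => [|i IH] X W P u p pP sup.
  rewrite !(ez0_proj _ pP sup) => ext f; have [n [r [s rs]]] := aX.
  have /choice[g gE] : forall j, exists g, s j \* f = g \* u by move=> l; apply: ext.
  exists (\sum_j r j \* g j); rewrite rcomp_suml -[LHS]rcomp1m -rs rcomp_suml.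
  by apply: eq_bigr => l _; rewrite -!rcompA gE.
rewrite !(ezS _ _ pP sup).
by have [W' [P' [u' [p' [pP' sup']]]]] := proj_cover W; apply: IH pP' sup'.
Qed.

Lemma ez_projl i P Y : projective P -> ez i P Y.
Proof.
move=> pP; elim: i Y => [|i IH] Y; have [J [Z [j [q [iJ sjq]]]]] := inj_env Y.
  apply/(ez0_inj _ iJ sjq) => f; case: sjq => _ eq _.
  exact: (projectiveE P).1.
exact/(ez_shift _ _ iJ sjq).
Qed.

(* [pdle m X] expresses that the projective dimension of X is at most m. *)
Definition pdle m X := forall Y, ez m X Y.

(** The obstruction to lifting a map along [g] lies in Ext^1(X, ker g). *)
Lemma pdle0 X : pdle 0 X <-> projective X.
Proof.
split=> [pd | pX Y]; last exact: ez_projl.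
apply/projectiveE => V W g f eg; have [K [i [mi ei]]] := ker_ex g.
by apply: (ez0_lift (pd K)); split; [exact: mi | exact: eg | exact: ei].
Qed.

Lemma pdleS m W P X (u : rHom W P) (p : rHom P X) :
  projective P -> ses u p -> pdle m.+1 X <-> pdle m W.
Proof. by move=> pP sup; split=> pd Y; apply/(ezS _ _ pP sup). Qed.

(** Here W is the j-th syzygy, and letting j vary allows the induction to walk along the resolution.
    As P is arbitrary, the existential choice of a resolution in [ext_vanishes] is harmless. *)
Lemma ext_cohomology (X : rmodType A) (P : proj_resolution X) i j W (e : rHom (P j) W) Y :
  epi e -> exact (pr_d P j) e ->
  (forall g : rHom (P (i + j).+1) Y, ext_cocycle g -> ext_coboundary g) <-> ez i W Y.
Proof.
elim: i j W e => [|i IH] j W e ee xe; have [K [u [mu xu]]] := ker_ex e.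
  have pP := @pr_projective _ _ _ P j; rewrite add0n (ez0_proj _ pP (And3 mu ee xu)).
  have [|e' e'E] := @factor_ker _ _ _ _ _ _ u e (pr_d P j) mu xu.
    exact: exact_comp.
  have ee' : epi e'.
    move=> w; have /xe[v] : e (u w) = 0 by apply/xu; exists w.
    by rewrite e'E rcompE => /(mono_inj mu) <-; exists v.
  have xe' : exact (pr_d P j.+1) e'.
    move=> v; have /exactE <- := pr_exact P j.
    rewrite e'E rcompE; split=> [->|/mu//]; exact: rHom0.
  split=> [co h | ext g cg].
    have [|h' h'E] := co (h \* e').
      by rewrite /ext_cocycle -rcompA (exact_comp xe') rcomp0r.
    by exists h'; apply: (epi_rcompI ee'); rewrite h'E e'E rcompA.
  have [g' g'E] := @factor_coker _ _ _ _ _ _ _ _ g ee' xe' cg.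
  by have [h hE] := ext g'; exists h; rewrite g'E hE e'E rcompA.
rewrite addSnnS (ezS _ _ (@pr_projective _ _ _ P j) (And3 mu ee xu)).
have [|e' e'E] := @factor_ker _ _ _ _ _ _ u e (pr_d P j) mu xu.
  exact: exact_comp.
apply: (IH _ _ e') => [w | v].
  have /xe[v] : e (u w) = 0 by apply/xu; exists w.
  by rewrite e'E rcompE => /(mono_inj mu) <-; exists v.
have /exactE <- := pr_exact P j.
rewrite e'E rcompE; split=> [->|/mu//]; exact: rHom0.
Qed.

(** Dependent choice: [Inv i] is carried by the i-th syzygy and renewed at each step, while [Q i] is
    what the i-th term has to satisfy. *)
Lemma resolution_build (Inv Q : nat -> rmodType A -> Prop) X :
  (forall i X, Inv i X -> exists W P (u : rHom W P) (p : rHom P X),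
     [/\ projective P, ses u p, Q i P & Inv i.+1 W]) ->
  Inv 0 X -> exists R : proj_resolution X, forall i, Q i (R i).
Proof.
move=> step I0.
pose T i (X : rmodType A) := {W : rmodType A & {P : rmodType A &
  {u : rHom W P & {p : rHom P X | [/\ projective P, ses u p, Q i P & Inv i.+1 W]}}}}.
have {}step i (X' : {X | Inv i X}) : T i (sval X').
  case: X' => X' /= /step.
  by move=> /cid[W] /cid[P] /cid[u] /cid[p H]; exists W, P, u, p.
have stepI i (X' : {X | Inv i X}) : Inv i.+1 (projT1 (step i X')).
  by case: (step i X') => W [P [u [p []]]].
pose nxt i (X' : {X | Inv i X}) : {X | Inv i.+1 X} := exist _ _ (stepI i X').
pose Xs := nat_rect (fun i => {X | Inv i X}) (exist _ X I0) nxt.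
pose st i := step i (Xs i).
pose W i := projT1 (st i); pose P i := projT1 (projT2 (st i)).
pose u i : rHom (W i) (P i) := projT1 (projT2 (projT2 (st i))).
pose p i : rHom (P i) (sval (Xs i)) := sval (projT2 (projT2 (projT2 (st i)))).
have H i : [/\ projective (P i), ses (u i) (p i), Q i (P i) & Inv i.+1 (W i)].
  exact: (svalP (projT2 (projT2 (projT2 (st i))))).
pose d i : rHom (P i.+1) (P i) := u i \* (p i.+1 : rHom (P i.+1) (W i)).
have pi i : projective (P i) by case: (H i).
have aug : limg (p 0%N) = fullv by apply/epiE; case: (H 0%N) => _ [].
have img i (f : rHom (P i) (sval (Xs i))) v :
    (exists w, d i w = v) <-> exists w, u i w = v.
  split=> [[w <-] | [w <-]]; first by exists (p i.+1 w); rewrite rcompE.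
  by case: (H i.+1) => _ [_ /(_ w)[x <-] _ _ _]; exists x; rewrite rcompE.
have ex0 : limg (d 0%N) = lker (p 0%N).
  by apply/exactE => v; rewrite img //; case: (H 0%N) => _ [_ _ /(_ v)].
have exi i : limg (d i.+1) = lker (d i).
  apply/exactE => v; rewrite img //; case: (H i.+1) => _ [_ _ <-] _ _.
  rewrite rcompE; split=> [|->]; last exact: rHom0.
  by case: (H i) => _ [mu _ _] _ _ /mu.
exists (@ProjResolution k A X P pi d (p 0%N) aug ex0 exi) => i.
by case: (H i).
Qed.

Lemma resolution_ex X : exists R : proj_resolution X, True.
Proof.
have [|//|R _] := @resolution_build (fun _ _ => True) (fun _ _ => True) X; last by exists R.
by move=> i Y _; have [W [P [u [p [pP s]]]]] := proj_cover Y; exists W, P, u, p.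
Qed.

Lemma ext_vanishesE i X Y : ext_vanishes i.+1 X Y <-> ez i X Y.
Proof.
have key (P : proj_resolution X) :
    (forall g : rHom (P i.+1) Y, ext_cocycle g -> ext_coboundary g) <-> ez i X Y.
  have := @ext_cohomology X P i 0 X (pr_aug P) Y; rewrite addn0; apply.
    by apply/epiE/pr_aug_onto.
  by apply/exactE/pr_exact0.
split=> [[P /key//] | e]; have [P _] := resolution_ex X.
by exists P; apply/key.
Qed.

Lemma projdim_leE m X : projdim_le X m <-> pdle m X.
Proof.
split=> [[P P0] Y | pd].
  (* [ez m] concerns degree m + 1, where P vanishes, so every cocycle there is zero. *)
  apply/ext_vanishesE; exists P => g _; exists 0.
  by apply: rHom_inj => v; rewrite (P0 m.+1 _ v) // !rHom0.
(* Each syzygy loses one unit of projective dimension. The m-th is projective and serves as its own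
   last term; from then on everything is zero. *)
pose Inv i X := if (i <= m)%N then pdle (m - i) X else forall x : X, x = 0.
pose Q i (P : rmodType A) := (m < i)%N -> forall x : P, x = 0.
have [||R RQ] := @resolution_build Inv Q X; last by exists R.
  move=> i Z; rewrite /Inv; case: (ltngtP i m) => [im|im|->].
  - have [W [P [u [p [pP s]]]]] := proj_cover Z; rewrite -{1}(subnSK im).
    move/(pdleS _ pP s) => pd'; exists W, P, u, p; split=> //.
    by rewrite /Q ltnNge (ltnW im).
  - move=> Z0; exists Z, Z, 0, (rid Z).
    split=> //.
    + by apply/projective_regular; apply: addp_zero.
    + split=> [v|v|v]; first by rewrite [v]Z0.
        by exists v; rewrite ridE.
      by split=> _; [exists 0; rewrite rHom0 [v]Z0 | rewrite [v]Z0 rHom0].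
  - rewrite subnn => /pdle0 pZ; have [K K0] := zero_ex A.
    exists K, Z, 0, (rid Z); split=> //; last by rewrite /Q ltnn.
    split=> [v|v|v]; first by rewrite [v]K0.
      by exists v; rewrite ridE.
    rewrite ridE; split=> [->|[w <-]]; last by rewrite !rhE.
    by exists 0; rewrite rHom0.
by rewrite /Inv leq0n subn0.
Qed.

End Ext.

(** * Injective envelopes and dominant dimension *)

Lemma ex_maximal T (P : T -> Prop) (mu : T -> nat) b :
  (forall t, P t -> (mu t <= b)%N) -> (exists t, P t) ->
  exists t, P t /\ forall t', P t' -> (mu t' <= mu t)%N.
Proof.
move=> Pb [t Pt]; have [n] := ubnP (b - mu t)%N.
elim: n t Pt => // n IH t Pt bt.
have [[t' [Pt' tt']]|no] := EM (exists t', P t' /\ (mu t < mu t')%N).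
  apply: (IH t') => //; rewrite ltnS in bt; apply: leq_trans bt.
  by apply: ltn_sub2l => //; apply: leq_trans tt' (Pb _ Pt').
exists t; split=> // t' Pt'; rewrite leqNgt; apply/negP => tt'.
by apply: no; exists t'.
Qed.

Section Envelopes.

Variables (k : fieldType) (A : fdAlgType k).
Implicit Types M U V W X Y Z P J : rmodType A.

Definition ess V W (f : rHom V W) :=
  forall w, w <> 0 -> exists a, ract w a <> 0 /\ exists v, f v = ract w a.

Lemma ess_essential V W (f : rHom V W) : ess f -> essential (limg f).
Proof.
move=> ef U sU U0 I0; apply: U0; apply/vspaceP => u; rewrite memv0.
apply/idP/eqP => [uU|->]; last exact: mem0v.
apply: contrapT => /ef[a [ua0 [v fv]]]; apply: ua0; apply/eqP.
rewrite -memv0 -I0 memv_cap; apply/andP; split; last exact: sU.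
by apply/mem_limgE; exists v.
Qed.

(** The envelope is the image of an endomorphism [phi] of an injective J containing V, chosen among
    those fixing V so that its kernel has maximal dimension. *)
Lemma envelope_ex V : exists J (f : rHom V J), [/\ injective_rmod J, mono f & ess f].
Proof.
have [J [_ [f [_ [iJ [mf _ _]]]]]] := inj_env V.
have [||phi [phif phimax]] := @ex_maximal (rHom J J) (fun phi => phi \* f = f)
    (fun phi => \dim (lker phi)) (dim J).
- by move=> phi _; rewrite -dimvf dimvS ?subvf.
- by exists (rid J); rewrite rcomp1m.
have kmax (psi : rHom J J) : psi \* f = f -> (forall x, phi x = 0 -> psi x = 0) ->
    forall x, psi x = 0 -> phi x = 0.
  move=> psif sub x psi0; have /eqP e : lker phi == lker psi.
    rewrite eqEdim phimax // andbT; apply/subvP => y.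
    by rewrite !memv_ker => /eqP/sub/eqP.
  by apply/eqP; rewrite -memv_ker e memv_ker psi0.
have [J' [e [m [ee mm phiE]]]] := img_ex phi.
(* Both [phi] and its square fix [f], so by maximality they have the same kernel; hence e m is an
   automorphism and J' is a retract of J. *)
have [s [sl sr]] : exists s, s \* (e \* m) = rid J' /\ (e \* m) \* s = rid J'.
  apply: iso_ex => [v | w].
    have [x <-] := ee v; rewrite rcompE => emx; have : phi (phi x) = 0.
      by rewrite phiE !rcompE emx rHom0.
    rewrite -rcompE => /kmax; rewrite -rcompA phif.
    move/(_ phif) => x0; apply: mm; rewrite -rcompE -phiE; apply: x0 => y y0.
    by rewrite rcompE y0 rHom0.
  (* a one-to-one endomorphism of a finite-dimensional space is onto *)
  suff /epiE : limg (e \* m) = fullv by apply.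
  apply/eqP; rewrite eqEdim subvf /=.
  rewrite limg_dim_eq //; apply/eqP; rewrite -subv0; apply/subvP => v.
  rewrite memv_cap memv_ker => /andP[_ /eqP].
  have [x <-] := ee v; rewrite rcompE => emx; have : phi (phi x) = 0.
    by rewrite phiE !rcompE emx rHom0.
  rewrite -rcompE => /kmax; rewrite -rcompA phif.
  move/(_ phif) => x0; rewrite memv0; apply/eqP/mm; rewrite -rcompE -phiE.
  by apply: x0 => y y0; rewrite rcompE y0 rHom0.
have iJ' : injective_rmod J'.
  apply: (injective_addp iJ); apply: retract_addp (addp_refl J).
  by exists m, (s \* e); rewrite -rcompA.
exists J', (e \* f); split=> // [v|w w0].
  by rewrite rcompE => ef0; apply: mf; rewrite -phif phiE !rcompE ef0 rHom0.
(* If no nonzero multiple of [w] lies in the image of V, then V embeds in the quotient of J' by the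
   submodule generated by [w]. Extending [f] from that quotient yields an endomorphism of J that
   fixes [f], kills ker phi and kills a preimage of [w]; maximality then forces [w] = 0. *)
apply: contrapT => no; apply: w0.
have [c cE] := regular_hom w; have [Q [p [ep xp]]] := coker_ex c.
have pw : p w = 0 by apply/xp; exists (1 : A); rewrite cE ract1.
have mpf : mono (p \* (e \* f)).
  move=> v; rewrite rcompE => /xp[a]; rewrite cE => wa.
  have [wa0 | wa0] := EM (ract w a = 0); last by case: no; exists a; split=> //; exists v.
  by apply: mf; rewrite -phif phiE !rcompE -(rcompE e f) -wa wa0 rHom0.
have [psi psiE] := (injectiveE J).1 iJ _ _ _ f mpf.
have [x xw] := ee w.
have psif : (psi \* p \* e) \* f = f by rewrite -!rcompA -psiE.
rewrite -xw; apply: (mm); rewrite -rcompE -phiE; apply: (kmax _ psif).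
  by move=> y; rewrite phiE rcompE => /mm ey; rewrite rcompE ey rHom0.
by rewrite !rcompE xw pw rHom0.
Qed.

Lemma inj_resolution_build (Inv Q : nat -> rmodType A -> Prop) X :
  (forall i X, Inv i X -> exists J Z (j : rHom X J) (q : rHom J Z),
     [/\ injective_rmod J, ess j, ses j q, Q i J & Inv i.+1 Z]) ->
  Inv 0 X -> exists R : min_inj_resolution X, forall i, Q i (R i).
Proof.
move=> step I0.
pose T i (X : rmodType A) := {Z : rmodType A & {J : rmodType A &
  {j : rHom X J & {q : rHom J Z |
     [/\ injective_rmod J, ess j, ses j q, Q i J & Inv i.+1 Z]}}}}.
have {}step i (X' : {X | Inv i X}) : T i (sval X').
  case: X' => X' /= /step.
  by move=> /cid[J] /cid[Z] /cid[j] /cid[q H]; exists Z, J, j, q.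
have stepI i (X' : {X | Inv i X}) : Inv i.+1 (projT1 (step i X')).
  by case: (step i X') => W [P [u [p []]]].
pose nxt i (X' : {X | Inv i X}) : {X | Inv i.+1 X} := exist _ _ (stepI i X').
pose Xs := nat_rect (fun i => {X | Inv i X}) (exist _ X I0) nxt.
pose st i := step i (Xs i).
pose Z i := projT1 (st i); pose J i := projT1 (projT2 (st i)).
pose j i : rHom (sval (Xs i)) (J i) := projT1 (projT2 (projT2 (st i))).
pose q i : rHom (J i) (Z i) := sval (projT2 (projT2 (projT2 (st i)))).
have H i : [/\ injective_rmod (J i), ess (j i), ses (j i) (q i), Q i (J i) & Inv i.+1 (Z i)].
  exact: (svalP (projT2 (projT2 (projT2 (st i))))).
pose d i : rHom (J i) (J i.+1) := (j i.+1 : rHom (Z i) (J i.+1)) \* q i.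
have iJ i : injective_rmod (J i) by case: (H i).
have aug : lker (j 0%N) = 0%VS by apply/monoE; case: (H 0%N) => _ _ [].
have img i v : (exists w, d i w = v) <-> exists w, j i.+1 w = v.
  split=> [[w <-] | [w <-]]; first by exists (q i w); rewrite rcompE.
  by case: (H i) => _ _ [_ /(_ w)[x <-] _] _ _; exists x; rewrite rcompE.
have kdi i v : d i v = 0 <-> exists w, j i w = v.
  case: (H i) => _ _ [_ _ <-] _ _; rewrite rcompE; split=> [|->]; last exact: rHom0.
  by case: (H i.+1) => _ _ [mu _ _] _ _ /mu.
have ex0 : limg (j 0%N) = lker (d 0%N) by apply/exactE => v; rewrite kdi.
have exi i : limg (d i) = lker (d i.+1).
  by apply/exactE => v; rewrite kdi img.
have min0 : essential (limg (j 0%N)) by apply: ess_essential; case: (H 0%N).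
have mini i : essential (limg (d i)).
  suff -> : limg (d i) = limg (j i.+1) by apply: ess_essential; case: (H i.+1).
  by apply/vspaceP => v; apply/idP/idP; rewrite !mem_limgE img.
exists (@MinInjResolution k A X J iJ (j 0%N) d aug ex0 exi min0 mini) => i.
by case: (H i).
Qed.

(* There is an exact sequence 0 -> V -> J_0 -> ... -> J_(m-1) all of whose
   cosyzygies embed through maps satisfying E. *)
Fixpoint copres (E : forall V J, rHom V J -> Prop) m V : Prop :=
  if m is m'.+1 then exists J Z (j : rHom V J) (q : rHom J Z),
    [/\ E V J j, ses j q & copres E m' Z]
  else True.

Definition copres_add Q := copres (fun V J (_ : rHom V J) => addp Q J).

Lemma copres_ge E m m' V : (m' <= m)%N -> copres E m V -> copres E m' V.
Proof.
elim: m m' V => [|m IH] [|m'] V //= mm [J [Z [j [q [H1 H2 H3]]]]].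
by exists J, Z, j, q; split=> //; apply: IH H3.
Qed.

(** A resolution is infinite, so after its first m terms the copresentation is continued by
    arbitrary injective envelopes. *)
Lemma domdim_copres m :
  copres (fun V J (j : rHom V J) => [/\ injective_rmod J, projective J & ess j])
    m (regular_rmod A) -> domdim_ge A m.
Proof.
move=> c; pose Inv i V := (i <= m)%N ->
  copres (fun V J (j : rHom V J) => [/\ injective_rmod J, projective J & ess j]) (m - i) V.
have [i V|_|R RQ] := @inj_resolution_build Inv (fun i J => (i < m)%N -> projective J)
  (regular_rmod A).
- move=> H; case: (leqP m i) => im.
    have [J [f [iJ mf ef]]] := envelope_ex V; have [Z [q [eq xq]]] := coker_ex f.
    by exists J, Z, f, q; split=> // im1; have := leq_trans im1 im; rewrite ltnn.
  have := H (ltnW im); rewrite -(subnSK im) => -[J [Z [f [q [[iJ pJ ef] s cZ]]]]].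
  by exists J, Z, f, q; split.
- by rewrite subn0.
- by exists R.
Qed.

Lemma domdim_copres_add m : domdim_ge A m ->
  exists Q, [/\ projective Q, injective_rmod Q & copres_add Q m (regular_rmod A)].
Proof.
move=> [I pI]; have [Q [i [p [H1 _ H2]]]] := biprod_ex (fun j : 'I_m => I j).
have aQ j : (j < m)%N -> addp Q (I j).
  move=> jm; exists 1%N, (fun=> p (Ordinal jm)), (fun=> i (Ordinal jm)).
  by rewrite big_ord1; exact: (H1 (Ordinal jm)).
exists Q; split.
- apply/projectiveE => V W g f eg.
  have /all_sig[h hE] (j : 'I_m) : {h | f \* i j = g \* h}.
    by apply/cid/((projectiveE _).1 (pI j _)).
  exists (\sum_j h j \* p j); rewrite rcomp_sumr -[LHS]rcompm1 -H2 rcomp_sumr.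
  by apply: eq_bigr => j _; rewrite !rcompA hE.
- apply/injectiveE => V W g f eg.
  have /all_sig[h hE] (j : 'I_m) : {h | p j \* f = h \* g}.
    by apply/cid/((injectiveE _).1 (@ir_injective _ _ _ I j)).
  exists (\sum_j i j \* h j); rewrite rcomp_suml -[LHS]rcomp1m -H2 rcomp_suml.
  by apply: eq_bigr => j _; rewrite -!rcompA hE.
(* [V] stands for the j-th cosyzygy, embedded in I_j as the kernel of the next differential; l terms
   of the copresentation remain to be found. *)
have key l j V (f : rHom V (I j)) : (j + l)%N = m -> mono f -> exact f (ir_d I j) ->
    copres_add Q l V.
  elim: l j V f => //= l IH j V f jl mf xf.
  have [Z [q [eq xq]]] := coker_ex f.
  exists (I j), Z, f, q; split=> //; first by apply: aQ; rewrite -jl -ltn_subLR // subnn.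
  have [|d dE] := @factor_coker _ _ _ _ _ _ f q (ir_d I j) eq xq.
    exact: exact_comp.
  apply: (IH j.+1 Z d); first by rewrite addSnnS.
    move=> z; have [x <-] := eq z; rewrite -rcompE -dE => /xf[v <-].
    by apply/xq; exists v.
  move=> x; have /exactE -> := @ir_exact _ _ _ I j; rewrite dE.
  split=> [[y <-]|[z <-]]; first by exists (q y); rewrite rcompE.
  by have [y <-] := eq z; exists y; rewrite rcompE.
apply: (key m 0%N _ (ir_aug I)) => //; first by apply/monoE/ir_aug_mono.
by apply/exactE/ir_exact0.
Qed.

End Envelopes.

(** * The functors Hom(T, -) and D Hom(-, T) *)

Section AdditiveFunctor.

Variables (C D : preadditive) (F : add_functor C D).

Lemma fmap0 (X Y : C) : fmap F (0 : mor X Y) = 0.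
Proof. by apply: (addrI (fmap F (0 : mor X Y))); rewrite -fmapD !addr0. Qed.

Lemma fmapN (X Y : C) (f : mor X Y) : fmap F (- f) = - fmap F f.
Proof. by apply: (addrI (fmap F f)); rewrite -fmapD !subrr fmap0. Qed.

Lemma fmapB (X Y : C) (f g : mor X Y) : fmap F (f - g) = fmap F f - fmap F g.
Proof. by rewrite fmapD fmapN. Qed.

Lemma fmap_sum (X Y : C) I (r : seq I) (P : pred I) (f : I -> mor X Y) :
  fmap F (\sum_(i <- r | P i) f i) = \sum_(i <- r | P i) fmap F (f i).
Proof. by elim/big_rec2: _ => [|i y x _ <-]; rewrite ?fmap0 ?fmapD. Qed.

End AdditiveFunctor.

Lemma functor_addp (k : fieldType) (A B : fdAlgType k)
    (F : add_functor (modcat A) (modcat B)) (M X : rmodType A) :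
  addp M X -> addp (F M : rmodType B) (F X : rmodType B).
Proof.
move=> [n [p [q pq]]].
exists n, (fun j => fmap F (p j : mor (M : modcat A) X)),
  (fun j => fmap F (q j : mor (X : modcat A) M)).
rewrite -[RHS](fmap1 F) -[idm _]pq fmap_sum.
apply: eq_bigr => j _.
exact (esym (@fmapM _ _ F (X : modcat A) (M : modcat A) (X : modcat A) (p j) (q j))).
Qed.

Section Functors.

Variables (k : fieldType) (A : fdAlgType k) (T : rmodType A).
Implicit Types M U V W X Y Z : rmodType A.

Local Notation B := (endalg T).

(** * The functor Hom(T, -) *)

Section Hom.

Definition hom_rmod X : Type := rHom T X.

HB.instance Definition _ X := Vector.copy (hom_rmod X) (rHom T X).

Fact hom_linearl X c (u v : hom_rmod X) (s : B) :
  (c *: u + v : rHom T X) \* s = c *: (u \* s : hom_rmod X) + (v \* s : hom_rmod X).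
Proof. by apply: rHom_inj => t; rewrite !rhE. Qed.

Fact hom_linearr X c (v : hom_rmod X) (s t : B) :
  (v : rHom T X) \* (c *: s + t : rHom T T) =
    c *: (v \* s : hom_rmod X) + (v \* t : hom_rmod X).
Proof. by apply: rHom_inj => x; rewrite !rhE rHomD rHomZ. Qed.

HB.instance Definition _ X := isRModule.Build k B (hom_rmod X)
  (@hom_linearl X) (@hom_linearr X) (@rcompm1 _ _ T X) (@rcompA _ _ T T T X).

Fact Hmap_linear X Y (f : rHom X Y) :
  linear (fun h : hom_rmod X => f \* (h : rHom T X) : hom_rmod Y).
Proof. by move=> c u v; apply: rHom_inj => t; rewrite !rhE rHomD rHomZ. Qed.

Fact Hmap_ract X Y (f : rHom X Y) (h : hom_rmod X) (s : B) :
  (f \* (ract h s : rHom T X) : hom_rmod Y) = ract (f \* (h : rHom T X) : hom_rmod Y) s.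
Proof. exact: rcompA. Qed.

Definition Hmap X Y (f : rHom X Y) : rHom (hom_rmod X) (hom_rmod Y) :=
  rHom_of (Hmap_linear f) (Hmap_ract f).

Lemma HmapE X Y (f : rHom X Y) (h : rHom T X) :
  Hmap f (h : hom_rmod X) = f \* h.
Proof. exact: (rHom_ofE (Hmap_linear f) (Hmap_ract f)). Qed.

Lemma Hmap1 X : Hmap (rid X) = rid (hom_rmod X).
Proof. by apply: rHom_inj => h; rewrite HmapE rcomp1m ridE. Qed.

Lemma HmapM X Y Z (g : rHom Y Z) (f : rHom X Y) : Hmap (g \* f) = Hmap g \* Hmap f.
Proof. by apply: rHom_inj => h; rewrite rcompE !HmapE rcompA. Qed.

Lemma HmapD X Y (f g : rHom X Y) : Hmap (f + g) = Hmap f + Hmap g.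
Proof. by apply: rHom_inj => h; rewrite rHomDE !HmapE rcompDl. Qed.

Definition homF : add_functor (modcat A) (modcat B) :=
  @AddFunctor (modcat A) (modcat B) (fun X => hom_rmod X : rmodType B) Hmap
    Hmap1 HmapM HmapD.

Lemma Hmap_sum X Y I (r : seq I) (P : pred I) (f : I -> rHom X Y) :
  Hmap (\sum_(i <- r | P i) f i) = \sum_(i <- r | P i) Hmap (f i).
Proof. exact: (fmap_sum homF). Qed.

Lemma Hmap0 X Y : Hmap (0 : rHom X Y) = 0.
Proof. exact: (fmap0 homF). Qed.

Lemma HmapB X Y (f g : rHom X Y) : Hmap (f - g) = Hmap f - Hmap g.
Proof. exact: (fmapB homF). Qed.

Lemma hom_addp M X : addp M X -> addp (hom_rmod M) (hom_rmod X).
Proof. exact: (functor_addp homF). Qed.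

Lemma Hmap_mono X Y (f : rHom X Y) : mono f -> mono (Hmap f).
Proof.
move=> mf h; rewrite HmapE => fh0; apply: (mono_rcompI mf).
by rewrite fh0 rcomp0r.
Qed.

Lemma Hmap_exact X Y Z (f : rHom X Y) (g : rHom Y Z) :
  mono f -> exact f g -> exact (Hmap f) (Hmap g).
Proof.
move=> mf xf h; rewrite HmapE; split=> [gh0 | [h' <-]].
  by have [h' hE] := factor_ker mf xf gh0; exists h'; rewrite HmapE.
by rewrite HmapE rcompA (exact_comp xf) rcomp0l.
Qed.

Lemma Hmap_ses X Y Z (f : rHom X Y) (g : rHom Y Z) :
  ses f g -> lifts g T -> ses (Hmap f) (Hmap g).
Proof.
move=> [mf eg xf] lif; split; first exact: Hmap_mono.
  by move=> h; have [h' hE] := lif h; exists h'; rewrite HmapE.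
exact: Hmap_exact.
Qed.

Lemma hom_regular_iso : exists (f : rHom (regular_rmod B) (hom_rmod T))
  (g : rHom (hom_rmod T) (regular_rmod B)),
  [/\ g \* f = rid _, f \* g = rid _ & forall s : B, f (s : regular_rmod B) = s].
Proof.
have lf : linear (fun s : regular_rmod B => s : hom_rmod T) by [].
have lg : linear (fun s : hom_rmod T => s : regular_rmod B) by [].
have ef (s : regular_rmod B) (a : B) : (ract s a : hom_rmod T) = ract (s : hom_rmod T) a by [].
have eg (s : hom_rmod T) (a : B) :
  (ract s a : regular_rmod B) = ract (s : regular_rmod B) a by [].
exists (rHom_of lf ef), (rHom_of lg eg).
by split=> [||s]; rewrite ?rHom_ofE //; apply: rHom_inj => s; rewrite rcompE !rHom_ofE ridE.
Qed.

Lemma hom_projective X : addp T X -> projective (hom_rmod X).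
Proof.
move=> /hom_addp aX; apply/projective_regular; apply: addp_trans aX.
have [f [g [gf fg _]]] := hom_regular_iso.
by apply: retract_addp (addp_refl _); exists g, f.
Qed.

Lemma Hmap_faithful X Y (f : rHom X Y) : addp T X -> Hmap f = 0 -> f = 0.
Proof.
move=> aX f0; apply: (addp_hom0 aX) => g; have := rHom_ext f0 (g : hom_rmod X).
by rewrite HmapE rHom0E.
Qed.

(** The Yoneda argument: a map out of Hom(T, T) is determined by its value at the identity. The case
    of add T follows by gluing along the components. *)
Lemma Hmap_full X Y (u : rHom (hom_rmod X) (hom_rmod Y)) :
  addp T X -> exists f, u = Hmap f.
Proof.
have base (v : rHom (hom_rmod T) (hom_rmod Y)) : exists f, v = Hmap f.
  exists (v (rid T : hom_rmod T)); apply: rHom_inj => h; rewrite HmapE.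
  have e : h = ract (rid T : hom_rmod T) (h : B) by apply/esym/rcomp1m.
  by rewrite {1}e rHomE.
move=> [n [p [q pq]]].
have /choice[f fE] : forall j, exists f, u \* Hmap (p j) = Hmap f by move=> j; apply: base.
exists (\sum_j f j \* q j); rewrite Hmap_sum -[LHS]rcompm1 -Hmap1 -pq Hmap_sum.
by rewrite rcomp_sumr; apply: eq_bigr => j _; rewrite !HmapM rcompA fE.
Qed.

Lemma hom_cover (N : rmodType B) :
  exists M (p : rHom (hom_rmod M) N), addp T M /\ epi p.
Proof.
have [n [f fE]] := generators N; have [_ [g [_ _ _]]] := hom_regular_iso.
have [S [i [p [H1 _ aS]]]] := power_ex T n.
have [r [s [sr rs rE]]] := hom_regular_iso.
exists S, (\sum_j f j \* s \* Hmap (p j)); split=> // x; have [a ->] := fE x.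
exists (\sum_j Hmap (i j) (r (a j : regular_rmod B))).
rewrite rHom_sum; apply: eq_bigr => j _; rewrite rHom_sumE (bigD1 j) //.
rewrite big1 => [|l lj]; rewrite !rcompE -(rcompE (Hmap _)) -HmapM H1.
  by rewrite eqxx mulr1n Hmap1 ridE -(rcompE s) sr ridE; exact: addr0.
by rewrite eq_sym (negPf lj) mulr0n Hmap0 rHom0E !rHom0.
Qed.

End Hom.

(** * The functor D Hom(-, T) *)

Section DualHom.

Definition dhom_rmod X : Type := 'Hom(rHom X T, k^o).

HB.instance Definition _ X := Vector.copy (dhom_rmod X) 'Hom(rHom X T, k^o).

Definition dev X (phi : dhom_rmod X) (h : rHom X T) : k := (phi : 'Hom(_, _)) h.

Lemma dev_inj X (phi psi : dhom_rmod X) :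
  (forall h, dev phi h = dev psi h) -> phi = psi.
Proof. by move=> e; apply/lfunP. Qed.

Lemma devP X c (phi psi : dhom_rmod X) h :
  dev (c *: phi + psi) h = c * dev phi h + dev psi h.
Proof. by rewrite /dev add_lfunE scale_lfunE. Qed.

Lemma dev0 X h : dev (0 : dhom_rmod X) h = 0.
Proof. exact: (@zero_lfunE k (rHom X T) k^o h). Qed.

Lemma devrP X c (phi : dhom_rmod X) h h' :
  dev phi (c *: h + h') = c * dev phi h + dev phi h'.
Proof. by rewrite /dev linearP. Qed.

Lemma devr0 X (phi : dhom_rmod X) : dev phi 0 = 0.
Proof. exact: (linear0 (phi : 'Hom(rHom X T, k^o))). Qed.

Lemma devrD X (phi : dhom_rmod X) h h' : dev phi (h + h') = dev phi h + dev phi h'.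
Proof. exact: (linearD (phi : 'Hom(rHom X T, k^o))). Qed.

Lemma dhom_of X (F : rHom X T -> k) :
  (forall c h h', F (c *: h + h') = c * F h + F h') -> {phi : dhom_rmod X | forall h, dev phi h = F h}.
Proof. move=> lF; exact: (@linfun_ex k (rHom X T) k^o F lF). Qed.

Fact dhom_act_linear X (phi : dhom_rmod X) (s : B) c (h h' : rHom X T) :
  dev phi ((s : rHom T T) \* (c *: h + h')) =
  c * dev phi ((s : rHom T T) \* h) + dev phi ((s : rHom T T) \* h').
Proof.
rewrite -devrP; congr dev; apply: rHom_inj => x.
by rewrite !rhE rHomD rHomZ.
Qed.

Definition dhom_act X (phi : dhom_rmod X) (s : B) : dhom_rmod X :=
  sval (dhom_of (dhom_act_linear phi s)).

Fact dhom_actE X (phi : dhom_rmod X) (s : B) h :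
  dev (dhom_act phi s) h = dev phi ((s : rHom T T) \* h).
Proof. exact: (svalP (dhom_of (dhom_act_linear phi s))). Qed.

Fact dhom_linearl X c (u v : dhom_rmod X) (s : B) :
  dhom_act (c *: u + v) s = c *: dhom_act u s + dhom_act v s.
Proof. by apply: dev_inj => h; rewrite !(dhom_actE, devP). Qed.

Fact dhom_linearr X c (v : dhom_rmod X) (s t : B) :
  dhom_act v (c *: s + t) = c *: dhom_act v s + dhom_act v t.
Proof.
apply: dev_inj => h; rewrite !(dhom_actE, devP) -devrP; congr dev.
by apply: rHom_inj => x; rewrite !rhE.
Qed.

Fact dhom_act1 X (v : dhom_rmod X) : dhom_act v 1 = v.
Proof. by apply: dev_inj => h; rewrite dhom_actE rcomp1m. Qed.

Fact dhom_actM X (v : dhom_rmod X) (s t : B) :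
  dhom_act v (s * t) = dhom_act (dhom_act v s) t.
Proof. by apply: dev_inj => h; rewrite !dhom_actE rcompA. Qed.

HB.instance Definition _ X := isRModule.Build k B (dhom_rmod X)
  (@dhom_linearl X) (@dhom_linearr X) (@dhom_act1 X) (@dhom_actM X).

Lemma dev_ract X (phi : dhom_rmod X) (s : B) h :
  dev (ract phi s) h = dev phi ((s : rHom T T) \* h).
Proof. exact: dhom_actE. Qed.

Fact Gmap_lin0 X Y (f : rHom X Y) (phi : dhom_rmod X) c (h h' : rHom Y T) :
  dev phi ((c *: h + h') \* f) = c * dev phi (h \* f) + dev phi (h' \* f).
Proof.
by rewrite -devrP; congr dev; apply: rHom_inj => x; rewrite !rhE.
Qed.

Definition Gmap_fun X Y (f : rHom X Y) (phi : dhom_rmod X) : dhom_rmod Y :=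
  sval (dhom_of (Gmap_lin0 f phi)).

Fact Gmap_funE X Y (f : rHom X Y) (phi : dhom_rmod X) h :
  dev (Gmap_fun f phi) h = dev phi (h \* f).
Proof. exact: (svalP (dhom_of (Gmap_lin0 f phi))). Qed.

Fact Gmap_linear X Y (f : rHom X Y) : linear (Gmap_fun f).
Proof.
move=> c u v; apply: dev_inj => h; rewrite devP !Gmap_funE; exact: devP.
Qed.

Fact Gmap_ract X Y (f : rHom X Y) (phi : dhom_rmod X) (s : B) :
  Gmap_fun f (ract phi s) = ract (Gmap_fun f phi) s.
Proof. by apply: dev_inj => h; rewrite !(dev_ract, Gmap_funE) rcompA. Qed.

Definition Gmap X Y (f : rHom X Y) : rHom (dhom_rmod X) (dhom_rmod Y) :=
  rHom_of (Gmap_linear f) (Gmap_ract f).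

Lemma GmapE X Y (f : rHom X Y) (phi : dhom_rmod X) h :
  dev (Gmap f phi) h = dev phi (h \* f).
Proof. by rewrite /Gmap rHom_ofE Gmap_funE. Qed.

Lemma Gmap1 X : Gmap (rid X) = rid (dhom_rmod X).
Proof. by apply: rHom_inj => u; apply: dev_inj => h; rewrite GmapE rcompm1 ridE. Qed.

Lemma GmapM X Y Z (g : rHom Y Z) (f : rHom X Y) : Gmap (g \* f) = Gmap g \* Gmap f.
Proof.
by apply: rHom_inj => u; apply: dev_inj => h; rewrite rcompE !GmapE rcompA.
Qed.

Lemma GmapD X Y (f g : rHom X Y) : Gmap (f + g) = Gmap f + Gmap g.
Proof.
apply: rHom_inj => u; apply: dev_inj => h.
rewrite rHomDE -[Gmap f u]scale1r devP mul1r !GmapE -devrD; congr dev.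
exact: rcompDr.
Qed.

Definition dhomF : add_functor (modcat A) (modcat B) :=
  @AddFunctor (modcat A) (modcat B) (fun X => dhom_rmod X : rmodType B) Gmap
    Gmap1 GmapM GmapD.

Lemma Gmap_sum X Y I (r : seq I) (P : pred I) (f : I -> rHom X Y) :
  Gmap (\sum_(i <- r | P i) f i) = \sum_(i <- r | P i) Gmap (f i).
Proof. exact: (fmap_sum dhomF). Qed.

Lemma Gmap0 X Y : Gmap (0 : rHom X Y) = 0.
Proof. exact: (fmap0 dhomF). Qed.

Lemma GmapB X Y (f g : rHom X Y) : Gmap (f - g) = Gmap f - Gmap g.
Proof. exact: (fmapB dhomF). Qed.

Lemma dhom_addp M X : addp M X -> addp (dhom_rmod M) (dhom_rmod X).
Proof. exact: (functor_addp dhomF). Qed.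

(** Hom(T, T) is the algebra B itself, so its dual is a copy of D B, with evaluation at the
    identity. Injective B-modules are therefore the modules in add of [dhom_rmod T]. *)
Lemma dhom_dual : exists ev : 'Hom(dhom_rmod T, k^o), is_dual ev.
Proof.
have lev : linear (fun phi : dhom_rmod T => dev phi (rid T) : k^o).
  by move=> c u v; rewrite devP.
have [ev evE] := linfun_ex lev; exists ev; split=> [V xi | x x0]; last first.
  apply: dev_inj => h; rewrite dev0 -(x0 (h : B)) evE dev_ract.
  by congr dev; rewrite rcompm1.
have lin (v : V) c (h h' : rHom T T) :
    xi (ract v (c *: h + h' : B)) = c * xi (ract v (h : B)) + xi (ract v (h' : B)).
  by rewrite ract_linearr linearP.
pose F (v : V) : dhom_rmod T := sval (dhom_of (lin v)).
have FE v h : dev (F v) h = xi (ract v (h : B)) := svalP (dhom_of (lin v)) h.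
have lF : linear F.
  by move=> c u v; apply: dev_inj => h; rewrite devP !FE ract_linearl linearP.
have eF v (a : B) : F (ract v a) = ract (F v) a.
  by apply: dev_inj => h; rewrite dev_ract !FE -ractM.
exists (rHom_of lF eF) => v; rewrite rHom_ofE evE FE.
by congr (xi _); apply: ract1.
Qed.

(* [Hom_A(T, D A)] and [D Hom_A(A, T)] are both copies of [D T]. *)
Lemma hom_dual_retract (D : rmodType A) (ev : 'Hom(D, k^o)) : is_dual ev ->
  retract (hom_rmod D) (dhom_rmod (regular_rmod A)).
Proof.
move=> [exD unD].
have lin (f : hom_rmod D) c (h h' : rHom (regular_rmod A) T) :
    ev ((f : rHom T D) ((c *: h + h' : rHom _ _) (1 : A))) =
    c * ev ((f : rHom T D) (h (1 : A))) + ev ((f : rHom T D) (h' (1 : A))).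
  by rewrite !rhE rHomD rHomZ linearP.
pose F (f : hom_rmod D) : dhom_rmod (regular_rmod A) := sval (dhom_of (lin f)).
have FE f h : dev (F f) h = ev ((f : rHom T D) (h (1 : A))) := svalP (dhom_of (lin f)) h.
have lF : linear F.
  by move=> c u v; apply: dev_inj => h; rewrite devP !FE !rhE linearP.
have eF v (a : B) : F (ract v a) = ract (F v) a.
  by apply: dev_inj => h; rewrite dev_ract !FE !rhE.
have [||g [gf fg]] := @iso_ex _ _ _ _ (rHom_of lF eF); last first.
- by exists (rHom_of lF eF), g.
- move=> phi.
  have lphi : linear (fun t : T => dev phi (sval (regular_hom t)) : k^o).
    move=> c u v; rewrite -devrP; congr dev; apply: rHom_inj => a.
    by rewrite !rhE !(svalP (regular_hom _)) ract_linearl.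
  have [xi xiE] := linfun_ex lphi; have [f fE] := exD _ xi.
  exists (f : hom_rmod D); apply: dev_inj => h; rewrite rHom_ofE FE fE xiE.
  by congr dev; apply: rHom_inj => a; rewrite (svalP (regular_hom _)) -regular_homE.
- move=> f; rewrite rHom_ofE => f0; apply: rHom_inj => t; rewrite rHom0E.
  apply: unD => a; have := congr1 (fun phi => dev phi (sval (regular_hom t))) f0.
  have := congr1 (fun phi => dev phi (sval (regular_hom (ract t a)))) f0.
  by rewrite !FE !dev0 (svalP (regular_hom _)) ract1 rHomE.
Qed.

(** Precomposition embeds Hom(Y, T) in Hom(X, T), and a form on a subspace extends to the whole
    space by a linear left inverse. *)
Lemma Gmap_epi X Y (f : rHom X Y) : epi f -> epi (Gmap f).
Proof.
move=> ef psi.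
have linf : linear (fun h : rHom Y T => h \* f).
  by move=> c u v; apply: rHom_inj => x; rewrite !rhE.
have [L LE] := linfun_ex linf.
have kL : lker L == 0%VS.
  by apply/lker0P => g h; rewrite !LE; apply: epi_rcompI.
have lin c (h h' : rHom X T) : dev psi (L^-1%VF (c *: h + h')) =
    c * dev psi (L^-1%VF h) + dev psi (L^-1%VF h').
  by rewrite linearP devrP.
have [phi phiE] := dhom_of lin; exists phi; apply: dev_inj => h.
by rewrite GmapE phiE -LE lker0_lfunK.
Qed.

Hypothesis iT : injective_rmod T.

Lemma Gmap_mono X Y (f : rHom X Y) : mono f -> mono (Gmap f).
Proof.
move=> mf phi phi0; apply: dev_inj => h; have [h' ->] := (injectiveE T).1 iT _ _ f h mf.
by rewrite -GmapE phi0 !dev0.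
Qed.

Lemma Gmap_exact X Y Z (f : rHom X Y) (g : rHom Y Z) : ses f g -> exact (Gmap f) (Gmap g).
Proof.
move=> [mf eg xf] phi; split=> [phi0 | [psi <-]]; last first.
  by apply: dev_inj => h; rewrite !GmapE dev0 -rcompA (exact_comp xf) rcomp0r devr0.
have linf : linear (fun h : rHom Y T => h \* f).
  by move=> c u v; apply: rHom_inj => x; rewrite !rhE.
have [L LE] := linfun_ex linf.
have LK h : L (L^-1%VF h) = h.
  apply: limg_lfunVK; have [h' ->] := (injectiveE T).1 iT _ _ f h mf.
  by rewrite -LE memv_img ?memvf.
have lin c (h h' : rHom X T) : dev phi (L^-1%VF (c *: h + h')) =
    c * dev phi (L^-1%VF h) + dev phi (L^-1%VF h').
  by rewrite linearP devrP.
have [psi psiE] := dhom_of lin; exists psi; apply: dev_inj => h.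
rewrite GmapE psiE -LE.
(* [h] and the chosen preimage of L h differ by a map that vanishes on the image of [f], hence
   factors through [g]; on such maps [phi] is zero. *)
have : (L^-1%VF (L h) - h) \* f = 0.
  by rewrite rcompBl -!LE LK subrr.
case/(factor_coker eg xf) => u /eqP; rewrite subr_eq => /eqP ->.
by rewrite devrD -GmapE phi0 dev0 add0r.
Qed.

Lemma Gmap_ses X Y Z (f : rHom X Y) (g : rHom Y Z) : ses f g -> ses (Gmap f) (Gmap g).
Proof.
move=> s; split; last exact: Gmap_exact.
  by apply: Gmap_mono; case: s.
by apply: Gmap_epi; case: s.
Qed.

Lemma Gmap_lexact X Y Z (f : rHom X Y) (g : rHom Y Z) :
  mono f -> exact f g -> exact (Gmap f) (Gmap g).
Proof.
move=> mf xf; have [I [e [m [ee mm gE]]]] := img_ex g.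
have s : ses f e.
  split=> // y; rewrite -xf gE rcompE; split=> [->|/mm//]; exact: rHom0.
move=> phi; rewrite -(Gmap_exact s phi) gE GmapM rcompE.
split=> [/(Gmap_mono mm)//|->]; exact: rHom0.
Qed.

End DualHom.

(** Reflexivity of the finite-dimensional space Hom(X, T): the coordinates of [h] are the values of
    [Xi] on the dual basis. *)
Lemma dhom_form X (Xi : 'Hom(dhom_rmod X, k^o)) :
  exists h : rHom X T, forall phi, Xi phi = dev phi h.
Proof.
pose b := vbasis {: rHom X T}.
have lin (j : 'I_(\dim {: rHom X T})) c (h h' : rHom X T) :
    coord b j (c *: h + h') = c * coord b j h + coord b j h' by rewrite linearP.
exists (\sum_j Xi (sval (dhom_of (lin j))) *: b`_j) => phi.
have {1}-> : phi = \sum_(j < \dim {: rHom X T}) dev phi b`_j *: sval (dhom_of (lin j)).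
  apply: dev_inj => h; rewrite {1}(coord_vbasis (memvf h)) /dev linear_sum sum_lfunE.
  apply: eq_bigr => j _; rewrite scale_lfunE linearZ.
  apply: etrans (mulrC _ _) _; congr (_ * _).
  exact/esym/(svalP (dhom_of (lin j))).
rewrite /dev !linear_sum; apply: eq_bigr => j _.
by rewrite !linearZ; exact: mulrC.
Qed.

End Functors.

(** * From Auslander algebras to cluster tilting objects *)

Section ClusterTilting.

Variables (k : fieldType) (A : fdAlgType k).
Implicit Types M U V W X Y Z P J : rmodType A.

Lemma lifts_addp M X Y Z (p : rHom Y Z) : addp M X -> lifts p M -> lifts p X.
Proof.
move=> [n [u [v uv]]] lif f.
have /choice[g gE] : forall j, exists g, f \* u j = p \* g by move=> l; apply: lif.
exists (\sum_j g j \* v j); rewrite rcomp_sumr -[LHS]rcompm1 -uv rcomp_sumr.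
by apply: eq_bigr => l _; rewrite !rcompA gE.
Qed.

Lemma power_sum M n (X : rmodType A) (f : 'I_n -> rHom M X) (S : rmodType A)
    (i : 'I_n -> rHom M S) (p : 'I_n -> rHom S M) :
  (forall j l, p l \* i j = (rid M) *+ (j == l)) ->
  forall j, (\sum_l f l \* p l) \* i j = f j.
Proof.
move=> H j; rewrite rcomp_suml (bigD1 j) //= big1 ?addr0 => [|l lj].
  by rewrite -rcompA H eqxx mulr1n rcompm1.
by rewrite -rcompA H eq_sym (negPf lj) rcomp0r.
Qed.

Lemma power_sumr M n (X : rmodType A) (f : 'I_n -> rHom X M) (S : rmodType A)
    (i : 'I_n -> rHom M S) (p : 'I_n -> rHom S M) :
  (forall j l, p l \* i j = (rid M) *+ (j == l)) ->
  forall j, p j \* (\sum_l i l \* f l) = f j.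
Proof.
move=> H j; rewrite rcomp_sumr (bigD1 j) //= big1 ?addr0 => [|l lj].
  by rewrite rcompA H eqxx mulr1n rcomp1m.
by rewrite rcompA H (negPf lj) rcomp0l.
Qed.

(** A basis of Hom(M, X) assembles into a map from a power of M to X. Together with the dual
    construction this makes add M functorially finite for every M. *)
Lemma right_approx M X : exists C (p : rHom C X), addp M C /\ lifts p M.
Proof.
pose b := vbasis {: rHom M X}; have [S [i [p [H1 _ aS]]]] := power_ex M (\dim {: rHom M X}).
exists S, (\sum_(j < \dim {: rHom M X}) b`_j \* p j); split=> // h.
exists (\sum_(j < \dim {: rHom M X}) coord b j h *: i j).
rewrite {1}(coord_vbasis (memvf h)) rcomp_sumr; apply: eq_bigr => j _.
rewrite -{1}(power_sum (fun j : 'I_(\dim {: rHom M X}) => b`_j) H1 j).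
by apply: rHom_inj => v; rewrite !(rcompE, rHomZE) rHomZ.
Qed.

Lemma left_approx M X : exists C (i : rHom X C), addp M C /\
  forall h : rHom X M, exists h', h = h' \* i.
Proof.
pose b := vbasis {: rHom X M}; have [S [i [p [H1 _ aS]]]] := power_ex M (\dim {: rHom X M}).
exists S, (\sum_(j < \dim {: rHom X M}) i j \* b`_j); split=> // h.
exists (\sum_(j < \dim {: rHom X M}) coord b j h *: p j).
rewrite {1}(coord_vbasis (memvf h)) rcomp_suml; apply: eq_bigr => j _.
rewrite -{1}(power_sumr (fun j : 'I_(\dim {: rHom X M}) => b`_j) H1 j).
by apply: rHom_inj => v; rewrite !(rcompE, rHomZE).
Qed.

Lemma functorially_finite_add M : functorially_finite (in_add (M : modcat A)).
Proof.
move=> X; split.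
  have [C [p [aC lif]]] := right_approx M X; exists C, p.
  split=> [|Y g /in_addE aY]; first exact/in_addE.
  exact: lifts_addp aY lif g.
have [C [i [aC ext]]] := left_approx M X; exists C, i.
split=> [|Y g /in_addE[n [u [v uv]]]]; first exact/in_addE.
have /choice[h hE] : forall j, exists h, v j \* (g : rHom X Y) = h \* i by move=> j; apply: ext.
exists (\sum_j u j \* h j); rewrite [RHS]rcomp_suml -[LHS]rcomp1m -uv rcomp_suml.
by apply: eq_bigr => j _; rewrite -!rcompA hE.
Qed.

Lemma ct_objectE n M : ct_object n M <->
  (forall X, addp M X <-> forall i, (i.+1 < n)%N -> ez i M X) /\
  (forall X, addp M X <-> forall i, (i.+1 < n)%N -> ez i X M).
Proof.
have key1 X : (forall i, (i.+1 < n)%N -> ez i M X) <-> (forall (C : modcat A) i, in_add (M : modcat A) C ->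
    (0 < i < n)%N -> ext_vanishes i C X).
  split=> [e C [|i] // /in_addE aC /e e' | e i im].
    by apply/ext_vanishesE; apply: ez_addl e'.
  by apply/ext_vanishesE/e => //; apply/in_addE/addp_refl.
have key2 X : (forall i, (i.+1 < n)%N -> ez i X M) <-> (forall (C : modcat A) i, in_add (M : modcat A) C ->
    (0 < i < n)%N -> ext_vanishes i X C).
  split=> [e C [|i] // /in_addE aC /e e' | e i im].
    by apply/ext_vanishesE; apply: ez_addr e'.
  by apply/ext_vanishesE/e => //; apply/in_addE/addp_refl.
split=> [[_ H1 H2] | [H1 H2]].
  by split=> X; rewrite -in_addE ?key1 ?key2; [exact: H1 | exact: H2].
split=> [|X|X]; first exact: functorially_finite_add.
  by rewrite -key1 -H1; apply: in_addE.
by rewrite -key2 -H2; apply: in_addE.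
Qed.

Section Approximations.

Variable M : rmodType A.
Hypothesis aA : addp M (regular_rmod A).

Lemma approx_ses X : exists K C (u : rHom K C) (p : rHom C X),
  [/\ addp M C, ses u p & lifts p M].
Proof.
have [C [p [aC lif]]] := right_approx M X; have [K [u [mu xu]]] := ker_ex p.
exists K, C, u, p; split=> //; split=> // x.
have [f fE] := regular_hom x; have [g gE] := lifts_addp aA lif f.
by exists (g (1 : A)); rewrite -rcompE -gE fE ract1.
Qed.

(** The kernel of an approximation gains one degree of vanishing against M: degree 1 because maps
    from M lift, the higher degrees by shifting from X. *)
Lemma approx_ez n K C X (u : rHom K C) (p : rHom C X) l :
  (forall i, (i.+1 < n)%N -> ez i M M) -> addp M C -> ses u p -> lifts p M ->
  (l.+1 < n)%N -> (forall i, (i < l)%N -> ez i M X) -> forall i, (i <= l)%N -> ez i M K.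
Proof.
move=> eM aC s lif ln eX i il.
have eC : ez i M C by apply: ez_addr aC (eM _ _); apply: leq_ltn_trans ln.
case: i il eC => [|i] il eC; first exact: (ez_ses_base s lif eC).
exact: (ez_ses_left s (eX _ il) eC).
Qed.

(** What remains is that Ext^i(X, M) = 0 for 0 < i < n puts X in add M. The approximation of X
    splits once Ext^1(X, K) = 0 for its kernel K. This is obtained by approximating K, then the
    kernel so found, and so on, until a kernel lies in add M. *)
Lemma ct_object_half n : (0 < n)%N ->
  (forall i, (i.+1 < n)%N -> ez i M M) ->
  (forall X, (forall i, (i.+1 < n)%N -> ez i M X) -> addp M X) ->
  ct_object n M.
Proof.
move=> n0 eM H; apply/ct_objectE; split=> X; split=> [aX i im | eX].
- by apply: ez_addr aX _; apply: eM.
- exact: H.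
- by apply: ez_addl aX _; apply: eM.
case: n => [|[|n]] // in n0 eM H eX *; first exact: H.
(* [n] now stands for the original value minus 2. The induction descends from l = n, where K is in
   add M by [H]; for smaller l, approximating K trades it for a kernel with one more vanishing
   degree. *)
have key d l K : (l + d)%N = n -> (forall i, (i <= l)%N -> ez i M K) -> ez l X K.
  elim: d l K => [|d IH] l K ld eK.
    apply: (@ez_addr _ _ l X M); last by apply: eX; rewrite -ld addn0.
    by apply: H => i; rewrite ltnS => im; apply: eK; rewrite -[l]addn0 ld.
  have [K' [C [u [p [aC s lif]]]]] := approx_ses K.
  have ln : (l < n)%N by rewrite -ld addnS ltnS leq_addr.
  have eK' : ez l.+1 X K'.
    apply: IH; first by rewrite addSnnS.
    by apply: (approx_ez (n := n.+2) eM aC s lif) => // i; rewrite ltnS => /eK.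
  apply: (ez_ses_right s eK'); apply: (@ez_addr _ _ l X M) => //.
  by apply: eX; rewrite !ltnS ltnW.
have [K [C [u [p [aC s lif]]]]] := approx_ses X.
have [|f fE] := @ez0_lift _ _ _ _ _ _ u p _ s (rid X); last first.
  by apply: retract_addp aC; exists f, p.
by apply: (key n) => //; apply: (approx_ez (n := n.+2) eM aC s lif).
Qed.

End Approximations.

Lemma copres_iso (E : forall V J, rHom V J -> Prop) m V W (f : rHom V W) :
  (forall J (j : rHom W J), E W J j -> E V J (j \* f)) ->
  mono f -> epi f -> copres E m W -> copres E m V.
Proof.
move=> fE mf ef; case: m => //= m [J [Z [j [q [Ej [mj eq xj] cZ]]]]].
exists J, Z, (j \* f), q; split=> //; first exact: fE.
split=> //; first exact: mono_comp.
move=> x; rewrite xj; split=> [[w <-]|[v <-]]; last by exists (f v); rewrite rcompE.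
by have [v <-] := ef w; exists v; rewrite rcompE.
Qed.

Lemma copres_add2 Q Y : copres_add Q 2 Y <->
  exists Q0 Q1 (m : rHom Y Q0) (d : rHom Q0 Q1),
    [/\ addp Q Q0, addp Q Q1, mono m & exact m d].
Proof.
split=> [[Q0 [Z [j [q [a0 [mj eq xj] [Q1 [_ [j' [_ [a1 [mj' _ _] _]]]]]]]]]] |
         [Q0 [Q1 [m [d [a0 a1 mm xm]]]]]].
  exists Q0, Q1, j, (j' \* q); split=> // x.
  by rewrite -xj rcompE; split=> [/mj'//|->]; exact: rHom0.
have [Z [q [eq xq]]] := coker_ex m; have [Z' [e [m' [ee mm' dE]]]] := img_ex d.
exists Q0, Z', m, e; split=> //.
  by split=> // x; rewrite -xm dE rcompE; split=> [->|/mm'//]; exact: rHom0.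
have [Z'' [q' [eq' xq']]] := coker_ex m'.
by exists Q1, Z'', m', q'; split.
Qed.

End ClusterTilting.

Section Correspondence.

Variables (k : fieldType) (A : fdAlgType k) (T : rmodType A).
Hypotheses (iT : injective_rmod T) (pT : projective T).
Implicit Types M U V W X Y Z P J : rmodType A.

Local Notation B := (endalg T).

Lemma dev_sep X (f : rHom X T) : (forall phi : dhom_rmod T X, dev phi f = 0) -> f = 0.
Proof.
move=> f0; rewrite (coord_vbasis (memvf f)) big1 // => j _.
have lin c (h h' : rHom X T) : coord (vbasis {: rHom X T}) j (c *: h + h') =
  c * coord (vbasis {: rHom X T}) j h + coord (vbasis {: rHom X T}) j h' by rewrite linearP.
by have [phi phiE] := dhom_of lin; rewrite -phiE f0 scale0r.
Qed.

Lemma Gmap_faithful_add X Y (f : rHom X Y) : addp T Y -> Gmap T f = 0 -> f = 0.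
Proof.
move=> [n [p [q pq]]] f0; rewrite -[f]rcomp1m -pq rcomp_suml big1 // => j _.
suff -> : p j \* q j \* f = p j \* (q j \* f).
  suff -> : q j \* f = 0 by rewrite rcomp0r.
  apply: dev_sep => phi; rewrite -[q j \* f]rcomp1m -GmapE GmapM f0 rcomp0r.
  by rewrite rHom0E dev0.
by rewrite rcompA.
Qed.

Lemma Gmap_faithful X Y (f : rHom X Y) :
  copres_add T 1 Y -> Gmap T f = 0 -> f = 0.
Proof.
move=> [Q0 [Z [m [q [a0 [mm _ _] _]]]]] f0; apply: (mono_rcompI mm).
by rewrite rcomp0r; apply: (Gmap_faithful_add a0); rewrite GmapM f0 rcomp0r.
Qed.

(** A map v into D Hom(T, T) is determined by the form phi |-> v(phi)(id), which by reflexivity is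
    evaluation at a map X -> T. *)
Lemma Gmap_full_add X Y (u : rHom (dhom_rmod T X) (dhom_rmod T Y)) :
  addp T Y -> exists f, u = Gmap T f.
Proof.
have base (v : rHom (dhom_rmod T X) (dhom_rmod T T)) : exists f, v = Gmap T f.
  have lin : linear (fun phi : dhom_rmod T X => dev (v phi) (rid T) : k^o).
    by move=> c f g; rewrite rHomD rHomZ (devP c (v f) (v g)).
  have [Xi XiE] := linfun_ex lin; have [h hE] := dhom_form Xi.
  exists h; apply: rHom_inj => phi; apply: dev_inj => f.
  have -> : dev (v phi) f = Xi (ract phi (f : B)).
    by rewrite XiE rHomE dev_ract rcompm1.
  by rewrite hE dev_ract GmapE.
move=> [n [p [q pq]]].
have /choice[f fE] : forall j, exists f, Gmap T (q j) \* u = Gmap T f by move=> j; apply: base.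
exists (\sum_j p j \* f j); rewrite Gmap_sum -[LHS]rcomp1m -Gmap1 -pq Gmap_sum.
by rewrite rcomp_suml; apply: eq_bigr => j _; rewrite !GmapM -rcompA fE.
Qed.

(** A map into the image of Y is first realized as a map X -> Q_0. Faithfulness at Q_1 shows that it
    dies in Q_1, so it factors through Y. *)
Lemma Gmap_full X Y (u : rHom (dhom_rmod T X) (dhom_rmod T Y)) :
  copres_add T 2 Y -> exists f, u = Gmap T f.
Proof.
move=> /copres_add2[Q0 [Q1 [m [d [a0 a1 mm xm]]]]].
have [h hE] := Gmap_full_add (Gmap T m \* u) a0.
have [|f fE] := @factor_ker _ _ _ _ _ _ m d h mm xm.
  apply: (Gmap_faithful_add a1); rewrite GmapM -hE rcompA -GmapM.
  by rewrite (exact_comp xm) Gmap0 rcomp0l.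
by exists f; apply: (mono_rcompI (Gmap_mono iT mm)); rewrite hE fE GmapM.
Qed.

Lemma dhom_injective J : addp T J -> injective_rmod (dhom_rmod T J).
Proof.
move=> /(dhom_addp T); apply: injective_addp; have [ev dT] := dhom_dual T.
exact: dual_injective dT.
Qed.

Lemma dhom_env (N : rmodType B) :
  exists S (i : rHom N (dhom_rmod T S)), addp T S /\ mono i.
Proof.
have [ev dT] := dhom_dual T; have [n [f fE]] := cogenerators dT N.
have [S [i [p [H1 _ aS]]]] := power_ex T n.
exists S, (\sum_j Gmap T (i j) \* f j); split=> // x x0; apply: fE => l.
rewrite -(@power_sumr _ _ _ n N f (dhom_rmod T S) (fun j => Gmap T (i j))
  (fun j => Gmap T (p j)) _ l) ?rcompE ?x0 ?rHom0 // => j m.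
by rewrite -GmapM H1; case: (j == m); rewrite ?mulr1n ?Gmap1 // !mulr0n Gmap0.
Qed.

(** N embeds in the image of some S in add T, and so does the cokernel of this embedding, for some
    S'. The resulting map comes from some S -> S' by fullness, and left exactness recovers N from
    its kernel. *)
Lemma dhom_dense (N : rmodType B) :
  exists Y (f : rHom N (dhom_rmod T Y)), [/\ copres_add T 2 Y, mono f & epi f].
Proof.
have [S [i [aS mi]]] := dhom_env N; have [Z [q [eq xq]]] := coker_ex i.
have [S' [i' [aS' mi']]] := dhom_env Z.
have [h hE] := Gmap_full_add (i' \* q) aS'.
have [Y [y [my xy]]] := ker_ex h.
have mGy := Gmap_mono iT my; have xGy := Gmap_lexact iT my xy.
have xi : exact i (Gmap T h).
  by move=> x; rewrite -hE -xq rcompE; split=> [/mi'//|->]; exact: rHom0.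
have [f fE] := factor_ker mGy xGy (exact_comp xi).
exists Y, f; split; first by apply/copres_add2; exists S, S', y, h.
  by move=> x fx0; apply: mi; rewrite fE rcompE fx0 rHom0.
move=> w; have /xi[x xE] : Gmap T h (Gmap T y w) = 0 by apply/xGy; exists w.
by exists x; apply: (mono_inj mGy); rewrite -xE fE rcompE.
Qed.

(** The i + 1 degrees of shifting use up one term each; the two terms left over make the functor
    full at the last cosyzygy, where projectivity of P gives the lift. *)
Lemma ez_dhom i P Y : projective P -> copres_add T (i + 3) Y ->
  ez i (dhom_rmod T P) (dhom_rmod T Y).
Proof.
move=> pP; elim: i Y => [|i IH] Y [J [Z [j [q [aJ sjq cZ]]]]].
  apply/(ez0_inj _ (dhom_injective aJ) (Gmap_ses iT sjq)) => u.
  have [h ->] := Gmap_full u cZ; case: sjq => _ eq _.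
  by have [g ->] := (projectiveE P).1 pP _ _ q h eq; exists (Gmap T g); rewrite GmapM.
by apply/(ez_shift _ _ (dhom_injective aJ) (Gmap_ses iT sjq))/IH.
Qed.

(** Each vanishing degree yields one further term. The point is that the cokernel Z of Y -> Q_0
    again has a two-term copresentation, although a priori only its embedding in add T is known. *)
Lemma copres_ez m Y : copres_add T 2 Y ->
  (forall i, (i < m)%N -> ez i (dhom_rmod T (regular_rmod A)) (dhom_rmod T Y)) ->
  copres_add T (m + 2) Y.
Proof.
elim: m Y => [//|m IH] Y [Q0 [Z [j [q [a0 sjq cZ]]]]] e.
have iQ0 := dhom_injective a0; have sG := Gmap_ses iT sjq.
exists Q0, Z, j, q; split=> //; apply: IH; last first.
  by move=> i im; apply/(ez_shift _ _ iQ0 sG)/e.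
have lif := (ez0_inj _ iQ0 sG).1 (e 0%N isT).
(* By density some W with a two-term copresentation has the same image as Z under F = D Hom(-, T),
   and fullness at W realizes the isomorphism by [w] : Z -> W. It remains to see that [w] is an
   isomorphism. *)
have [W [f [cW mf ef]]] := dhom_dense (dhom_rmod T Z).
have [w wE] := Gmap_full f cW.
have [g [gf fg]] := iso_ex mf ef.
have mw : mono w.
  have [K [u [mu xu]]] := ker_ex w.
  have u0 : u = 0.
    apply: (Gmap_faithful cZ); apply: (mono_rcompI mf).
    by rewrite wE -GmapM (exact_comp xu) Gmap0 rcomp0r.
  by move=> z /xu[x <-]; rewrite u0 rHom0E.
have ew : epi w.
  (* An element of W is a map A -> W. The induced map F A -> F Z lifts to F Q_0 because Ext^1(F A, F
     Y) = 0, so by faithfulness the element comes from Q_0. *)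
  move=> y; have [r rE] := regular_hom y; have [u uE] := lif (g \* Gmap T r).
  have [u' u'E] := Gmap_full_add u a0.
  have cW1 : copres_add T 1 W by apply: copres_ge cW.
  have : r = w \* q \* u'.
    apply/eqP; rewrite -subr_eq0; apply/eqP/(Gmap_faithful cW1).
    by rewrite GmapB !GmapM -u'E -rcompA -uE -wE rcompA fg rcomp1m subrr.
  move/rHom_ext/(_ (1 : A)); rewrite rE ract1 !rcompE => ->.
  by exists (q (u' (1 : A))).
by apply: copres_iso mw ew cW => J h.
Qed.

(** The terms in add T are projective, so Y is an m-th syzygy. *)
Lemma copres_pdle N m Y : (forall X, pdle N X) -> (m <= N)%N -> copres_add T m Y ->
  pdle (N - m) Y.
Proof.
move=> pd; elim: m Y => [|m IH] Y mN; first by rewrite subn0.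
move=> [J [Z [j [q [aJ sjq cZ]]]]]; apply/(pdleS _ (projective_addp pT aJ) sjq).
by rewrite subnSK //; apply: IH => //; apply: ltnW.
Qed.

(** Since T is injective it lies in add D A; hence Hom(T, T) lies in add Hom(T, D A), and Hom(T, D
    A) is D Hom(A, T). This is the generator hypothesis of [ct_object_half]. *)
Lemma regular_dhom : addp (dhom_rmod T (regular_rmod A)) (regular_rmod B).
Proof.
have [D [ev dD]] := dual_ex A.
have [f [g [gf fg _]]] := hom_regular_iso T.
apply: (@retract_addp _ _ _ _ (hom_rmod T T)); first by exists f, g.
apply: (@addp_trans _ _ _ (hom_rmod T D)).
  by apply: retract_addp (hom_dual_retract T dD) (addp_refl _).
by apply/hom_addp/(injective_dual dD).
Qed.

Lemma dhom_ct n : (0 < n)%N -> copres_add T n.+1 (regular_rmod A) ->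
  (forall X, pdle n.+1 X) -> ct_object n (dhom_rmod T (regular_rmod A)).
Proof.
move=> n0 cA pd; apply: (ct_object_half regular_dhom n0) => [i im | X eX].
  apply: ez_dhom; first exact: regular_projective.
  by apply: copres_ge cA; rewrite addn3.
have [Y [f [cY mf ef]]] := dhom_dense X; have [g [gf fg]] := iso_ex mf ef.
have cY' : copres_add T (n.-1 + 2) Y.
  apply: copres_ez => // i im.
  have eXi : ez i (dhom_rmod T (regular_rmod A)) X.
    by apply: eX; rewrite -(prednK n0) ltnS.
  by apply: ez_addr eXi; apply: retract_addp (addp_refl _); exists g, f.
(* The copresentation has (n - 1) + 2 = n + 1 terms, the bound on all projective dimensions, so
   dimension 0 is left for Y. *)
have pY : projective Y.
  apply/pdle0; rewrite -(subnn n.+1); apply: copres_pdle => //.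
  by move: cY'; rewrite addn2 prednK.
apply: (@retract_addp _ _ _ _ (dhom_rmod T Y)); first by exists f, g.
by apply/dhom_addp/projective_regular.
Qed.

(** Full faithfulness identifies the endomorphisms of F A with those of A, which are the left
    multiplications [L]. *)
Lemma dhom_end_iso : copres_add T 2 (regular_rmod A) ->
  fdalg_iso A (endalg (dhom_rmod T (regular_rmod A))).
Proof.
move=> cA; pose L (a : A) := sval (regular_hom (a : regular_rmod A)).
have LE (a : A) : forall b : A, L a (b : regular_rmod A) = a * b.
  exact: (svalP (regular_hom (a : regular_rmod A))).
pose F a : endalg (dhom_rmod T (regular_rmod A)) := Gmap T (L a).
have lF : linear F.
  move=> c a b; apply: rHom_inj => phi; apply: dev_inj => h.
  rewrite !rhE devP !GmapE -devrP; congr dev; apply: rHom_inj => x.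
  by rewrite !rhE !LE -rHomZ -rHomD mulrDl fdmulZl.
pose f : {linear A -> endalg (dhom_rmod T (regular_rmod A))} :=
  HB.pack F (GRing.isLinear.Build _ _ _ _ _ lF).
exists f; split.
- have inj : injective F.
    move=> a b /eqP; rewrite -subr_eq0 => /eqP ab.
    have {}ab : L a - L b = 0.
      by apply: (Gmap_faithful (copres_ge _ cA)) => //; rewrite GmapB.
    have := rHom_ext ab (1 : A); rewrite !rhE !LE !mulr1 => /eqP.
    by rewrite subr_eq0 => /eqP.
  have sur u : exists a, F a = u.
    have [h ->] := Gmap_full (u : rHom _ _) cA; exists (h (1 : A)).
    congr Gmap; apply: rHom_inj => a; rewrite LE; exact/esym/regular_homE.
  have [g gE] := choice sur.
  by exists g => [a|u]; [apply: inj; rewrite gE | rewrite -[RHS]gE].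
- transitivity (Gmap T (rid (regular_rmod A))); last exact: Gmap1.
  by congr Gmap; apply: rHom_inj => a; rewrite LE ridE mul1r.
- move=> a b; transitivity (Gmap T (L a \* L b)); last exact: GmapM.
  by congr Gmap; apply: rHom_inj => c; rewrite rcompE !LE mulrA.
Qed.

End Correspondence.

Theorem auslander_surj (k : fieldType) n (G : fdAlgType k) : (0 < n)%N ->
  auslander_algebra n G ->
  exists (L : fdAlgType k) (M : rmodType L), ct_object n M /\ fdalg_iso G (endalg M).
Proof.
move=> n0 [gl dd]; have [Q [pQ iQ cQ]] := domdim_copres_add dd.
exists (endalg Q), (dhom_rmod Q (regular_rmod G)); split.
  by apply: dhom_ct => // X; apply/projdim_leE.
by apply: dhom_end_iso => //; apply: copres_ge cQ.
Qed.

(** * From cluster tilting objects to Auslander algebras *)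

Lemma ez_injr (k : fieldType) (A : fdAlgType k) i (X J : rmodType A) :
  injective_rmod J -> ez i X J.
Proof.
move=> /injectiveE iJ; elim: i X => [|i IH] X W P u p pP [mu eu xu]; last exact: IH.
by move=> h; apply: iJ.
Qed.

Section EndomorphismAlgebra.

Variables (k : fieldType) (A : fdAlgType k) (M : rmodType A) (n : nat).
Hypotheses (n0 : (0 < n)%N) (ctM : ct_object n M).
Implicit Types U V W X Y Z P J : rmodType A.

Local Notation B := (endalg M).

Let ct1 X : (forall i, (i.+1 < n)%N -> ez i M X) -> addp M X.
Proof. by case/ct_objectE: ctM => H _ /H. Qed.

Let ct2 i : (i.+1 < n)%N -> ez i M M.
Proof. by case/ct_objectE: ctM => H _; apply: (H M).1; apply: addp_refl. Qed.

Lemma ct_generator : addp M (regular_rmod A).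
Proof.
by case/ct_objectE: ctM => _ H; apply/H => i _; apply/ez_projl/regular_projective.
Qed.

(** X lacks at most j of the n - 1 vanishing degrees that would put it in add M. Each approximation
    recovers one degree and costs one projective term. *)
Lemma hom_pdle j X : (j < n)%N -> (forall i, (i + j < n.-1)%N -> ez i M X) ->
  pdle j (hom_rmod M X).
Proof.
elim: j X => [|j IH] X jn eX.
  apply/pdle0/hom_projective/ct1 => i im; apply: eX.
  by rewrite addn0 -ltnS prednK.
have [K [C [u [p [aC s lif]]]]] := approx_ses ct_generator X.
apply/(pdleS _ (hom_projective aC) (Hmap_ses s lif)); apply: IH (ltnW jn) _ => i ijn.
have eC : ez i M C.
  apply: ez_addr aC (ct2 _); rewrite -(prednK n0) ltnS.
  by apply: leq_ltn_trans ijn; apply: leq_addr.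
case: i eC ijn => [|i] eC ijn; first exact: (ez_ses_base s lif eC).
by apply: (ez_ses_left s _ eC); apply: eX; rewrite addnS -addSn.
Qed.

Lemma endalg_gldim : gldim_le B n.+1.
Proof.
move=> N; apply/projdim_leE.
have [M0 [p0 [a0 e0]]] := hom_cover N; have [W [w [mw xw]]] := ker_ex p0.
have [M1 [p1 [a1 e1]]] := hom_cover W.
have [f fE] := Hmap_full (w \* p1) a1; have [K [u [mu xu]]] := ker_ex f.
have s0 : ses w p0 by split.
have s1 : ses (Hmap M u) p1.
  split=> //; first exact: Hmap_mono.
  move=> h; rewrite -(Hmap_exact mu xu) -fE rcompE.
  by split=> [->|/mw//]; exact: rHom0.
apply/(pdleS _ (hom_projective a0) s0); rewrite -(prednK n0).
(* Nothing is known about K, but for j = n - 1 the condition of [hom_pdle] is empty. *)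
apply/(pdleS _ (hom_projective a1) s1); apply: hom_pdle => [|i].
  by rewrite prednK.
by rewrite ltnNge leq_addl.
Qed.

(** J lies in add D A, and Hom(M, D A) is D Hom(A, M), which lies in add D Hom(M, M) because A is in
    add M. The last module is the dual of B. *)
Lemma hom_injective J : injective_rmod J -> injective_rmod (hom_rmod M J).
Proof.
have [D [ev dD]] := dual_ex A => iJ; have [ev' dM] := dhom_dual M.
apply: (injective_addp (dual_injective dM)).
apply: (addp_trans (dhom_addp M ct_generator)).
apply: (@addp_trans _ _ _ (hom_rmod M D)); last first.
  by apply/hom_addp/(injective_dual dD).
by apply: retract_addp (hom_dual_retract M dD) (addp_refl _).
Qed.

(* A nonzero h : M -> J takes a nonzero value in Y, hence restricts to a nonzero
   map M -> A -> J with image in Y because A is a summand of a power of M. *)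
Lemma hom_ess Y J (f : rHom Y J) (N : rmodType B) (w : rHom N (hom_rmod M Y)) :
  ess f ->
  (forall (g : rHom M (regular_rmod A)) (y : rHom (regular_rmod A) Y),
     exists x, w x = y \* g) ->
  ess (Hmap M f \* w).
Proof.
move=> ef wE h h0.
have [m hm] : exists m, (h : rHom M J) m <> 0.
  apply: contrapT => no; apply: h0; apply: rHom_inj => m; rewrite rHom0E.
  by apply: contrapT => hm; apply: no; exists m.
have [a [hma [y fy]]] := ef _ hm.
have [c cE] := regular_hom (ract m a); have [d dE] := regular_hom y.
have hc : (h : rHom M J) \* c = f \* d.
  apply: rHom_inj => b; rewrite !rcompE cE dE !rHomE fy.
  by congr ract; apply/esym/rHomE.
have [g hg] : exists g : rHom M (regular_rmod A), (h : rHom M J) \* c \* g <> 0.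
  apply: contrapT => no; apply: hma.
  have : (h : rHom M J) \* c = 0.
    apply: (addp_hom0 ct_generator) => g; apply: contrapT => hg; apply: no.
    by exists g.
  move/rHom_ext/(_ (1 : A)); rewrite rcompE cE ract1 rHom0E => <-.
  exact/esym/rHomE.
(* The required scalar is the endomorphism M -> A -> M, whose second map sends 1 to m a. *)
exists (c \* g : B); split.
  by move=> e; apply: hg; rewrite -rcompA; exact: e.
have [x xE] := wE g d; exists x; rewrite rcompE xE HmapE rcompA -hc.
exact/esym/rcompA.
Qed.

(** As long as Ext^1 vanishes, Hom(M, -) keeps the sequence exact and the induction proceeds. At the
    end it is only left exact, yet the image of Hom(M, J) in Hom(M, Z) still embeds essentially in
    the next term, which accounts for the summand 2. *)
Lemma hom_copres m Y : (forall i, (i < m)%N -> ez i M Y) ->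
  copres (fun (V J : rmodType B) (j : rHom V J) =>
    [/\ injective_rmod J, projective J & ess j]) (m + 2) (hom_rmod M Y).
Proof.
have pr J : injective_rmod J -> projective (hom_rmod M J).
  by move=> iJ; apply/hom_projective/ct1 => i _; apply: ez_injr.
elim: m Y => [|m IH] Y eY; have [J [f [iJ mf ef]]] := envelope_ex Y;
  have [Z [q [eq xq]]] := coker_ex f.
  have [J1 [g [iJ1 mg eg]]] := envelope_ex Z.
  have [W [e [w [ee mw qE]]]] := img_ex (Hmap M q).
  have [Z' [q' [eq' xq']]] := coker_ex (Hmap M g \* w).
  exists (hom_rmod M J), W, (Hmap M f), e; split.
  - split; [exact: hom_injective | exact: pr |].
    rewrite -[Hmap M f]rcompm1; apply: hom_ess ef _ => g' y.
    by exists (y \* g'); rewrite ridE.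
  - split=> //; first exact: Hmap_mono.
    move=> h; rewrite -(Hmap_exact mf xq) qE rcompE.
    by split=> [->|/mw//]; exact: rHom0.
  - exists (hom_rmod M J1), Z', (Hmap M g \* w), q'; split=> //.
      split; [exact: hom_injective | exact: pr |].
      (* Only maps M -> A -> Z have to lie in the image of Hom(M, q), and these lift because A is
         projective. *)
      apply: hom_ess eg _ => g' y.
      have [y' ->] := (projectiveE _).1 (@regular_projective _ A) _ _ q y eq.
      exists (e (y' \* g')); rewrite -rcompE -qE HmapE.
      exact: rcompA.
    by split=> //; apply: mono_comp mw (Hmap_mono mg).
have s : ses f q by split.
have lif := (ez0_inj _ iJ s).1 (eY 0%N isT).
exists (hom_rmod M J), (hom_rmod M Z), (Hmap M f), (Hmap M q); split.
- split; [exact: hom_injective | exact: pr |].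
  rewrite -[Hmap M f]rcompm1; apply: hom_ess ef _ => g' y.
  by exists (y \* g'); rewrite ridE.
- exact: Hmap_ses.
- by apply: IH => i im; apply/(ez_shift _ _ iJ s)/eY.
Qed.

Lemma endalg_domdim : domdim_ge B n.+1.
Proof.
apply: domdim_copres; have [f [g [gf fg _]]] := hom_regular_iso M.
apply: (@copres_iso _ _ _ _ _ (hom_rmod M M) f) => [J j [iJ pJ ej] | v fv0 | w |].
- split=> // w /ej[a [wa [v vE]]]; exists a; split=> //; exists (g v).
  by rewrite rcompE -(rcompE f) fg ridE.
- by have := rHom_ext gf v; rewrite rcompE fv0 rHom0 ridE => <-.
- by exists (g w); rewrite -(rcompE f) fg ridE.
have -> : n.+1 = (n.-1 + 2)%N by rewrite addn2 prednK.
by apply: hom_copres => i im; apply: ct2; rewrite -(prednK n0) ltnS.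
Qed.

Lemma endalg_auslander : auslander_algebra n B.
Proof. by split; [exact: endalg_gldim | exact: endalg_domdim]. Qed.

End EndomorphismAlgebra.

(** * Equivalences of preadditive categories *)

Section Iso.

Variable C : preadditive.
Implicit Types X Y Z : C.

Lemma mcomp0r X Y Z (g : mor Y Z) : g \oc (0 : mor X Y) = 0.
Proof. by apply: (addrI (g \oc 0)); rewrite -mcompDr !addr0. Qed.

Lemma mcomp0l X Y Z (f : mor X Y) : (0 : mor Y Z) \oc f = 0.
Proof. by apply: (addrI (0 \oc f)); rewrite -mcompDl !addr0. Qed.

Lemma mcomp_sumr I (r : seq I) X Y Z (g : mor Y Z) (f : I -> mor X Y) :
  g \oc (\sum_(j <- r) f j) = \sum_(j <- r) g \oc f j.
Proof.
elim: r => [|x r IH]; last by rewrite !big_cons mcompDr IH.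
by rewrite !big_nil mcomp0r.
Qed.

Lemma mcomp_suml I (r : seq I) X Y Z (f : mor X Y) (g : I -> mor Y Z) :
  (\sum_(j <- r) g j) \oc f = \sum_(j <- r) g j \oc f.
Proof.
elim: r => [|x r IH]; last by rewrite !big_cons mcompDl IH.
by rewrite !big_nil mcomp0l.
Qed.

Lemma iso_comp X Y Z (g : mor Y Z) (f : mor X Y) : is_iso g -> is_iso f -> is_iso (g \oc f).
Proof.
move=> [g' [g'g gg']] [f' [f'f ff']]; exists (f' \oc g'); split.
  by rewrite -mcompA (mcompA g') g'g mcomp1m.
by rewrite -mcompA (mcompA f) ff' mcomp1m.
Qed.

Lemma iso_id X : is_iso (idm X).
Proof. by exists (idm X); rewrite mcomp1m. Qed.

Lemma iso_monic X Y Z (f : mor Y Z) (g h : mor X Y) : is_iso f -> f \oc g = f \oc h -> g = h.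
Proof.
by move=> [f' [f'f _]] /(congr1 (mcomp f')); rewrite !mcompA f'f !mcomp1m.
Qed.

Lemma iso_epic X Y Z (f : mor X Y) (g h : mor Y Z) : is_iso f -> g \oc f = h \oc f -> g = h.
Proof.
by move=> [f' [_ ff']] /(congr1 (fun u => u \oc f')); rewrite -!mcompA ff' !mcompm1.
Qed.

End Iso.

Lemma fmap_iso (C D : preadditive) (F : add_functor C D) (X Y : C) (f : mor X Y) :
  is_iso f -> is_iso (fmap F f).
Proof. by move=> [g [gf fg]]; exists (fmap F g); rewrite -!fmapM gf fg !fmap1. Qed.

Section Equivalences.

Definition faithful (C D : preadditive) (F : add_functor C D) :=
  forall X Y (f g : mor X Y), fmap F f = fmap F g -> f = g.
Definition full (C D : preadditive) (F : add_functor C D) :=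
  forall X Y (u : mor (F X) (F Y)), exists f, u = fmap F f.
Definition dense (C D : preadditive) (F : add_functor C D) :=
  forall Y, exists X (e : mor (F X) Y), is_iso e.
Definition equivalence (C D : preadditive) (F : add_functor C D) :=
  [/\ faithful F, full F & dense F].

Lemma equivalence_equivalent (C D : preadditive) (F : add_functor C D) :
  equivalence F -> equivalent C D.
Proof.
move=> [fF fuF dF].
have /all_tag[G0 /all_sig[e eI]] (Y : D) : {X : C & {e : mor (F X) Y | is_iso e}}.
  by have /cid[X /cid[e ei]] := dF Y; exists X, e.
have /all_sig[e' eE] (Y : D) : {e' : mor Y (F (G0 Y)) | e' \oc e Y = idm _ /\ e Y \oc e' = idm _}.
  exact/cid/eI.
have Gm (Y Y' : D) (g : mor Y Y') :
    {f : mor (G0 Y) (G0 Y') | e' Y' \oc g \oc e Y = fmap F f} by exact/cid/fuF.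
have G1 Y : sval (Gm Y Y (idm Y)) = idm (G0 Y).
  by apply: fF; rewrite -(svalP (Gm _ _ _)) fmap1 mcompm1; case: (eE Y).
have GM (X Y Z : D) (g : mor Y Z) (f : mor X Y) :
    sval (Gm X Z (g \oc f)) = sval (Gm Y Z g) \oc sval (Gm X Y f).
  apply: fF; rewrite fmapM -!(svalP (Gm _ _ _)) !mcompA.
  by congr (_ \oc _ \oc _); rewrite -!mcompA (eE Y).2 mcompm1.
have GD (X Y : D) (f g : mor X Y) :
    sval (Gm X Y (f + g)) = sval (Gm X Y f) + sval (Gm X Y g).
  by apply: fF; rewrite fmapD -!(svalP (Gm _ _ _)) mcompDr mcompDl.
pose G := @AddFunctor D C G0 (fun Y Y' g => sval (Gm Y Y' g)) G1 GM GD.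
have /all_sig[eta etaE] (X : C) : {f : mor X (G0 (F X)) | e' (F X) = fmap F f}.
  exact/cid/fuF.
exists F, G, eta, e; split=> [X|Y|X X' f|Y Y' g].
- have /cid[f fE] := fuF _ _ (e (F X)); have [e1 e2] := eE (F X).
  by exists f; split; apply: fF; rewrite fmapM fmap1 -etaE -fE.
- exact: eI.
- apply: fF; rewrite !fmapM -!etaE -(svalP (Gm _ _ _)) -!mcompA (eE (F X)).2.
  by rewrite mcompm1.
- by rewrite /= -(svalP (Gm _ _ _)) !mcompA (eE Y').2 mcomp1m.
Qed.

Lemma equivalent_equivalence (C D : preadditive) (F : add_functor C D)
    (G : add_functor D C) (eta : forall X : C, mor X (G (F X)))
    (eps : forall Y : D, mor (F (G Y)) Y) :
  (forall X, is_iso (eta X)) -> (forall Y, is_iso (eps Y)) ->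
  (forall (X X' : C) (f : mor X X'),
          eta X' \oc f = fmap G (fmap F f) \oc eta X) ->
  (forall (Y Y' : D) (g : mor Y Y'),
          eps Y' \oc fmap F (fmap G g) = g \oc eps Y) ->
  equivalence F /\ equivalence G.
Proof.
move=> ieta ieps neta neps.
have fF : faithful F.
  by move=> X Y f g e; apply: (iso_monic (ieta Y)); rewrite !neta e.
have fG : faithful G.
  by move=> X Y f g e; apply: (iso_epic (ieps X)); rewrite -!neps e.
split.
  split=> // [X Y u|Y]; last by exists (G Y), (eps Y).
  have [eta' [eta1 eta2]] := ieta Y.
  exists (eta' \oc (fmap G u \oc eta X)); apply: fG; apply: (iso_epic (ieta X)).
  by rewrite -neta mcompA eta2 mcomp1m.
split=> // [X Y u|X].
  have [eps' [eps1 eps2]] := ieps X.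
  exists (eps Y \oc fmap F u \oc eps'); apply: fF; apply: (iso_monic (ieps Y)).
  by rewrite neps -mcompA eps1 mcompm1.
by exists (F X); have [e [e1 e2]] := ieta X; exists e, (eta X).
Qed.

Lemma equivalentP (C D : preadditive) :
  equivalent C D <-> exists F : add_functor C D, equivalence F.
Proof.
split=> [[F [G [eta [eps [H1 H2 H3 H4]]]]] | [F]]; last exact: equivalence_equivalent.
by exists F; case: (equivalent_equivalence H1 H2 H3 H4).
Qed.

Lemma equivalent_sym (C D : preadditive) : equivalent C D -> equivalent D C.
Proof.
move=> [F [G [eta [eps [H1 H2 H3 H4]]]]].
have /all_sig[eta' etaE] X : {g | g \oc eta X = idm _ /\ eta X \oc g = idm _}.
  exact/cid/H1.
have /all_sig[eps' epsE] Y : {g | g \oc eps Y = idm _ /\ eps Y \oc g = idm _}.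
  exact/cid/H2.
exists G, F, eps', eta'; split=> [Y|X|Y Y' g|X X' f].
- by exists (eps Y); case: (epsE Y).
- by exists (eta X); case: (etaE X).
- apply: (iso_epic (H2 Y)); rewrite -mcompA -H4 mcompA (epsE Y').1 mcomp1m.
  by rewrite -mcompA (epsE Y).1 mcompm1.
- apply: (iso_epic (H1 X)); rewrite -mcompA -H3 mcompA (etaE X').1 mcomp1m.
  by rewrite -mcompA (etaE X).1 mcompm1.
Qed.

Definition id_functor (C : preadditive) : add_functor C C :=
  @AddFunctor C C id (fun _ _ f => f) (fun _ => erefl) (fun _ _ _ _ _ => erefl)
    (fun _ _ _ _ => erefl).

Lemma equivalent_refl (C : preadditive) : equivalent C C.
Proof.
apply/equivalentP; exists (id_functor C); split=> // [X Y u|Y]; first by exists u.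
by exists Y, (idm Y); apply: iso_id.
Qed.

Lemma comp_functor_ex (C D E : preadditive) (G : add_functor D E) (F : add_functor C D) :
  [/\ forall X : C, fmap G (fmap F (idm X)) = idm (G (F X)),
      forall (X Y Z : C) (g : mor Y Z) (f : mor X Y),
        fmap G (fmap F (g \oc f)) = fmap G (fmap F g) \oc fmap G (fmap F f) &
      forall (X Y : C) (f g : mor X Y),
        fmap G (fmap F (f + g)) = fmap G (fmap F f) + fmap G (fmap F g)].
Proof. by split=> *; rewrite ?fmap1 ?fmapM ?fmapD. Qed.

Lemma equivalent_trans (C D E : preadditive) :
  equivalent C D -> equivalent D E -> equivalent C E.
Proof.
move=> /equivalentP[F [fF uF dF]] /equivalentP[G [fG uG dG]].
apply/equivalentP; have [H1 HM HD] := comp_functor_ex G F.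
exists (@AddFunctor C E (fun X => G (F X)) (fun _ _ f => fmap G (fmap F f)) H1 HM HD).
split=> [X Y f g /fG/fF// | X Y u | Z].
  by have [v vE] := uG _ _ u; have [f fE] := uF _ _ v; exists f; rewrite /= -fE.
have [Y [e ie]] := dG Z; have [X [e' ie']] := dF Y.
by exists X, (e \oc fmap G e'); apply: iso_comp ie (fmap_iso G ie').
Qed.

(** A class is a predicate, so equality of classes rests on functional and propositional
    extensionality. *)
Lemma equivalent_eq (C D : preadditive) :
  equivalent C D -> equivalent C = equivalent D.
Proof.
move=> CD; apply: funext => E; apply: propext.
by split; apply: equivalent_trans => //; apply: equivalent_sym.
Qed.

(** The target is not known to have biproducts, so only the decomposition of the identity is
    transported. *)
Lemma dense_generator (C D : preadditive) (F : add_functor C D) (M : C) :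
  dense F -> (forall X, in_add M X) ->
  forall Y : D, exists n (p : 'I_n -> mor (F M) Y) (q : 'I_n -> mor Y (F M)),
    \sum_j p j \oc q j = idm Y.
Proof.
move=> dF gM Y; have [X [e [e' [e'e ee']]]] := dF Y.
have [n [S [[i [p [_ _ ip]]] [Z [i' [p' [/(_ true) pi' _ _]]]]]]] := gM X.
exists n, (fun j => e \oc fmap F (p' true \oc i j)), (fun j => fmap F (p j \oc i' true) \oc e').
transitivity (e \oc fmap F (\sum_j (p' true \oc i j) \oc (p j \oc i' true)) \oc e').
  rewrite fmap_sum.
  by rewrite mcomp_sumr mcomp_suml; apply: eq_bigr => j _; rewrite !fmapM !mcompA.
have -> : \sum_j (p' true \oc i j) \oc (p j \oc i' true) = idm X.
  rewrite -pi' -[i' true in RHS]mcomp1m -ip.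
  by rewrite mcomp_suml mcomp_sumr; apply: eq_bigr => j _; rewrite !mcompA.
by rewrite fmap1 mcompm1.
Qed.

End Equivalences.

(** * Morita equivalence and projectives *)

Definition projcat (k : fieldType) (A : fdAlgType k) : preadditive :=
  full_subcategory (fun X : modcat A => projective (X : rmodType A)).

Section AddProj.

Variables (k : fieldType) (A : fdAlgType k) (M : rmodType A).

Fact hom_projective_in_add (X : rmodType A) :
  in_add (M : modcat A) X -> projective (hom_rmod M X).
Proof. by move/in_addE/hom_projective. Qed.

Definition hom_add_proj : add_functor (addcat M) (projcat (endalg M)) :=
  @AddFunctor (addcat M) (projcat (endalg M))
    (fun X => exist _ (hom_rmod M (sval X) : modcat (endalg M))
      (hom_projective_in_add (svalP X)))
    (fun X Y f => Hmap M f)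
    (fun X => Hmap1 M (sval X)) (fun X Y Z g f => HmapM M g f) (fun X Y f g => HmapD M f g).

Lemma hom_add_proj_equivalence : equivalence hom_add_proj.
Proof.
split.
- move=> [X aX] [Y aY] f g e; pose h : rHom X Y := (f : rHom X Y) - g.
  suff h0 : h = 0 by apply/eqP; rewrite -subr_eq0; apply/eqP.
  apply: (Hmap_faithful (T := M)); first exact/in_addE.
  rewrite HmapB.
  by apply/eqP; rewrite subr_eq0; apply/eqP.
- by move=> [X aX] [Y aY] u; apply: Hmap_full; apply/in_addE.
move=> [P pP].
have [f [g [gf fg _]]] := hom_regular_iso M.
have aP : addp (hom_rmod M M) P.
  apply: addp_trans ((projective_regular P).1 pP).
  by apply: retract_addp (addp_refl _); exists f, g.
have [n [p [q pq]]] := aP; have [S [i [r [H1 _ aS]]]] := power_ex M n.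
have HH j l : Hmap M (r l) \* Hmap M (i j) = (rid (hom_rmod M M)) *+ (j == l).
  by rewrite -HmapM H1; case: (j == l); rewrite ?mulr1n ?Hmap1 // !mulr0n Hmap0.
pose pi : rHom (hom_rmod M S) P := \sum_j p j \* Hmap M (r j).
pose io : rHom P (hom_rmod M S) := \sum_j Hmap M (i j) \* q j.
have pio : pi \* io = rid P.
  rewrite /io rcomp_sumr -pq; apply: eq_bigr => j _.
  by rewrite rcompA (power_sum p HH).
(* P is a retract of Hom(M, S). The associated idempotent comes from an idempotent of S, which
   splits in mod A through its image X, and P is then isomorphic to Hom(M, X). *)
have [ep epE] := Hmap_full (io \* pi) aS.
have idem : ep \* ep = ep.
  apply/eqP; rewrite -subr_eq0; apply/eqP/(Hmap_faithful (T := M) aS).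
  rewrite HmapB HmapM -epE rcompA -[io \* pi \* io]rcompA.
  by rewrite pio rcompm1 subrr.
have [X [e [m [ee mm epm]]]] := img_ex ep.
have em : e \* m = rid X.
  apply: (mono_rcompI mm); apply: (epi_rcompI ee).
  by rewrite rcompm1 -epm -idem {1}epm -!rcompA -epm.
have aX : addp M X by apply: retract_addp aS; exists m, e.
exists (exist _ (X : modcat A) ((in_addE M X).2 aX)), (pi \* Hmap M m : rHom _ _).
exists (Hmap M e \* io : rHom _ _); split.
  transitivity (Hmap M e \* (io \* pi) \* Hmap M m).
    by rewrite -[LHS]/((Hmap M e \* io) \* (pi \* Hmap M m)) !rcompA.
  by rewrite epE -!HmapM epm rcompA em rcomp1m em; apply: Hmap1.
transitivity (pi \* (Hmap M m \* Hmap M e) \* io).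
  by rewrite -[LHS]/((pi \* Hmap M m) \* (Hmap M e \* io)) !rcompA.
by rewrite -HmapM -epm -epE !rcompA pio rcomp1m.
Qed.

End AddProj.

Section MoritaProj.

Variables (k : fieldType).

Lemma epi_cancel (A : fdAlgType k) (V W : rmodType A) (f : rHom V W) :
  (forall (Z : rmodType A) (h : rHom W Z), h \* f = 0 -> h = 0) -> epi f.
Proof.
move=> H w; have [Q [p [ep xp]]] := coker_ex f.
by apply/xp; rewrite (H _ p (exact_comp xp)) rHom0E.
Qed.

(** Surjective maps are the right-cancellable ones ([epi_cancel]), a condition that can be tested in
    the source after replacing Z by an isomorphic object in the image of F. *)
Lemma epi_equivalence (A B : fdAlgType k) (F : add_functor (modcat A) (modcat B))
    (V W : rmodType A) (f : rHom V W) :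
  equivalence F -> epi f -> epi (fmap F (f : mor (V : modcat A) W) : rHom _ _).
Proof.
move=> [fF uF dF] ef; apply: epi_cancel => Z h h0.
have [Z' [e ie]] := dF Z; have [e' [e'e ee']] := ie.
have [h' hE] := uF _ _ (e' \oc (h : mor (F W) (Z : modcat B))).
suff h'0 : h' = 0.
  apply: (iso_monic (C := modcat B) (X := F W) (Y := Z) (Z := F Z') (f := e')).
    by exists e.
  by rewrite [LHS]hE h'0 fmap0; rewrite [RHS](mcomp0r (C := modcat B)).
apply: (epi_rcompI (V := W) ef); rewrite rcomp0l; apply: fF; rewrite fmap0.
transitivity (e' \oc ((h : mor (F W) (Z : modcat B)) \oc fmap F (f : mor (V : modcat A) W))).
  by rewrite mcompA hE -fmapM.
by rewrite [X in _ \oc X]h0 mcomp0r.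
Qed.

Lemma projective_reflect (A B : fdAlgType k) (F : add_functor (modcat A) (modcat B))
    (P : rmodType A) :
  equivalence F -> projective (F P : rmodType B) -> projective P.
Proof.
move=> eF /projectiveE pFP; apply/projectiveE => V W g f eg.
have := epi_equivalence eF eg; case: eF => fF uF dF eFg.
have [h hE] := pFP _ _ _ (fmap F (f : mor (P : modcat A) W)) eFg.
have [h' h'E] := uF _ _ h; exists h'; apply: fF.
by rewrite [LHS]hE h'E -[LHS](fmapM F (g : mor (V : modcat A) W)).
Qed.

Lemma projective_iso (A : fdAlgType k) (P Q : modcat A) (f : mor P Q) :
  is_iso f -> projective (P : rmodType A) -> projective (Q : rmodType A).
Proof.
move=> [g [gf fg]] pP; apply: (projective_addp pP).
by apply: retract_addp (addp_refl _); exists g, f.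
Qed.

Lemma morita_projcat (A B : fdAlgType k) :
  equivalent (modcat A) (modcat B) -> equivalent (projcat A) (projcat B).
Proof.
move=> [F [G [eta [eps [H1 H2 H3 H4]]]]].
have [[fF uF dF] eG] := equivalent_equivalence H1 H2 H3 H4.
(* Preservation is reflection along the quasi-inverse, since G F X is isomorphic to X. *)
have pF (X : modcat A) : projective (X : rmodType A) -> projective (F X : rmodType B).
  by move=> pX; apply: (projective_reflect eG); apply: projective_iso (H1 X) pX.
have rF (X : modcat A) : projective (F X : rmodType B) -> projective (X : rmodType A).
  by move=> pX; apply: (projective_reflect _ pX).
pose Fp := @AddFunctor (projcat A) (projcat B)
    (fun X => exist _ (F (sval X)) (pF _ (svalP X)))
    (fun X Y f => fmap F (f : mor (sval X) (sval Y)))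
    (fun X => fmap1 F (sval X)) (fun X Y Z g f => fmapM F g f) (fun X Y f g => fmapD F f g).
apply/equivalentP; exists Fp; split=> [X Y f g | X Y u | [Y pY]]; first exact: fF.
  exact: uF.
have [X [e [e' [e'e ee']]]] := dF Y.
have pX : projective (X : rmodType A).
  by apply: rF; apply: (projective_iso (f := e')) pY; exists e.
by exists (exist _ X pX), e, e'.
Qed.

End MoritaProj.

(** * Extending an equivalence from projectives to modules *)

Section Extend.

Variables (k : fieldType) (A B : fdAlgType k) (F : add_functor (projcat A) (projcat B)).
Hypothesis eF : equivalence F.

Lemma proj_exact_lift (D : fdAlgType k) (P U V W : rmodType D)
    (f : rHom U V) (g : rHom V W) (h : rHom P V) :
  projective P -> exact f g -> g \* h = 0 -> exists h', h = f \* h'.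
Proof.
move=> /projectiveE pP xf gh; have [I [e [m [ee mm fE]]]] := img_ex f.
have [|u uE] := @factor_mono _ _ P I V m h mm.
  move=> p; have /xf[v <-] : g (h p) = 0 by rewrite -rcompE gh rHom0E.
  by exists (e v); rewrite fE rcompE.
have [v vE] := pP _ _ e u ee; exists v.
by rewrite uE vE fE rcompA.
Qed.

Definition pobj (D : fdAlgType k) (P : projcat D) : rmodType D := sval P.

Definition pmap (P Q : projcat A) (f : rHom (pobj P) (pobj Q)) :
  rHom (pobj (F P)) (pobj (F Q)) := fmap F (f : mor P Q).

Lemma pmapM P Q R (g : rHom (pobj Q) (pobj R)) (f : rHom (pobj P) (pobj Q)) :
  pmap (g \* f) = pmap g \* pmap f.
Proof. exact: (fmapM F (g : mor Q R) (f : mor P Q)). Qed.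

Lemma pmap1 P : pmap (rid (pobj P)) = rid (pobj (F P)).
Proof. exact: (fmap1 F P). Qed.

Lemma pmapD P Q (f g : rHom (pobj P) (pobj Q)) : pmap (f + g) = pmap f + pmap g.
Proof. exact: (fmapD F (f : mor P Q) g). Qed.

Lemma pmapB P Q (f g : rHom (pobj P) (pobj Q)) : pmap (f - g) = pmap f - pmap g.
Proof. exact: (fmapB F (f : mor P Q) g). Qed.

Lemma pmap_inj P Q (f g : rHom (pobj P) (pobj Q)) : pmap f = pmap g -> f = g.
Proof. by case: eF => fF _ _; apply: fF. Qed.

Lemma pmap_full P Q (u : rHom (pobj (F P)) (pobj (F Q))) : exists f, u = pmap f.
Proof. by case: eF => _ uF _; apply: uF. Qed.

(* F extends to modules by X |-> Z = coker (F d), where d presents X; [indR] below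
   is the graph of this extension on morphisms. *)
Record pres (X : rmodType A) (Z : rmodType B) := Pres {
  pres1 : projcat A; pres0 : projcat A;
  pd : rHom (pobj pres1) (pobj pres0);
  ppi : rHom (pobj pres0) X;
  prho : rHom (pobj (F pres0)) Z;
  ppi_epi : epi ppi; ppi_exact : exact pd ppi;
  prho_epi : epi prho; prho_exact : exact (pmap pd) prho }.

Lemma pres_ex X : exists Z, inhabited (pres X Z).
Proof.
have [P0 [pi [/projective_regular pP0 epi0]]] := free_cover X.
have [K [i [mi xi]]] := ker_ex pi.
have [P1 [q [/projective_regular pP1 epi1]]] := free_cover K.
pose Q1 : projcat A := exist _ (P1 : modcat A) pP1.
pose Q0 : projcat A := exist _ (P0 : modcat A) pP0.
have [Z [rho [er xr]]] := coker_ex (pmap (P := Q1) (Q := Q0) (i \* q)).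
exists Z; split; apply: (@Pres X Z Q1 Q0 (i \* q) pi rho) => // v.
rewrite (xi v); split=> [[u <-]|[u <-]]; last by exists (q u); rewrite rcompE.
by have [w <-] := epi1 u; exists w; rewrite rcompE.
Qed.

Lemma proj_dense (Q : rmodType B) : projective Q ->
  exists (P : projcat A) (f : rHom (pobj (F P)) Q) (g : rHom Q (pobj (F P))),
    g \* f = rid _ /\ f \* g = rid _.
Proof.
case: eF => _ _ dF pQ; have [P [f [g [gf fg]]]] := dF (exist _ (Q : modcat B) pQ).
by exists P, f, g.
Qed.

Lemma pres_dense Z : exists X, inhabited (pres X Z).
Proof.
have [P0 [rho0 [/projective_regular pP0 epi0]]] := free_cover Z.
have [K [i [mi xi]]] := ker_ex rho0.
have [P1 [q [/projective_regular pP1 epi1]]] := free_cover K.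
have [Q1 [f1 [g1 [gf1 fg1]]]] := proj_dense pP1.
have [Q0 [f0 [g0 [gf0 fg0]]]] := proj_dense pP0.
have [d dE] := pmap_full (g0 \* (i \* q) \* f1).
have [X [pi [epi xpi]]] := coker_ex d.
exists X; split; apply: (@Pres X Z Q1 Q0 d pi (rho0 \* f0)) => //.
  move=> z; have [v <-] := epi0 z; exists (g0 v).
  by rewrite rcompE -(rcompE f0) fg0 ridE.
move=> v; rewrite -dE rcompE (xi (f0 v)); split=> [[u uE]|[u <-]].
  have [w wE] := epi1 u; exists (g1 w).
  rewrite !rcompE -(rcompE f1) fg1 ridE wE uE.
  by rewrite -(rcompE g0) gf0 ridE.
by exists (q (f1 u)); rewrite -[in RHS]rcompE !rcompA fg0 rcomp1m !rcompE.
Qed.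

Definition indR X Z X' Z' (p : pres X Z) (p' : pres X' Z') (f : rHom X X')
    (g : rHom Z Z') :=
  exists f0, ppi p' \* f0 = f \* ppi p /\ prho p' \* pmap f0 = g \* prho p.

Lemma ind_total X Z X' Z' (p : pres X Z) (p' : pres X' Z') f :
  exists g, indR p p' f g.
Proof.
have [f0 f0E] := (projectiveE _).1 (svalP (pres0 p)) _ _ (ppi p') (f \* ppi p) (@ppi_epi _ _ p').
have [|f1 f1E] := @proj_exact_lift _ _ _ _ _ (pd p') (ppi p') (f0 \* pd p)
    (svalP (pres1 p)) (@ppi_exact _ _ p').
  by rewrite rcompA -f0E -rcompA (exact_comp (@ppi_exact _ _ p)) rcomp0r.
have [|g gE] := @factor_coker _ _ _ _ _ _ (pmap (pd p)) (prho p) (prho p' \* pmap f0)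
    (@prho_epi _ _ p) (@prho_exact _ _ p).
  rewrite -rcompA -pmapM f1E pmapM rcompA (exact_comp (@prho_exact _ _ p')).
  by rewrite rcomp0l.
by exists g, f0.
Qed.

Lemma ind_full X Z X' Z' (p : pres X Z) (p' : pres X' Z') g :
  exists f, indR p p' f g.
Proof.
have [u uE] := (projectiveE _).1 (svalP (F (pres0 p))) _ _ (prho p') (g \* prho p)
  (@prho_epi _ _ p').
have [f0 f0E] := pmap_full u.
have [|v vE] := @proj_exact_lift _ _ _ _ _ (pmap (pd p')) (prho p') (pmap (f0 \* pd p))
    (svalP (F (pres1 p))) (@prho_exact _ _ p').
  rewrite pmapM -f0E rcompA -uE -rcompA (exact_comp (@prho_exact _ _ p)).
  by rewrite rcomp0r.
have [f1 f1E] := pmap_full v.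
have e : f0 \* pd p = pd p' \* f1 by apply: pmap_inj; rewrite vE f1E pmapM.
have [|f fE] := @factor_coker _ _ _ _ _ _ (pd p) (ppi p) (ppi p' \* f0)
    (@ppi_epi _ _ p) (@ppi_exact _ _ p).
  by rewrite -rcompA e rcompA (exact_comp (@ppi_exact _ _ p')) rcomp0l.
by exists f, f0; rewrite -f0E uE.
Qed.

(** Each side says that the map factors through the presentation, before or after applying F; the
    two factorizations correspond because F is full and faithful. *)
Lemma ind_zero X' Z' (p' : pres X' Z') (P : projcat A) (f : rHom (pobj P) (pobj (pres0 p'))) :
  ppi p' \* f = 0 <-> prho p' \* pmap f = 0.
Proof.
split=> [/(proj_exact_lift (svalP P) (@ppi_exact _ _ p'))[s ->] |
         /(proj_exact_lift (svalP (F P)) (@prho_exact _ _ p'))[s fE]].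
  by rewrite pmapM rcompA (exact_comp (@prho_exact _ _ p')) rcomp0l.
have [t tE] := pmap_full s.
have -> : f = pd p' \* t by apply: pmap_inj; rewrite fE tE pmapM.
by rewrite rcompA (exact_comp (@ppi_exact _ _ p')) rcomp0l.
Qed.

(** One implication makes the extended functor well defined, the other makes it faithful. *)
Lemma ind_uniq X Z X' Z' (p : pres X Z) (p' : pres X' Z') f f' g g' :
  indR p p' f g -> indR p p' f' g' -> f = f' <-> g = g'.
Proof.
move=> [f0 [e1 e2]] [f0' [e1' e2']].
have k1 : ppi p' \* (f0 - f0') = (f - f') \* ppi p by rewrite rcompBr rcompBl e1 e1'.
have k2 : prho p' \* pmap (f0 - f0') = (g - g') \* prho p.
  by rewrite pmapB rcompBr rcompBl e2 e2'.
split=> [ff | gg].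
  apply/eqP; rewrite -subr_eq0; apply/eqP/(epi_rcompI (@prho_epi _ _ p)).
  by rewrite rcomp0l -k2; apply/ind_zero; rewrite k1 ff subrr rcomp0l.
apply/eqP; rewrite -subr_eq0; apply/eqP/(epi_rcompI (@ppi_epi _ _ p)).
by rewrite rcomp0l -k1; apply/ind_zero; rewrite k2 gg subrr rcomp0l.
Qed.

Lemma ind_comp X Z X' Z' X'' Z'' (p : pres X Z) (p' : pres X' Z') (p'' : pres X'' Z'')
    f g f' g' :
  indR p p' f g -> indR p' p'' f' g' -> indR p p'' (f' \* f) (g' \* g).
Proof.
move=> [f0 [e1 e2]] [f0' [e1' e2']]; exists (f0' \* f0); split.
  by rewrite rcompA e1' -!rcompA e1.
by rewrite pmapM rcompA e2' -!rcompA e2.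
Qed.

Lemma ind_id X Z (p : pres X Z) : indR p p (rid X) (rid Z).
Proof. by exists (rid _); rewrite pmap1 !rcomp1m !rcompm1. Qed.

Lemma ind_add X Z X' Z' (p : pres X Z) (p' : pres X' Z') f g f' g' :
  indR p p' f g -> indR p p' f' g' -> indR p p' (f + f') (g + g').
Proof.
move=> [f0 [e1 e2]] [f0' [e1' e2']]; exists (f0 + f0').
by rewrite pmapD !rcompDr !rcompDl e1 e2 e1' e2'.
Qed.

Lemma extend_equivalence : equivalent (modcat A) (modcat B).
Proof.
have /all_tag[Zo pr] (X : modcat A) : {Z : modcat B & pres X Z}.
  have /cid[Z iZ] := pres_ex X; exists Z; case: (cid (P := fun _ : pres X Z => True)) => //.
  by case: iZ => p; exists p.
have /all_tag[Fm FmE] (XY : modcat A * modcat A) :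
    {h : rHom (XY.1 : rmodType A) XY.2 -> rHom (Zo XY.1 : rmodType B) (Zo XY.2) |
      forall f, indR (pr XY.1) (pr XY.2) f (h f)}.
  by apply/all_sig => f; apply/cid/ind_total.
have H1 X : Fm (X, X) (rid X) = rid (Zo X).
  by apply/(ind_uniq (FmE (X, X) (rid X)) (ind_id (pr X))).
have HM X Y Z (g : rHom Y Z) (f : rHom X Y) : Fm (X, Z) (g \* f) = Fm (Y, Z) g \* Fm (X, Y) f.
  exact/(ind_uniq (FmE (X, Z) (g \* f)) (ind_comp (FmE (X, Y) f) (FmE (Y, Z) g))).
have HD X Y (f g : rHom X Y) : Fm (X, Y) (f + g) = Fm (X, Y) f + Fm (X, Y) g.
  exact/(ind_uniq (FmE (X, Y) (f + g)) (ind_add (FmE (X, Y) f) (FmE (X, Y) g))).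
pose Fh := @AddFunctor (modcat A) (modcat B) Zo (fun X Y f => Fm (X, Y) f) H1 HM HD.
apply/equivalentP; exists Fh; split=> [X Y f g fg | X Y u | Z].
- exact/(ind_uniq (FmE (X, Y) f) (FmE (X, Y) g)).
- have [f fE] := ind_full (pr X) (pr Y) u; exists f.
  exact/(ind_uniq fE (FmE (X, Y) f)).
have [X [q]] := pres_dense Z; exists X.
(* [pr X] and [q] are presentations of the same X with possibly different modules over B; the
   identity of X induces inverse maps between these. *)
have [e eE] := ind_total (pr X) q (rid X); have [e' e'E] := ind_total q (pr X) (rid X).
exists e, e'; split.
  by apply/(ind_uniq (ind_comp eE e'E) (ind_id (pr X))); rewrite rcomp1m.
by apply/(ind_uniq (ind_comp e'E eE) (ind_id q)); rewrite rcomp1m.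
Qed.

End Extend.

Lemma morita_projcatP (k : fieldType) (A B : fdAlgType k) :
  morita_equivalent A B <-> equivalent (projcat A) (projcat B).
Proof.
split; first exact: morita_projcat.
by move/equivalentP => [F]; apply: extend_equivalence.
Qed.

Lemma addcat_morita (k : fieldType) (A B : fdAlgType k) (M : rmodType A) (N : rmodType B) :
  equivalent (addcat M) (addcat N) <-> morita_equivalent (endalg M) (endalg N).
Proof.
have eM := equivalence_equivalent (hom_add_proj_equivalence M).
have eN := equivalence_equivalent (hom_add_proj_equivalence N).
rewrite morita_projcatP; split=> e.
  exact: equivalent_trans (equivalent_sym eM) (equivalent_trans e eN).
exact: equivalent_trans eM (equivalent_trans e (equivalent_sym eN)).
Qed.

(** * The correspondence *)

Section AddCategory.

Variables (k : fieldType) (A : fdAlgType k) (M : rmodType A).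

Lemma addcat_additive : is_additive (addcat M).
Proof.
move=> n X; have [S [i [p [H1 H2 H3]]]] := biprod_ex (fun j => sval (X j) : rmodType A).
have aS : in_add (M : modcat A) S.
  by apply/in_addE/(addp_sum H3) => j; apply/in_addE/(svalP (X j)).
by exists (exist _ (S : modcat A) aS), i, p.
Qed.

Lemma addcat_generator : has_additive_generator (addcat M).
Proof.
have aM : in_add (M : modcat A) M by apply/in_addE/addp_refl.
exists (exist _ (M : modcat A) aM) => -[X /= /[dup] /in_addE aX aX'].
have [n [S [i [p [H1 H2 rX]]]]] := addp_retract aX.
have aS : addp M S by exists n, i, p.
have [Y [i' [p' [E1 E2 E3]]]] := retract_summand rX.
(* In a full subcategory the complement of a summand must itself be an object, so it too has to lie
   in add M. *)
have aY : in_add (M : modcat A) Y.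
  by apply/in_addE/(retract_addp _ aS); exists (i' false), (p' false); exact: (E1 false).
exists n, (exist _ (S : modcat A) ((in_addE M S).2 aS)); split.
  exists i, p; split=> // [j | j l jl]; rewrite [LHS]H1 ?eqxx //.
  by rewrite (negPf jl).
pose F b : addcat M := if b then exist _ X aX' else exist _ Y aY.
exists (exist _ Y aY).
pose inj b : mor (F b) (exist _ (S : modcat A) ((in_addE M S).2 aS)) :=
  match b with true => i' true | false => i' false end.
pose prj b : mor (exist _ (S : modcat A) ((in_addE M S).2 aS) : addcat M) (F b) :=
  match b with true => p' true | false => p' false end.
exists inj, prj; split=> [[]|[] [] //|].
- exact: (E1 true).
- exact: (E1 false).
- by move=> _; apply: (E2 true false).
- by move=> _; apply: (E2 false true).
- by rewrite -[RHS]E3 !big_bool.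
Qed.

End AddCategory.

(** The cluster tilting subcategory P equals add M, where M is the image of the generator: density
    gives one inclusion, and the other holds because membership in P is a vanishing condition on
    Ext, inherited by add M. *)
Lemma ct_equivalent_add (k : fieldType) n (C : preadditive) :
  ct_category k n C -> has_additive_generator C ->
  exists (A : fdAlgType k) (M : rmodType A), ct_object n M /\ equivalent C (addcat M).
Proof.
move=> [_ [A [P [ctP CP]]]] [X gX]; have /equivalentP[F [_ _ dF]] := CP.
have gM := dense_generator dF gX; case: (F X) gM => M pM gM.
suff PM : P = in_add (M : modcat A).
  by exists A, M; rewrite /ct_object /addcat -PM.
case: (ctP) => _ _ H; apply: funext => Y; apply: propext; split=> [pY | /in_addE aY].
  have [n' [p [q pq]]] := gM (exist _ Y pY).
  by apply/in_addE; exists n', p, q.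
apply/H => D [|i] // pD im; apply/ext_vanishesE/(ez_addl aY).
by apply/ext_vanishesE; have /H := pM; apply.
Qed.

Lemma addcat_ct (k : fieldType) n (A : fdAlgType k) (M : rmodType A) :
  ct_object n M -> ct_category k n (addcat M).
Proof.
move=> ctM; split; first exact: addcat_additive.
by exists A, (in_add (M : modcat A)); split=> //; apply: equivalent_refl.
Qed.

(** The maps [u] and [v] are identities; they keep the carrier V and the new module apart. *)
Lemma rmod_of_action (k : fieldType) (B : fdAlgType k) (V : vectType k) (act : V -> B -> V) :
  (forall c u v a, act (c *: u + v) a = c *: act u a + act v a) ->
  (forall c v a b, act v (c *: a + b) = c *: act v a + act v b) ->
  (forall v, act v 1 = v) -> (forall v a b, act v (a * b) = act (act v a) b) ->
  exists (Y : rmodType B) (u : V -> Y) (v : Y -> V),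
  [/\ linear u, linear v, cancel u v, cancel v u &
      forall x b, u (act x b) = ract (u x) b].
Proof.
move=> h1 h2 h3 h4.
pose Y : rmodType B := HB.pack (Vector.sort V) (isRModule.Build k B V h1 h2 h3 h4).
by exists Y, id, id; split.
Qed.

Lemma linear_at0 (k : fieldType) (V W : vectType k) (F : V -> W) : linear F -> F 0 = 0.
Proof. by move=> lF; have [f <-] := linfun_ex lF; exact: linear0. Qed.

Lemma restriction_ex (k : fieldType) (A B : fdAlgType k) (h : B -> A) (X : rmodType A) :
  linear h -> h 1 = 1 -> (forall a b, h (a * b) = h a * h b) ->
  exists (Y : rmodType B) (u : X -> Y) (v : Y -> X),
  [/\ linear u, linear v, cancel u v, cancel v u &
      forall x b, u (ract x (h b)) = ract (u x) b].
Proof.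
move=> lh h1 hM.
apply: (@rmod_of_action k B X (fun x b => ract x (h b))) => [c x y b|c x a b|x|x a b].
- exact: ract_linearl.
- by rewrite lh ract_linearr.
- by rewrite h1 ract1.
- by rewrite hM ractM.
Qed.

(** The equivalence is restriction of scalars along the inverse [g]; restriction along [f] provides
    the preimages of objects. *)
Lemma morita_iso (k : fieldType) (A B : fdAlgType k) :
  fdalg_iso A B -> morita_equivalent A B.
Proof.
move=> [f [[g fK gK] f1 fM]].
have glin : linear g by move=> c a b; apply: (can_inj fK); rewrite gK linearP !gK.
have g1 : g 1 = 1 by apply: (can_inj fK); rewrite gK f1.
have gM a b : g (a * b) = g a * g b by apply: (can_inj fK); rewrite fM !gK.
have /all_tag[R /all_tag[u /all_sig[v uv]]] (X : rmodType A) :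
    {Y : rmodType B & {u : X -> Y & {v : Y -> X |
      [/\ linear u, linear v, cancel u v, cancel v u &
      forall x b, u (ract x (g b)) = ract (u x) b]}}}.
  by have /cid[Y /cid[u /cid[v uv]]] := restriction_ex X glin g1 gM; exists Y, u, v.
have lF (X Y : rmodType A) (h : rHom X Y) : linear (fun x : R X => u Y (h (v X x))).
  case: (uv X) (uv Y) => _ lv _ _ _ [lu _ _ _ _] c x y.
  by rewrite lv rHomD rHomZ lu.
have eF (X Y : rmodType A) (h : rHom X Y) (x : R X) b :
    u Y (h (v X (ract x b))) = ract (u Y (h (v X x))) b.
  case: (uv X) (uv Y) => _ _ uK vK ue [_ _ _ _ ue'].
  by rewrite -ue' -rHomE -{1}[x]vK -ue uK.
pose Fm X Y h := rHom_of (lF X Y h) (eF X Y h).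
have FmE X Y h x : Fm X Y h x = u Y (h (v X x)) by apply: rHom_ofE.
have H1 X : Fm X X (rid X) = rid (R X).
  by apply: rHom_inj => x; rewrite FmE !ridE; case: (uv X).
have HM X Y Z (h' : rHom Y Z) (h : rHom X Y) : Fm X Z (h' \* h) = Fm Y Z h' \* Fm X Y h.
  by apply: rHom_inj => x; rewrite !(FmE, rcompE); case: (uv Y) => _ _ ->.
have HD X Y (h h' : rHom X Y) : Fm X Y (h + h') = Fm X Y h + Fm X Y h'.
  apply: rHom_inj => x; rewrite !(FmE, rHomDE); case: (uv Y) => lu _ _ _ _.
  by rewrite -[h _]scale1r lu !scale1r.
apply/equivalentP; exists (@AddFunctor (modcat A) (modcat B) R Fm H1 HM HD).
split=> [X Y h h' e | X Y h0 | Y].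
- apply: rHom_inj => x; case: (uv X) (uv Y) => _ _ uK _ _ [_ _ uK' _ _].
  have := rHom_ext e (u X x); rewrite /= [LHS]FmE [RHS]FmE uK.
  by move/(can_inj uK').
- pose h : rHom (R X) (R Y) := h0.
  case: (uv X) (uv Y) => lu lv uK vK ue [lu' lv' uK' vK' ue'].
  have lh : linear (fun x : X => v Y (h (u X x))).
    by move=> c x y; rewrite lu rHomD rHomZ lv'.
  have eh (x : X) a : v Y (h (u X (ract x a))) = ract (v Y (h (u X x))) a.
    apply: (can_inj uK'); rewrite vK' -[a]fK ue rHomE.
    by rewrite ue' vK'.
  exists (rHom_of lh eh); apply: rHom_inj => x.
  transitivity (Fm X Y (rHom_of lh eh) x) => //.
  by rewrite FmE rHom_ofE vK' vK.
have [X [u' [v' [lu lv uK vK ue]]]] := restriction_ex Y (linearP f) f1 fM.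
have [lu1 lv1 uK1 vK1 ue1] := uv X.
have lf : linear (fun y : R X => v' (v X y)) by move=> c x y; rewrite lv1 lv.
have ef (y : R X) b : v' (v X (ract y b)) = ract (v' (v X y)) b.
  apply: (can_inj uK); rewrite vK -[b in RHS]gK ue vK.
  by apply: (can_inj uK1); rewrite vK1 ue1 vK1.
have [||w [wf fw]] := @iso_ex _ _ _ _ (rHom_of lf ef).
- move=> y; rewrite rHom_ofE => y0; rewrite -[y]vK1 -[v X y]vK y0.
  by rewrite (linear_at0 lu) (linear_at0 lu1).
- by move=> y; exists (u X (u' y)); rewrite rHom_ofE uK1 uK.
by exists X, (rHom_of lf ef); exists w.
Qed.

Lemma morita_eq (k : fieldType) (A B : fdAlgType k) :
  morita_equivalent A B -> morita_equivalent A = morita_equivalent B.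
Proof.
move=> AB; apply: funext => D; apply: propext.
by split; apply: equivalent_trans => //; apply: equivalent_sym.
Qed.

Theorem theorem2p6 (k : fieldType) (n : nat) (n_ge1 : (1 <= n)%N) :
  (forall (L : fdAlgType k) (M : rmodType L),
     ct_object n M -> auslander_algebra n (endalg M))
  /\
  (forall G : fdAlgType k, auslander_algebra n G ->
     exists (L : fdAlgType k) (M : rmodType L),
       ct_object n M /\ fdalg_iso G (endalg M))
  /\
  (exists Phi : (preadditive -> Prop) -> (fdAlgType k -> Prop),
     (forall (L : fdAlgType k) (M : rmodType L), ct_object n M ->
        Phi (equivalent (addcat M)) = morita_equivalent (endalg M))
     /\
     bijection_on
       (classes equivalent
          (fun C => ct_category k n C /\ has_additive_generator C))
       (classes (@morita_equivalent k) (auslander_algebra n))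
       Phi).
Proof.
split=> [L M ctM | ]; first exact: endalg_auslander.
split=> [G aG | ]; first exact: auslander_surj.
(* [Phi] is given by its graph, so it is defined on every predicate without choosing a
   representative M; independence of M is [addcat_morita]. *)
pose Phi (c : preadditive -> Prop) (B : fdAlgType k) := exists (L : fdAlgType k)
  (M : rmodType L), [/\ ct_object n M, c = equivalent (addcat M) &
     morita_equivalent (endalg M) B].
have PhiE (L : fdAlgType k) (M : rmodType L) : ct_object n M ->
    Phi (equivalent (addcat M)) = morita_equivalent (endalg M).
  move=> ctM; apply: funext => B; apply: propext; split=> [[L' [M' [ctM' e m]]] | m].
    have : equivalent (addcat M) (addcat M') by rewrite e; apply: equivalent_refl.
    by move/addcat_morita/equivalent_trans; apply.
  by exists L, M.
have rep c : classes equivalent (fun C => ct_category k n C /\ has_additive_generator C) c ->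
    exists (L : fdAlgType k) (M : rmodType L), ct_object n M /\ c = equivalent (addcat M).
  move=> [C [ctC gC] ->]; have [L [M [ctM CM]]] := ct_equivalent_add ctC gC.
  by exists L, M; split=> //; apply: equivalent_eq.
exists Phi; split=> //; split=> [c /rep[L [M [ctM ->]]] | c c' | c [G aG ->]].
- by rewrite PhiE //; exists (endalg M) => //; apply: endalg_auslander.
- move=> /rep[L [M [ctM ->]]] /rep[L' [M' [ctM' ->]]]; rewrite !PhiE // => e.
  apply/equivalent_eq/addcat_morita.
  by rewrite e; apply: equivalent_refl.
have [L [M [ctM iG]]] := auslander_surj n_ge1 aG.
exists (equivalent (addcat M)).
  by exists (addcat M) => //; split; [exact: addcat_ct | exact: addcat_generator].
by rewrite PhiE //; apply/esym/morita_eq/morita_iso.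
Qed.
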